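(* Let $R$ be the Riemann curvature tensor of a Riemannian manifold $(M,g)$ of dimension $n$, let $k$ be an integer with $0\leq 2k\leq n-2$, and let $$N_{2k}(R)=*\frac{g^{n-2k-2}R^k}{(n-2k-2)!}.$$ Then $N_{2k}(R)$ is a divergence free symmetric $(2,2)$ double form that satisfies the first Bianchi identity. Moreover, $$c\,N_{2k}(R)=(n-2k-1)\,T_{2k}\qquad\text{and}\qquad c^2N_{2k}(R)=(n-2k)(n-2k-1)\,h_{2k}.$$
   Context: A $(p,q)$ double form on $(M,g)$ is a section of $\Lambda^pT^*M\otimes\Lambda^qT^*M$. Juxtaposition and powers denote the exterior (Kulkarni–Nomizu) product $(\omega_1\otimes\omega_2)(\theta_1\otimes\theta_2)=(\omega_1\wedge\theta_1)\otimes(\omega_2\wedge\theta_2)$; thus $g^k(x_1,\dots,x_k;y_1,\dots,y_k)=k!\det[g(x_i,y_j)]$. The contraction is $c\,\omega(x_2,\dots;y_2,\dots)=\sum_i\omega(e_i,x_2,\dots;e_i,y_2,\dots)$ for an orthonormal basis $(e_i)$. $*(\omega_1\otimes\omega_2)=( *\omega_1)\otimes( *\omega_2)$ is the Hodge operator. $R$ is regarded as a $(2,2)$ double form with $R(x,y;x,y)$ the sectional curvature for orthonormal $x,y$. A symmetric $(2,2)$ double form $\omega$ satisfies the first Bianchi identity if $\omega(x,y;z,u)+\omega(y,z;x,u)+\omega(z,x;y,u)=0$, and is divergence free if $\sum_i(\nabla_{e_i}\omega)(e_i,x;y,z)=0$ for all $x,y,z$. The $(2k)$-th Gauss–Bonnet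 curvature is $h_{2k}=\frac{1}{(n-2k)!}*(g^{n-2k}R^k)=\frac{c^{2k}R^k}{(2k)!}$ ($h_0=1$), and the $(2k)$-th Einstein–Lovelock tensor is $T_{2k}=*\frac{g^{n-2k-1}R^k}{(n-2k-1)!}$, which equals $h_{2k}g-\frac{c^{2k-1}R^k}{(2k-1)!}$ for $k\ge1$ and $g$ for $k=0$. *)

(* Defs.v *)
From mathcomp Require Import all_boot all_order all_algebra all_fingroup.
From mathcomp Require Import all_classical all_reals all_analysis.
Import Order.TTheory GRing.Theory Num.Theory numFieldNormedType.Exports.

Set Implicit Arguments.
Unset Strict Implicit.
Unset Printing Implicit Defensive.

Local Open Scope classical_set_scope.
Local Open Scope ring_scope.

(** * Double forms on the vector space 'rV_n *)

(* A (p, q) double form takes p + q vectors; they are the rows of two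
   matrices. An element of Lambda^p V^* (x) Lambda^q V^* is such a function
   that is multilinear and alternating in the rows of each argument
   ([double_form_at] below). *)
Definition dform (R : realType) (n p q : nat) :=
  'M[R]_(p, n) -> 'M[R]_(q, n) -> R.

(* Same formulation as [determinant_multilinear], [determinant_alternate]. *)
Definition multilinear_rows (R : realType) (n p : nat)
    (f : 'M[R]_(p, n) -> R) :=
  forall (A B C : 'M[R]_(p, n)) (i : 'I_p) (b c : R),
    row i A = b *: row i B + c *: row i C ->
    row' i B = row' i A -> row' i C = row' i A ->
    f A = b * f B + c * f C.

Definition alternating_rows (R : realType) (n p : nat)
    (f : 'M[R]_(p, n) -> R) :=
  forall (A : 'M[R]_(p, n)) (i j : 'I_p), i != j -> row i A = row j A ->
    f A = 0.

Definition double_form_at (R : realType) (n p q : nat) (w : dform R n p q) :=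
  (forall Y, multilinear_rows (w ^~ Y) /\ alternating_rows (w ^~ Y)) /\
  (forall X, multilinear_rows (w X) /\ alternating_rows (w X)).

(* The wedge products are normalised by
   (a /\ b)(x_1 .. x_(p+r)) = (p! r!)^-1 \sum_s sgn(s) a(x_s(1) ..) b(..),
   so that g^k (x; y) = k! det (g (x_i, y_j)). *)
Definition wedge (R : realType) (n p q r s : nat)
    (w : dform R n p q) (t : dform R n r s) : dform R n (p + r) (q + s) :=
  fun X Y => ((p`! * r`! * (q`! * s`!))%:R)^-1 *
    \sum_(a : 'S_(p + r)) \sum_(b : 'S_(q + s))
      (-1) ^+ a * (-1) ^+ b *
      (w (usubmx (row_perm a X)) (usubmx (row_perm b Y)) *
       t (dsubmx (row_perm a X)) (dsubmx (row_perm b Y))).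

Fixpoint dpow (R : realType) (n p q : nat) (w : dform R n p q) (k : nat) :
    dform R n (k * p) (k * q) :=
  if k is j.+1 then wedge w (@dpow R n p q w j) else fun _ _ => 1.
Arguments dpow {R n p q} w k : rename.

(** * Operations depending on an inner product *)

(* The inner product is given by its Gram matrix G: <x, y> = x G y^T. *)
Definition posdef (R : realType) (n : nat) (G : 'M[R]_n) :=
  G^T = G /\ forall v : 'rV[R]_n, v != 0 -> 0 < (v *m G *m v^T) 0 0.

Definition metric_form (R : realType) (n : nat) (G : 'M[R]_n) : dform R n 1 1 :=
  fun X Y => (X *m G *m Y^T) 0 0.

(* The rows of [onb G] form some orthonormal basis. *)
Definition onb (R : realType) (n : nat) (G : 'M[R]_n) : 'M[R]_n :=
  xget 1%:M [set E : 'M[R]_n | E *m G *m E^T = 1%:M].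

Definition contr (R : realType) (n p q : nat) (G : 'M[R]_n)
    (w : dform R n p.+1 q.+1) : dform R n p q :=
  fun X Y => \sum_(i < n) w (col_mx (row i (onb G)) X : 'M[R]_(1 + p, n))
                            (col_mx (row i (onb G)) Y : 'M[R]_(1 + q, n)).

(* The volume form sqrt(det G) dx_1 /\ .. /\ dx_n evaluated on the rows of W.
   It is used only for m = n; [conform_mx] replaces a cast and makes the value
   0 on other sizes (when 0 < n). *)
Definition vol (R : realType) (n m : nat) (G : 'M[R]_n) (W : 'M[R]_(m, n)) : R :=
  Num.sqrt (\det G) * \det (conform_mx (0 : 'M[R]_n) W).

(* On p-forms, with e an orthonormal basis,
     ( *a)(v_1 .. v_(n-p)) =
       (p!)^-1 \sum_(i_1 .. i_p) a(e_i1 .. e_ip) vol(e_i1 .. e_ip, v_1 .. v_(n-p)),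
   i.e. a' /\ *a = <a', a> vol. Applied on both sides; a change of
   orientation changes both volume factors and has no effect.
   To be used with p + r = n and q + s = n. *)
Definition hodge (R : realType) (n p q : nat) (G : 'M[R]_n) (r s : nat)
    (w : dform R n p q) : dform R n r s :=
  fun X Y => ((p`! * q`!)%:R)^-1 *
    \sum_(I : {ffun 'I_p -> 'I_n}) \sum_(J : {ffun 'I_q -> 'I_n})
      w (rowsub I (onb G)) (rowsub J (onb G)) *
      vol G (col_mx (rowsub I (onb G)) X) * vol G (col_mx (rowsub J (onb G)) Y).
Arguments hodge {R n p q} G r s w.

(* In these three definitions Rm is the curvature tensor. *)
Definition gauss_bonnet (R : realType) (n : nat) (G : 'M[R]_n)
    (Rm : dform R n 2 2) (k : nat) : R :=
  ((n - 2 * k)`!%:R)^-1 *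
  hodge G 0 0 (wedge (dpow (metric_form G) (n - 2 * k)) (dpow Rm k)) 0 0.

Definition einstein_lovelock (R : realType) (n : nat) (G : 'M[R]_n)
    (Rm : dform R n 2 2) (k : nat) : dform R n 1 1 :=
  fun X Y => ((n - 2 * k - 1)`!%:R)^-1 *
  hodge G 1 1 (wedge (dpow (metric_form G) (n - 2 * k - 1)) (dpow Rm k)) X Y.

Definition Nform (R : realType) (n : nat) (G : 'M[R]_n)
    (Rm : dform R n 2 2) (k : nat) : dform R n 2 2 :=
  fun X Y => ((n - 2 * k - 2)`!%:R)^-1 *
  hodge G 2 2 (wedge (dpow (metric_form G) (n - 2 * k - 2)) (dpow Rm k)) X Y.

(** * Calculus in a chart *)

Definition iter_partial (R : realType) (n : nat) (s : seq 'I_n)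
    (f : 'rV[R]_n -> R) : 'rV[R]_n -> R :=
  foldr (fun i h => fun x => 'D_(delta_mx 0 i) h x) f s.

(* f is infinitely differentiable at the points of the open set U. *)
Definition smooth_on (R : realType) (n : nat) (U : set 'rV[R]_n)
    (f : 'rV[R]_n -> R) :=
  forall s x, U x -> differentiable (iter_partial s f) x.

Section Local.
Variables (R : realType) (n : nat).
Local Notation V := 'rV[R]_n.
(* the Gram matrix of the metric in the coordinates *)
Variable G : V -> 'M[R]_n.

Definition partial_metric (l i j : 'I_n) (x : V) : R :=
  'D_(delta_mx 0 l) (fun y => G y i j) x.

Definition christoffel (x : V) (l i j : 'I_n) : R :=
  2^-1 * \sum_(m < n) (invmx (G x)) l m *
    (partial_metric i j m x + partial_metric j i m x - partial_metric m i j x).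

Definition christoffel_vec (x v w : V) : V :=
  \row_l \sum_(i < n) \sum_(j < n) christoffel x l i j * v 0 i * w 0 j.

(* The Levi-Civita connection: covariant derivative at x of a vector field W
   in the direction v. *)
Definition nabla (v : V) (W : V -> V) (x : V) : V :=
  'D_v W x + christoffel_vec x v (W x).

(* R(u, v)w; the vectors are extended as constant fields in the coordinates,
   whose brackets vanish. *)
Definition curv_op (u v w x : V) : V :=
  nabla u (nabla v (fun=> w)) x - nabla v (nabla u (fun=> w)) x.

(* R(x, y; z, u) = <R(x, y)u, z>, so that R(x, y; x, y) is the sectional
   curvature for orthonormal x, y. *)
Definition curvature (x : V) : dform R n 2 2 := fun X Y =>
  metric_form (G x) (curv_op (row 0 X) (row 1 X) (row 1 Y) x) (row 0 Y).

Definition set_row (p : nat) (X : 'M[R]_(p, n)) (i : 'I_p) (v : V) :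
    'M[R]_(p, n) :=
  \matrix_(j < p) (if j == i then v else row j X).

(* (nabla_v w)(X; Y), with the rows of X and Y extended as constant fields. *)
Definition cov_deriv (p q : nat) (w : V -> dform R n p q) (x v : V) :
    dform R n p q :=
  fun X Y => 'D_v (fun y => w y X Y) x
    - \sum_(i < p) w x (set_row X i (christoffel_vec x v (row i X))) Y
    - \sum_(j < q) w x X (set_row Y j (christoffel_vec x v (row j Y))).

End Local.

(** * Riemannian manifolds *)

Record smooth_manifold (R : realType) (n : nat) := SmoothManifold {
  carrier :> topologicalType;
  hausdorff_carrier : hausdorff_space carrier;
  second_countable_carrier : @second_countable carrier;
  chart : Type;
  chart_dom : chart -> set carrier;
  chart_coord : chart -> carrier -> 'rV[R]_n;
  chart_param : chart -> 'rV[R]_n -> carrier;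
  chart_cover : forall p, exists a, chart_dom a p;
  open_chart_dom : forall a, open (chart_dom a);
  open_chart_img : forall a, open (chart_coord a @` chart_dom a);
  chart_coordK : forall a p, chart_dom a p ->
    chart_param a (chart_coord a p) = p;
  chart_coord_continuous : forall a p, chart_dom a p ->
    {for p, continuous (chart_coord a)};
  chart_param_continuous : forall a x, (chart_coord a @` chart_dom a) x ->
    {for x, continuous (chart_param a)};
  transition_smooth : forall a b (i : 'I_n),
    smooth_on (chart_coord a @` (chart_dom a `&` chart_dom b))
              (fun x => chart_coord b (chart_param a x) 0 i)
}.

Definition chart_img (R : realType) (n : nat) (M : smooth_manifold R n)
    (a : chart M) : set 'rV[R]_n :=
  chart_coord a @` chart_dom a.

Definition chart_overlap (R : realType) (n : nat) (M : smooth_manifold R n)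
    (a b : chart M) : set 'rV[R]_n :=
  chart_coord a @` (chart_dom a `&` chart_dom b).

Definition transition (R : realType) (n : nat) (M : smooth_manifold R n)
    (a b : chart M) (x : 'rV[R]_n) : 'rV[R]_n :=
  chart_coord b (chart_param a x).

(* Tensor fields are given by their expressions in all the charts, as functions
   of the coordinates, meaningful on [chart_img a] only. A tangent vector with
   coordinates v in the chart a has coordinates
   v *m jacobian (transition a b) x in the chart b. *)
Record riemannian_metric (R : realType) (n : nat) (M : smooth_manifold R n) :=
  RiemannianMetric {
  gram :> chart M -> 'rV[R]_n -> 'M[R]_n;
  metric_smooth : forall a i j, smooth_on (chart_img a) (fun x => gram a x i j);
  metric_posdef : forall a x, chart_img a x -> posdef (gram a x);
  metric_transition : forall a b x, chart_overlap a b x ->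
    gram a x = jacobian (transition a b) x *m gram b (transition a b x) *m
                 (jacobian (transition a b) x)^T
}.

Section Fields.
Variables (R : realType) (n : nat) (M : smooth_manifold R n).

Definition dfield (p q : nat) := chart M -> 'rV[R]_n -> dform R n p q.

(* w is a smooth section of Lambda^p T^*M (x) Lambda^q T^*M. *)
Definition is_double_form (p q : nat) (w : dfield p q) :=
  [/\ forall a x, chart_img a x -> double_form_at (w a x),
      forall a X Y, smooth_on (chart_img a) (fun x => w a x X Y)
    & forall a b x X Y, chart_overlap a b x ->
        w a x X Y = w b (transition a b x) (X *m jacobian (transition a b) x)
                                           (Y *m jacobian (transition a b) x)].

Definition symmetric_double_form (p : nat) (w : dfield p p) :=
  forall a x X Y, chart_img a x -> w a x X Y = w a x Y X.

Definition first_bianchi (w : dfield 2 2) :=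
  forall a x, chart_img a x -> forall u v y z : 'rV[R]_n,
    w a x (col_mx u v) (col_mx y z) + w a x (col_mx v y) (col_mx u z)
    + w a x (col_mx y u) (col_mx v z) = 0.

Definition divergence_free (g : riemannian_metric M) (w : dfield 2 2) :=
  forall a x, chart_img a x -> forall u y z : 'rV[R]_n,
    let e i := row i (onb (g a x)) in
    \sum_(i < n)
      cov_deriv (g a) (w a) x (e i) (col_mx (e i) u) (col_mx y z) = 0.

Variable g : riemannian_metric M.

Definition riemann : dfield 2 2 := fun a x => curvature (g a) x.

(* The value of h_{2k} at the point with coordinates x in the chart a. *)
Definition h2k (k : nat) (a : chart M) (x : 'rV[R]_n) : R :=
  gauss_bonnet (g a x) (riemann a x) k.

Definition T2k (k : nat) : dfield 1 1 :=
  fun a x => einstein_lovelock (g a x) (riemann a x) k.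

Definition N2k (k : nat) : dfield 2 2 :=
  fun a x => Nform (g a x) (riemann a x) k.

End Fields.

(* Main.v *)
Require Import Defs.
From HB Require Import structures.
From mathcomp Require Import all_boot all_order all_algebra all_fingroup.
From mathcomp Require Import all_classical all_reals all_analysis.
From mathcomp Require Import ring lra.
Import Order.TTheory GRing.Theory Num.Theory numFieldNormedType.Exports.
Local Open Scope classical_set_scope.
Local Open Scope ring_scope.

Set Implicit Arguments.
Unset Strict Implicit.
Unset Printing Implicit Defensive.

(** The idea is to see N_2k as R^k completely contracted against Gram
    determinants. Put D_s(X; Y) = det <x_i, y_j>, the s-th power of the metric
    divided by s!, and let a (p, p) form w act on a family Psi of (s, s) forms,
    one for each s, by
      (w . Psi)_s(X; Y)
        = (p!)^-2 \sum_(I, J) w(e_I; e_J) Psi_(p+s)(e_I, X; e_J, Y)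
    for an orthonormal frame e. A wedge product acts as the composite of the
    actions of its factors ([contract_with_wedge]), the Hodge operator on
    forms of complementary degree is the action on D ([hodge_contract_with]),
    and the metric acts on D by g . D_s = (n - s) D_s ([trace_gram_det]). The
    factors coming from g^m multiply to m!, so that the dual of g^m R^k / m! is
    P_k = R . (R . (.. D)), with k actions of R ([hodge_curvature]). N_2k, T_2k
    and h_2k are this one family P_k in degrees 2, 1 and 0.

    All algebraic claims are then inductions on k over all degrees s.
    - Taking the trace commutes with the action of R, so that the trace of P_k
      in degree s + 1 is (n - 2k - s) P_k ([trace_contract_pow]).
    - For the Bianchi identity one takes the alternating sum over all rows of
      X; a further action of R adds two terms, each of which is a sum of R
      against a function with cyclic symmetry, hence zero by the Bianchi
      identity of R ([bianchi_contract_with]).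
    - Since the metric is parallel, the covariant derivative of P_k is obtained
      by differentiating the k factors R one at a time
      ([cov_deriv_contract_pow]); in the divergence each term sums the second
      Bianchi identity against an alternating function ([div_contract_pow]).

    The frame enters only through \sum_a e_a (x) e_a, the inverse of the Gram
    matrix ([contract_pow_inv_frame]). This makes P_k smooth and independent of
    the chosen frame, although the frame itself may depend wildly on the point,
    and it yields the formula that is differentiated.

    The properties of R are derived in a chart from the scalar formula
      R(u, v; z, w) = D_u G(v, w; z) - D_v G(u, w; z)
                      - <G(u, z), G(v, w)> + <G(v, z), G(u, w)>,
    where G(u, v) is the Christoffel vector and G(u, v; z) = <G(u, v), z>.
    With the Koszul formula and the symmetry of second derivatives ([schwarz]),
    the symmetries of R, both Bianchi identities and the tensoriality of R
    become polynomial identities. *)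

(** * Alternating forms on the rows of a matrix *)

Section Rows.
Variables (R : realType) (n : nat).
Local Notation V := 'rV[R]_n.

(** The lock keeps [mxE] from unfolding the block matrix, so that rows are
    reached through [vcons0] and [vconsS] only. *)
Definition vcons p (u : V) (X : 'M[R]_(p, n)) : 'M[R]_(p.+1, n) :=
  locked (col_mx u X : 'M[R]_(1 + p, n)).

Lemma vconsE p (u : V) (X : 'M[R]_(p, n)) :
  vcons u X = (col_mx u X : 'M[R]_(1 + p, n)).
Proof. by rewrite /vcons -lock. Qed.

Lemma vcons0 p (u : V) (X : 'M[R]_(p, n)) j : vcons u X ord0 j = u 0 j.
Proof.
have := col_mxEu u X 0 j; rewrite vconsE => <-; congr (col_mx u X _ j).
exact: val_inj.
Qed.

Lemma vconsS p (u : V) (X : 'M[R]_(p, n)) i j :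
  vcons u X (lift ord0 i) j = X i j.
Proof.
have := col_mxEd u X i j; rewrite vconsE => <-; congr (col_mx u X _ j).
exact: val_inj.
Qed.

Lemma row_vcons0 p (u : V) (X : 'M[R]_(p, n)) : row ord0 (vcons u X) = u.
Proof. by apply/rowP => j; rewrite mxE vcons0. Qed.

Lemma row_vconsS p (u : V) (X : 'M[R]_(p, n)) i :
  row (lift ord0 i) (vcons u X) = row i X.
Proof. by apply/rowP => j; rewrite mxE vconsS mxE. Qed.

Lemma vcons_ext p (A B : 'M[R]_(p, n)) : (forall i, row i A = row i B) -> A = B.
Proof.
by move=> H; apply/matrixP => i j; have /rowP/(_ j) := H i; rewrite !mxE.
Qed.

Lemma row_row' p (X : 'M[R]_(p.+1, n)) i j :
  row j (row' i X : 'M[R]_(p, n)) = row (lift i j) X.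
Proof. by apply/rowP => l; rewrite !mxE. Qed.

Lemma vcons_row p (X : 'M[R]_(p.+1, n)) :
  X = vcons (row ord0 X) (row' ord0 X : 'M[R]_(p, n)).
Proof.
apply: vcons_ext => i; case: (unliftP ord0 i) => [k|] ->.
  by rewrite row_vconsS row_row'.
by rewrite row_vcons0.
Qed.

Lemma row'_vcons0 p (u : V) (X : 'M[R]_(p, n)) : row' ord0 (vcons u X) = X.
Proof. by apply: vcons_ext => i; rewrite row_row' row_vconsS. Qed.

Lemma row'_vconsS p (u : V) (X : 'M[R]_(p.+1, n)) (i : 'I_p.+1) :
  row' (lift ord0 i) (vcons u X) = vcons u (row' i X : 'M[R]_(p, n)).
Proof.
apply: vcons_ext => j; rewrite row_row'; case: (unliftP ord0 j) => [k|] ->.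
  have -> : lift (lift ord0 i) (lift ord0 k) = lift ord0 (lift i k).
    by apply: val_inj; rewrite /= /bump /= !add1n ltnS -addnS.
  by rewrite !row_vconsS row_row'.
have -> : lift (lift ord0 i) ord0 = ord0 by exact: val_inj.
by rewrite !row_vcons0.
Qed.

Lemma row_set_row p (X : 'M[R]_(p, n)) i v j :
  row j (set_row X i v) = if j == i then v else row j X.
Proof. by apply/rowP => l; rewrite !mxE; case: eqP => //; rewrite mxE. Qed.

Lemma set_row_id p (X : 'M[R]_(p, n)) i : set_row X i (row i X) = X.
Proof. by apply: vcons_ext => j; rewrite row_set_row; case: eqP => // ->. Qed.

Lemma set_row_vcons0 p u (X : 'M[R]_(p, n)) v :
  set_row (vcons u X) ord0 v = vcons v X.
Proof.
apply: vcons_ext => j; rewrite row_set_row; case: (unliftP ord0 j) => [i|] ->.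
  by rewrite /= !row_vconsS.
by rewrite eqxx row_vcons0.
Qed.

Lemma set_row_vconsS p u (X : 'M[R]_(p, n)) i v :
  set_row (vcons u X) (lift ord0 i) v = vcons u (set_row X i v).
Proof.
apply: vcons_ext => j; rewrite row_set_row; case: (unliftP ord0 j) => [l|] ->.
  by rewrite (inj_eq lift_inj) !row_vconsS row_set_row.
by rewrite !row_vcons0.
Qed.

Lemma row_row_perm p (s : 'S_p) (X : 'M[R]_(p, n)) k :
  row k (row_perm s X) = row (s k) X.
Proof. by apply/rowP => j; rewrite !mxE. Qed.

Definition lin_rows p (f : 'M[R]_(p, n) -> R) :=
  forall X i c u v,
    f (set_row X i (c *: u + v)) = c * f (set_row X i u) + f (set_row X i v).

(** Replacing one row is the form of linearity that can be rewritten with: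
    the two statements differ only in how the other rows are held fixed. *)
Lemma multilinear_set_row p (f : 'M[R]_(p, n) -> R) :
  multilinear_rows f <-> lin_rows f.
Proof.
split=> [H X i c u v|H A B C i b c eA eB eC].
  rewrite -[f (set_row X i v)]mul1r; apply: (H _ _ _ i).
  - by rewrite !row_set_row eqxx scale1r.
  - by apply/matrixP => j l; rewrite !mxE eq_sym (negbTE (neq_lift i j)).
  - by apply/matrixP => j l; rewrite !mxE eq_sym (negbTE (neq_lift i j)).
have rowE D : row' i D = row' i A -> D = set_row A i (row i D).
  move=> e; apply/matrixP => j l; rewrite mxE; case: eqP => [->|/eqP ji].
    by rewrite mxE.
  have [k ->] : exists k, j = lift i k.
    by case: (unliftP i j) ji => [k ->|->]; [exists k|rewrite eqxx].
  by have /matrixP/(_ k l) := e; rewrite !mxE.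
rewrite (rowE B eB) (rowE C eC) -{1}(set_row_id A i) eA H.
congr (_ + _); have := H A i (c - 1) (row i C) (row i C).
by rewrite scalerBl scale1r subrK => ->; ring.
Qed.

Definition altform p (f : 'M[R]_(p, n) -> R) := lin_rows f /\
    alternating_rows f.

(** Expand f at the matrix both of whose rows i and j are x_i + x_j. *)
Lemma altform_tperm p (f : 'M[R]_(p, n) -> R) : altform f ->
  forall X i j, i != j -> f (row_perm (tperm i j) X) = - f X.
Proof.
move=> [fl fa] X i j ij.
pose M u v := set_row (set_row X i u) j v.
have Mi u v : row i (M u v) = u by rewrite !row_set_row (negbTE ij) eqxx.
have Mj u v : row j (M u v) = v by rewrite !row_set_row eqxx.
have MC u v : M u v = set_row (set_row X j v) i u.
  apply: vcons_ext => k; rewrite !row_set_row.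
  by case: (altP (k =P i)) => // ->; rewrite (negbTE ij).
have M0 u : f (M u u) = 0 by apply: (fa _ i j) => //; rewrite Mi Mj.
have MD u v w : f (M u (v + w)) = f (M u v) + f (M u w).
  by rewrite -[v]scale1r /M fl mul1r scale1r.
have MDl u v w : f (M (u + v) w) = f (M u w) + f (M v w).
  by rewrite -[u]scale1r !MC fl mul1r scale1r.
have -> : row_perm (tperm i j) X = M (row j X) (row i X).
  apply: vcons_ext => k; rewrite !row_set_row row_row_perm.
  by case: tpermP => [->|->|/eqP/negbTE -> /eqP/negbTE -> //];
    rewrite ?eqxx ?(negbTE ij).
have -> : f X = f (M (row i X) (row j X)).
  congr f; apply: vcons_ext => k; rewrite !row_set_row.
  by case: (k =P j) => [->//|_]; case: (k =P i) => [->|_].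
have := M0 (row i X + row j X); rewrite MD !MDl !M0 add0r addr0.
by move/eqP; rewrite addr_eq0 => /eqP.
Qed.

Lemma altform_perm p (f : 'M[R]_(p, n) -> R) : altform f ->
  forall X (s : 'S_p), f (row_perm s X) = (-1) ^+ s * f X.
Proof.
move=> fA X s; have [ts -> dts] := prod_tpermP s.
elim: ts X dts => [|t ts IH] X /=.
  by rewrite big_nil row_perm1 odd_perm1 expr0 mul1r.
case/andP=> dt dts; rewrite big_cons row_permM odd_permM.
rewrite altform_tperm // IH //.
rewrite odd_tperm dt; case: (odd_perm _) => /=; ring.
Qed.

Lemma altform_vcons p (f : 'M[R]_(p.+1, n) -> R) u :
  altform f -> altform (fun X => f (vcons u X)).
Proof.
move=> [fl fa]; split=> [X i c a b|X i j ij e].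
  by rewrite -!set_row_vconsS fl.
by apply: (fa _ (lift ord0 i) (lift ord0 j));
  rewrite ?(inj_eq lift_inj) // !row_vconsS.
Qed.

Lemma altform_vconsD p (f : 'M[R]_(p.+1, n) -> R) c u v X : altform f ->
  f (vcons (c *: u + v) X) = c * f (vcons u X) + f (vcons v X).
Proof.
by move=> [fl _]; have := fl (vcons 0 X) ord0 c u v; rewrite !set_row_vcons0.
Qed.

Lemma altform_swap p (f : 'M[R]_(p.+2, n) -> R) u v X : altform f ->
  f (vcons u (vcons v X)) = - f (vcons v (vcons u X)).
Proof.
move=> fA.
have ne : ord0 != lift ord0 ord0 :> 'I_p.+2 by [].
rewrite -(altform_tperm fA _ ne); congr f; apply: vcons_ext => i.
rewrite row_row_perm; case: tpermP => [->|->|].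
- by rewrite row_vcons0 row_vconsS row_vcons0.
- by rewrite row_vcons0 row_vconsS row_vcons0.
case: (unliftP ord0 i) => [{}i|] -> //; rewrite !row_vconsS.
by case: (unliftP ord0 i) => [{}i|] -> //; rewrite !row_vconsS.
Qed.

(** Moving one row across two others is an even permutation; this is why the
    action of a (2, 2) form commutes with anything done to another row. *)
Lemma altform_rot p (f : 'M[R]_(p.+3, n) -> R) u v w X : altform f ->
  f (vcons u (vcons v (vcons w X))) = f (vcons w (vcons u (vcons v X))).
Proof.
move=> fA; rewrite (altform_swap v w _ (altform_vcons u fA)).
by rewrite (altform_swap u w _ fA) opprK.
Qed.

Lemma altform_col_mx p q (f : 'M[R]_(p + q, n) -> R) (X : 'M[R]_(q, n)) :
  altform f -> altform (fun Z : 'M[R]_(p, n) => f (col_mx Z X)).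
Proof.
move=> [fl fa]; split=> [Z i c a b|Z i j ij e]; last first.
  by apply: (fa _ (lshift q i) (lshift q j));
    rewrite ?(inj_eq (@lshift_inj _ _)) // !rowKu.
have E u : col_mx (set_row Z i u) X = set_row (col_mx Z X) (lshift q i) u.
  apply: vcons_ext => k; rewrite row_set_row; case: (split_ordP k) => k' ->.
    by rewrite !rowKu row_set_row (inj_eq (@lshift_inj _ _)).
  by rewrite !rowKd eq_rlshift.
by rewrite !E fl.
Qed.

Lemma altform_col_mxr p q (f : 'M[R]_(p + q, n) -> R) (Z : 'M[R]_(p, n)) :
  altform f -> altform (fun X : 'M[R]_(q, n) => f (col_mx Z X)).
Proof.
move=> [fl fa]; split=> [X i c a b|X i j ij e]; last first.
  by apply: (fa _ (rshift p i) (rshift p j));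
    rewrite ?(inj_eq (@rshift_inj _ _)) // !rowKd.
have E u : col_mx Z (set_row X i u) = set_row (col_mx Z X) (rshift p i) u.
  apply: vcons_ext => k; rewrite row_set_row; case: (split_ordP k) => k' ->.
    by rewrite !rowKu eq_lrshift.
  by rewrite !rowKd row_set_row (inj_eq (@rshift_inj _ _)).
by rewrite !E fl.
Qed.

End Rows.

(** * Contraction of families of double forms *)

Section Contraction.
Variables (R : realType) (n : nat).
Local Notation V := 'rV[R]_n.

(** The degree s is a variable because contraction lowers it, and the
    inductions below are on the number of contractions, over all degrees at
    once. *)
Definition form_family := forall s, dform R n s s.

Definition alternating_family (Psi : form_family) :=
  forall s, (forall Y, altform (Psi s ^~ Y)) /\ (forall X, altform (Psi s X)).

Lemma altform_sum p (I : finType) (c : I -> R) (f : I -> 'M[R]_(p, n) -> R) :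
  (forall i, altform (f i)) -> altform (fun X => \sum_i c i * f i X).
Proof.
move=> fA; split=> [X i a u v|X i j ij e].
  rewrite mulr_sumr -big_split; apply: eq_bigr => l _ /=.
  by rewrite (proj1 (fA l)); ring.
by rewrite big1 // => l _; rewrite (proj2 (fA l) _ _ _ ij e) mulr0.
Qed.

Lemma altform_ext p (f g : 'M[R]_(p, n) -> R) : f =1 g -> altform f ->
    altform g.
Proof. by move=> /funext ->. Qed.

(** Degrees such as p + q + s and p + (q + s) are equal without being
    convertible; a family does not see the cast between them. *)
Lemma family_cast (Psi : form_family) s s' (e : s = s') (X Y : 'M[R]_(s, n)) :
  Psi s' (castmx (e, erefl) X) (castmx (e, erefl) Y) = Psi s X Y.
Proof. by case: s' / e; rewrite !castmx_id. Qed.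

Lemma sum_ffun_split (T : finType) p q (F : {ffun 'I_(p + q) -> T} -> R) :
  \sum_I F I = \sum_(I1 : {ffun 'I_p -> T}) \sum_(I2 : {ffun 'I_q -> T})
    F [ffun i => match fintype.split i with inl j => I1 j | inr j => I2 j end].
Proof.
rewrite pair_big /=.
pose h (u : {ffun 'I_p -> T} * {ffun 'I_q -> T}) : {ffun 'I_(p + q) -> T} :=
  [ffun i => match fintype.split i with inl j => u.1 j | inr j => u.2 j end].
pose h' (I : {ffun 'I_(p + q) -> T}) :=
  ([ffun j => I (lshift q j)] : {ffun 'I_p -> T},
   [ffun j => I (rshift p j)] : {ffun 'I_q -> T}).
rewrite (reindex h) //; exists h' => [[I1 I2] _|I _].
  by congr (_, _); apply/ffunP => j;
    rewrite !ffunE -?[lshift _ _]/(unsplit (inl _))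
        -?[rshift _ _]/(unsplit (inr _)) unsplitK.
apply/ffunP => i; rewrite ffunE /h' /=.
by case: split_ordP => j ->; rewrite ffunE.
Qed.

Variable E : 'M[R]_n.

(** The rows of E play the role of an orthonormal frame. *)
Definition contract_with p (w : dform R n p p) (Psi : form_family) :
    form_family := fun s X Y =>
  ((p`! * p`!)%:R)^-1 *
  \sum_(I : {ffun 'I_p -> 'I_n}) \sum_(J : {ffun 'I_p -> 'I_n})
    w (rowsub I E) (rowsub J E) *
    Psi (p + s)%N (col_mx (rowsub I E) X) (col_mx (rowsub J E) Y).

Lemma contract_with_alternating p (w : dform R n p p) Psi :
    alternating_family Psi -> alternating_family (contract_with w Psi).
Proof.
move=> PA s.
have -> : contract_with w Psi (s := s) = fun X Y =>
    \sum_(u : {ffun 'I_p -> 'I_n} * {ffun 'I_p -> 'I_n})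
      ((p`! * p`!)%:R^-1 * w (rowsub u.1 E) (rowsub u.2 E)) *
      Psi (p + s)%N (col_mx (rowsub u.1 E) X) (col_mx (rowsub u.2 E) Y).
  apply/funext => X; apply/funext => Y;
      rewrite /contract_with pair_big mulr_sumr.
  by apply: eq_bigr => u _; rewrite mulrA.
split=> [Y|X]; apply: altform_sum => u.
  exact: altform_col_mxr (proj1 (PA _) _).
exact: altform_col_mxr (proj2 (PA _) _).
Qed.

(** Antisymmetrizing a function that is summed against an alternating one
    only multiplies the sum by m!: reindex by the permutation, whose sign is
    squared. *)
Lemma alt_sum_perm m (F g : 'M[R]_(m, n) -> R) : altform g ->
  \sum_(I : {ffun 'I_m -> 'I_n})
    (\sum_(a : 'S_m) (-1) ^+ a * F (row_perm a (rowsub I E))) * g (rowsub I E)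
  = m`!%:R * \sum_(I : {ffun 'I_m -> 'I_n}) F (rowsub I E) * g (rowsub I E).
Proof.
move=> gA.
under eq_bigr do rewrite mulr_suml.
rewrite exchange_big /=.
set S := (\sum_I F _ * g _).
rewrite (eq_bigr (fun=> S)).
  by rewrite sumr_const card_Sn mulr_natl.
move=> a _.
(* precomposition of an index map with b permutes the rows of the frame *)
pose h (b : 'S_m) (I : {ffun 'I_m -> 'I_n}) : {ffun 'I_m -> 'I_n} :=
  [ffun i => I (b i)].
have rE b (I : {ffun 'I_m -> 'I_n}) :
    rowsub (h b I) E = row_perm b (rowsub I E).
  by apply/matrixP => i j; rewrite !mxE ffunE.
rewrite (reindex (h (a^-1)%g)) /=.
  apply: eq_bigr => I _; rewrite rE (altform_perm gA) -row_permM mulgV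
      row_perm1.
  by rewrite odd_permV mulrACA -expr2 sqrr_sign mul1r.
by exists (h a) => I _; apply/ffunP => i; rewrite !ffunE ?permK ?permKV.
Qed.

Lemma rowsub_split p q (I1 : {ffun 'I_p -> 'I_n}) (I2 : {ffun 'I_q -> 'I_n}) :
  rowsub [ffun i => match fintype.split i with inl j => I1 j | inr j =>
      I2 j end] E
  = col_mx (rowsub I1 E) (rowsub I2 E).
Proof.
apply/matrixP => i j; rewrite mxE ffunE; case: split_ordP => k ->.
  by rewrite col_mxEu mxE.
by rewrite col_mxEd mxE.
Qed.

(** By [alt_sum_perm] the antisymmetrizations in the wedge product
    contribute (p + q)! on each side, which cancels the normalisation of the
    contraction; the normalisation of the wedge product is that of the two
    single contractions. *)
Lemma contract_with_wedge p q (w : dform R n p p) (t : dform R n q q) Psi :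
    alternating_family Psi ->
  forall s X Y, contract_with (wedge w t) Psi (s := s) X Y
                = contract_with t (contract_with w Psi) X Y.
Proof.
move=> PA s X Y; rewrite /contract_with /wedge.
pose H (A B : 'M[R]_(p + q, n)) :=
  w (usubmx A) (usubmx B) * t (dsubmx A) (dsubmx B).
pose Ps (I J : {ffun 'I_(p + q) -> 'I_n}) :=
    Psi (p + q + s)%N (col_mx (rowsub I E) X) (col_mx (rowsub J E) Y).
pose c : R := ((p`! * q`! * (p`! * q`!))%:R)^-1.
transitivity (((p + q)`! * (p + q)`!)%:R^-1 * (c *
  \sum_(I : {ffun 'I_(p + q) -> 'I_n}) \sum_(J : {ffun 'I_(p + q) -> 'I_n})
   (\sum_(b : 'S_(p + q)) (-1) ^+ b * \sum_(a : 'S_(p + q)) (-1) ^+ a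
       * H (row_perm a (rowsub I E)) (row_perm b (rowsub J E))) * Ps I J)).
  congr (_ * _); rewrite mulr_sumr; apply: eq_bigr => I _.
  rewrite mulr_sumr; apply: eq_bigr => J _; rewrite mulrA; congr (_ * _ * _).
  rewrite exchange_big; apply: eq_bigr => b _; rewrite mulr_sumr.
  by apply: eq_bigr => a _; rewrite /H [RHS]mulrA [X in _ = X * _]mulrC.
under eq_bigr => I _ do rewrite
  (alt_sum_perm (fun B => \sum_(a : 'S_(p + q)) (-1) ^+ a *
     H (row_perm a (rowsub I E)) B)
   (altform_col_mx Y (proj2 (PA _) (col_mx (rowsub I E) X)))).
rewrite -mulr_sumr exchange_big.
under eq_bigr => J _ do rewrite
  (alt_sum_perm (fun A => H A (rowsub J E))
   (altform_col_mx X (proj1 (PA _) (col_mx (rowsub J E) Y)))).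
rewrite -mulr_sumr exchange_big /=.
under eq_bigr => I _ do rewrite sum_ffun_split.
rewrite sum_ffun_split.
set S := (X in _ * (_ * (_ * (_ * X)))).
have fN (m : nat) : m`!%:R != 0 :> R by rewrite pnatr_eq0 -lt0n fact_gt0.
transitivity (c * S).
  by rewrite /c !natrM; field; rewrite !fN.
rewrite exchange_big /= in S *.
transitivity (((q`! * q`!)%:R)^-1 *
 \sum_(I2 : {ffun 'I_q -> 'I_n}) \sum_(J2 : {ffun 'I_q -> 'I_n})
   (p`! * p`!)%:R^-1 *
   \sum_(I1 : {ffun 'I_p -> 'I_n}) \sum_(J1 : {ffun 'I_p -> 'I_n})
   t (rowsub I2 E) (rowsub J2 E) * (w (rowsub I1 E) (rowsub J1 E) *
   Psi (p + (q + s))%N (col_mx (rowsub I1 E) (col_mx (rowsub I2 E) X))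
                   (col_mx (rowsub J1 E) (col_mx (rowsub J2 E) Y))));
                       last first.
  congr (_ * _); apply: eq_bigr => I2 _; apply: eq_bigr => J2 _.
  rewrite mulrCA; congr (_ * _); rewrite mulr_sumr; apply: eq_bigr => I1 _.
  by rewrite mulr_sumr.
rewrite /S -[X in _ = _ * X]mulr1.
have -> : c = (q`! * q`!)%:R^-1 * (p`! * p`!)%:R^-1.
  by rewrite /c !natrM; field; rewrite !fN.
rewrite -mulrA mulr1; congr (_ * _); rewrite mulr_sumr; apply: eq_bigr => I2 _.
rewrite -mulr_sumr; congr (_ * _).
rewrite [RHS]exchange_big; apply: eq_bigr => I1 _.
rewrite exchange_big; apply: eq_bigr => J2 _; apply: eq_bigr => J1 _.
rewrite !rowsub_split /H !col_mxKu !col_mxKd -mulrA mulrCA; congr (_ * (_ * _)).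
by rewrite !col_mxA family_cast.
Qed.

Lemma sum_ffun0 (T : finType) (F : {ffun 'I_0 -> T} -> R) I0 :
  \sum_I F I = F I0.
Proof.
rewrite (bigD1 I0) //= big1 ?addr0 // => I /eqP[].
by apply/ffunP => -[].
Qed.

Lemma contract_with_dpow p (w : dform R n p p) k Psi : alternating_family Psi ->
  contract_with (dpow w k) Psi = iter k (contract_with w) Psi.
Proof.
elim: k Psi => [|k IH] Psi PA.
  apply: functional_extensionality_dep => s; apply/funext => X;
      apply/funext => Y.
  have I0 : {ffun 'I_0 -> 'I_n} by apply: ffun0; rewrite card_ord.
  rewrite /contract_with /= (sum_ffun0 _ I0) (sum_ffun0 _ I0) fact0 invr1
      !mul1r.
  have cE (Z : 'M[R]_(s, n)) : col_mx (rowsub I0 E : 'M[R]_(0, n)) Z = Z.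
    by apply/matrixP => i j; rewrite mxE; case: splitP => [[]//|l /val_inj ->].
  by rewrite !cE.
rewrite iterSr -IH; last exact: contract_with_alternating.
apply: functional_extensionality_dep => s; apply/funext => X; apply/funext => Y.
exact: contract_with_wedge.
Qed.

End Contraction.
Arguments form_family : clear implicits.

(** * Gram determinants and orthonormal frames *)

Section GramDeterminant.
Variables (R : realType) (n : nat).
Local Notation V := 'rV[R]_n.
Variable G : 'M[R]_n.

Definition inner (u v : V) : R := (u *m G *m v^T) 0 0.

(** The s-th exterior power of the metric divided by s!. *)
Definition gram_det : form_family R n := fun s X Y => \det (X *m G *m Y^T).

Lemma det_mulmx_altform s (M : 'M[R]_(n, s)) :
  altform (fun X : 'M[R]_(s, n) => \det (X *m M)).
Proof.
split=> [X i c u v|X i j ij e].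
  rewrite -[X in _ = _ + X]mul1r; apply: (determinant_multilinear (i0 := i)).
  - by rewrite !row_mul !row_set_row eqxx mulmxDl -scalemxAl scale1r.
  - apply/matrixP => k l; rewrite !mxE; apply: eq_bigr => m _.
    by rewrite !mxE eq_sym (negbTE (neq_lift i k)).
  - apply/matrixP => k l; rewrite !mxE; apply: eq_bigr => m _.
    by rewrite !mxE eq_sym (negbTE (neq_lift i k)).
apply: (determinant_alternate ij) => k.
have : row i (X *m M) = row j (X *m M) by rewrite !row_mul e.
by move/rowP/(_ k); rewrite !mxE.
Qed.

Lemma gram_det_alternating : alternating_family gram_det.
Proof.
move=> s; split=> [Y|X].
  apply: altform_ext (det_mulmx_altform (G *m Y^T)) => X.
  by rewrite /gram_det mulmxA.
apply: altform_ext (det_mulmx_altform (X *m G)^T) => Y.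
by rewrite /gram_det -[in LHS]det_tr trmx_mul trmxK.
Qed.

(** Laplace expansion along the column of the new row e. *)
Lemma gram_det_cons_r s (X : 'M[R]_(s.+1, n)) (Y : 'M[R]_(s, n)) e :
  gram_det X (vcons e Y) =
  \sum_(j < s.+1) (-1) ^+ j * inner (row j X) e
      * gram_det (row' j X : 'M[R]_(s, n)) Y.
Proof.
rewrite /gram_det (expand_det_col _ ord0); apply: eq_bigr => j _.
rewrite /cofactor addn0 mulrCA mulrA; congr (_ * _ * _).
  rewrite /inner !mxE; apply: eq_bigr => l _.
  by rewrite !mxE vcons0; congr (_ * _); apply: eq_bigr => m _; rewrite !mxE.
congr (\det _); apply/matrixP => k l; rewrite !mxE; apply: eq_bigr => m _.
rewrite !mxE vconsS; congr (_ * _).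
by apply: eq_bigr => p _; rewrite !mxE.
Qed.

Hypothesis Gsym : G^T = G.

Lemma innerC u v : inner u v = inner v u.
Proof.
rewrite /inner -{2}Gsym -[X in _ = (X *m _ *m _) _ _]trmxK -!trmx_mul mulmxA.
by rewrite [RHS]mxE.
Qed.

Lemma gram_detC s (X Y : 'M[R]_(s, n)) : gram_det X Y = gram_det Y X.
Proof. by rewrite /gram_det -det_tr !trmx_mul trmxK Gsym mulmxA. Qed.

Variable E : 'M[R]_n.
Hypothesis EGE : E *m G *m E^T = 1%:M.

Lemma frameV : E^T *m E *m G = 1%:M.
Proof.
have := mulmx1C EGE; rewrite mulmxA => EEG.
by have := mulmx1C EEG; rewrite !mulmxA.
Qed.

(** u is the sum of <u, e_i> e_i. *)
Lemma frame_decomp (f : V -> R) u :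
  (forall c u v, f (c *: u + v) = c * f u + f v) ->
  \sum_i inner u (row i E) * f (row i E) = f u.
Proof.
move=> fl; have f0 : f 0 = 0.
  by have := fl (-1) 0 0; rewrite scaler0 addr0 mulN1r addNr.
have fs (I : seq 'I_n) (c : 'I_n -> R) (w : 'I_n -> V) :
    f (\sum_(i <- I) c i *: w i) = \sum_(i <- I) c i * f (w i).
  by elim: I => [|i I IH]; rewrite ?big_nil // !big_cons fl IH.
rewrite -fs; congr f.
rewrite -[RHS]mulmx1 -[1%:M]trmx1 -frameV !trmx_mul trmxK Gsym mulmxA mulmxA
    mulmx_sum_row.
apply: eq_bigr => i _; rewrite /inner; congr (_ *: _).
by rewrite mulmxA [LHS]mxE [RHS]mxE; apply: eq_bigr => j _; congr (_ * _);
    rewrite !mxE.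
Qed.

Lemma inner_frame i : inner (row i E) (row i E) = 1.
Proof.
have -> : 1 = (E *m G *m E^T) i i :> R by rewrite EGE mxE eqxx.
rewrite /inner [LHS]mxE [RHS]mxE; apply: eq_bigr => j _; rewrite -row_mul.
by congr (_ * _); rewrite [LHS]mxE ?[RHS]mxE // mxE.
Qed.

Definition trace_family (Psi : form_family R n) : form_family R n :=
    fun s X Y =>
  \sum_i Psi s.+1 (vcons (row i E) X) (vcons (row i E) Y).

(** Moving row j to the front is a cycle of length j + 1. *)
Lemma altform_cycle s (f : 'M[R]_(s.+1, n) -> R) X (j : 'I_s.+1) : altform f ->
  f (vcons (row j X) (row' j X : 'M[R]_(s, n))) = (-1) ^+ j * f X.
Proof.
move=> fA; elim: s f X j fA => [|s IH] f X j fA.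
  rewrite (ord1 j) expr0 mul1r; congr f; apply: vcons_ext => i.
  by rewrite (ord1 i) row_vcons0.
have [a [Z ->]] : exists a (Z : 'M[R]_(s.+1, n)), X = vcons a Z.
  by exists (row ord0 X), (row' ord0 X); exact: vcons_row.
case: (unliftP ord0 j) => [k|] ->; last by rewrite row_vcons0 row'_vcons0 mul1r.
rewrite row_vconsS row'_vconsS (altform_swap _ _ _ fA).
rewrite (IH (fun W => f (vcons a W))); last exact: altform_vcons.
by rewrite /= /bump /= add1n exprS mulN1r mulNr.
Qed.

(** Expand along the first column. The diagonal terms give n; the term with
    the inner product of x_j and e_i, summed over i, moves x_j back to the
    first row, where the cycle and the Laplace signs combine to -1, once for
    each of the s rows. *)
Lemma trace_gram_det s X Y : trace_family gram_det (s := s) X Y =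
    (n%:R - s%:R) * gram_det X Y.
Proof.
rewrite /trace_family.
under eq_bigr => i _ do rewrite gram_det_cons_r big_ord_recl.
rewrite big_split /= mulrBl; congr (_ + _).
  under eq_bigr => i _ do rewrite row'_vcons0 row_vcons0 inner_frame expr0
      !mul1r.
  by rewrite sumr_const card_ord mulr_natl.
rewrite exchange_big /=.
case: s X Y => [|s] X Y; first by rewrite big_ord0 mul0r oppr0.
under eq_bigr => j _.
  under eq_bigr => i _.
    rewrite row'_vconsS.
    rewrite row_vconsS -mulrA.
    over.
  rewrite -mulr_sumr.
  rewrite (@frame_decomp (fun e => gram_det (vcons e (row' j X : 'M[R]_(s, n)))
      Y)); last first.
    by move=> c u v; rewrite (altform_vconsD _ _ _ _
        (proj1 (gram_det_alternating _) Y)).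
  rewrite (altform_cycle _ _ (proj1 (gram_det_alternating _) Y)).
  rewrite mulrA -exprD /= /bump /= add1n addSn addnn exprS -mul2n exprM sqrrN
      expr1n expr1n mulr1 mulN1r.
  over.
by rewrite /= sumr_const card_ord mulr_natl mulNrn.
Qed.

End GramDeterminant.

(** * The Hodge dual of a power of the metric times a power of R *)

(** The determinant of G splits evenly between the two volume forms, so that
    their product is a Gram determinant. *)
Lemma vol_mul (R : realType) (n m : nat) (G : 'M[R]_n) (W1 W2 : 'M[R]_(m, n)) :
  m = n -> 0 <= \det G -> vol G W1 * vol G W2 = \det (W1 *m G *m W2^T).
Proof.
move=> e G0; case: n / e G W1 W2 G0 => G W1 W2 G0.
rewrite /vol !conform_mx_id mulrACA -expr2 sqr_sqrtr // !det_mulmx det_tr; ring.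
Qed.

Section HodgeDual.
Variables (R : realType) (n : nat) (G E : 'M[R]_n).
Hypothesis Gsym : G^T = G.
Hypothesis EGE : E *m G *m E^T = 1%:M.
Local Notation V := 'rV[R]_n.
Local Notation e i := (row i E).

Lemma frame_det : 0 <= \det G.
Proof.
have : \det (E *m G *m E^T) = 1 by rewrite EGE det1.
rewrite !det_mulmx det_tr mulrAC -expr2 => H; rewrite leNgt; apply/negP => G0.
have : \det E ^+ 2 * \det G <= 0 by rewrite mulr_ge0_le0 ?sqr_ge0 ?ltW.
by rewrite H leNgt ltr01.
Qed.

Definition eval4 (w : dform R n 2 2) (a b c d : V) : R :=
  w (col_mx a b : 'M[R]_(1 + 1, n)) (col_mx c d : 'M[R]_(1 + 1, n)).

Lemma sum_ffun1 (F : {ffun 'I_1 -> 'I_n} -> R) :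
  \sum_I F I = \sum_i F [ffun=> i].
Proof.
rewrite (reindex (fun i => [ffun=> i] : {ffun 'I_1 -> 'I_n})) //.
exists (fun I : {ffun 'I_1 -> 'I_n} => I 0) => [i _|I _];
    first by rewrite ffunE.
by apply/ffunP => i; rewrite ffunE (ord1 i).
Qed.

Lemma rowsub_ffun1 i : rowsub ([ffun=> i] : {ffun 'I_1 -> 'I_n}) E = e i.
Proof. by apply/matrixP => j k; rewrite !mxE ffunE. Qed.

Lemma col_mx_vcons2 s (a b : V) (X : 'M[R]_(s, n)) :
  col_mx (col_mx a b : 'M[R]_(1 + 1, n)) X = vcons a (vcons b X).
Proof. by rewrite !vconsE; have /= -> := @col_mxA R _ _ _ n a b X;
    rewrite castmx_id. Qed.

Lemma contract_with2E (w : dform R n 2 2) Psi s X Y :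
  contract_with E w Psi (s := s) X Y = 4^-1 * \sum_a \sum_b \sum_c \sum_d
    eval4 w (e a) (e b) (e c) (e d) *
    Psi s.+2 (vcons (e a) (vcons (e b) X)) (vcons (e c) (vcons (e d) Y)).
Proof.
rewrite /contract_with; congr (_^-1 * _).
rewrite (sum_ffun_split (p := 1) (q := 1)) sum_ffun1; apply: eq_bigr => a _.
rewrite sum_ffun1; apply: eq_bigr => b _.
rewrite (sum_ffun_split (p := 1) (q := 1)) sum_ffun1; apply: eq_bigr => c _.
rewrite sum_ffun1; apply: eq_bigr => d _.
by rewrite !(@rowsub_split _ _ _ 1 1) !rowsub_ffun1 !col_mx_vcons2.
Qed.

(** Orthonormality leaves only the diagonal terms. *)
Lemma contract_with_metric Psi s X Y :
  contract_with E (metric_form G) Psi (s := s) X Y = trace_family E Psi X Y.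
Proof.
rewrite /contract_with invr1 mul1r sum_ffun1; apply: eq_bigr => i _.
rewrite sum_ffun1 (bigD1 i) //= big1 ?addr0 => [|j ji].
  rewrite !rowsub_ffun1 -!vconsE.
  by rewrite /metric_form -/(inner G (e i) (e i)) (inner_frame EGE) mul1r.
rewrite !rowsub_ffun1; suff -> : metric_form G (e i) (e j) = 0 by rewrite mul0r.
have -> : metric_form G (e i) (e j) = (E *m G *m E^T) i j.
  rewrite /metric_form -row_mul [LHS]mxE [RHS]mxE.
  by apply: eq_bigr => k _; congr (_ * _); rewrite !mxE.
by rewrite EGE mxE eq_sym (negbTE ji).
Qed.

Lemma hodge_contract_with p s (w : dform R n p p) (X Y : 'M[R]_(s, n)) :
  onb G = E -> (p + s)%N = n -> hodge G s s w X Y =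
      contract_with E w (gram_det G) X Y.
Proof.
move=> onbE ps; rewrite /hodge /contract_with onbE; congr (_ * _).
apply: eq_bigr => I _; apply: eq_bigr => J _.
by rewrite -mulrA vol_mul // frame_det.
Qed.

Lemma fact_prod m : \prod_(j < m) (m%:R - j%:R) = m`!%:R :> R.
Proof.
elim: m => [|m IH]; first by rewrite big_ord0.
rewrite big_ord_recl subr0 factS natrM -IH; congr (_ * _).
by apply: eq_bigr => j _; rewrite /= /bump /= add1n -!natr1; ring.
Qed.

(** A factor that depends on the degree s is read at the degree k p + s in
    which the innermost family is evaluated. *)
Lemma iter_contract_with_scale p (w : dform R n p p) k (c : nat -> R) Psi s X
    Y :
  iter k (contract_with E w) (fun s X Y => c s * Psi s X Y) s X Y =
  c (k * p + s)%N * iter k (contract_with E w) Psi s X Y.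
Proof.
elim: k s X Y => [//|k IH] s X Y; rewrite !iterS /contract_with mulrCA;
    congr (_ * _).
rewrite mulr_sumr; apply: eq_bigr => I _; rewrite mulr_sumr.
apply: eq_bigr => J _; rewrite IH mulrCA; congr (c _ * _).
by rewrite mulSn -addnA addnCA addnA.
Qed.

Lemma iter_contract_with_metric m s X Y :
  iter m (contract_with E (metric_form G)) (gram_det G) s X Y =
  \prod_(j < m) (n%:R - s%:R - j%:R) * gram_det G X Y.
Proof.
elim: m s X Y => [|m IH] s X Y; first by rewrite big_ord0 mul1r.
rewrite iterS contract_with_metric /trace_family.
under eq_bigr => i _ do rewrite IH.
rewrite -mulr_sumr -/(trace_family E (gram_det G) X Y) trace_gram_det //
    big_ord_recl subr0.
rewrite mulrCA mulrA; congr (_ * _ * _).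
by apply: eq_bigr => j _; rewrite /= /bump /= add1n -!natr1; ring.
Qed.

(** The m contractions with g come first and multiply D_s, where s = 2k + r,
    by the product of the n - s - j for j < m; as n - s = m this is m!. *)
Lemma hodge_curvature (w : dform R n 2 2) k m r (X Y : 'M[R]_(r, n)) :
  onb G = E -> (m + 2 * k + r)%N = n ->
  (m`!%:R)^-1 * hodge G r r (wedge (dpow (metric_form G) m) (dpow w k)) X Y
  = iter k (contract_with E w) (gram_det G) r X Y.
Proof.
move=> onbE mkr; rewrite hodge_contract_with //;
    last by rewrite muln1 [(k * 2)%N]mulnC.
rewrite contract_with_wedge; last exact: gram_det_alternating.
rewrite (contract_with_dpow _ (metric_form G));
    last exact: gram_det_alternating.
rewrite contract_with_dpow; last first.
  elim: {mkr} m => [|m IH]; first exact: gram_det_alternating.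
  by rewrite iterS; exact: contract_with_alternating.
have -> : iter m (contract_with E (metric_form G)) (gram_det G) =
    fun s X Y => \prod_(j < m) (n%:R - s%:R - j%:R) * gram_det G X Y.
  apply: functional_extensionality_dep => s.
  by apply/funext => A; apply/funext => B; rewrite iter_contract_with_metric.
rewrite iter_contract_with_scale mulrA.
rewrite (eq_bigr (fun j : 'I_m => m%:R - j%:R)) => [|j _].
  by rewrite fact_prod mulVf ?mul1r // pnatr_eq0 -lt0n fact_gt0.
by rewrite -{1}mkr -addnA mulnC natrD addrK.
Qed.

Section Curvature.
Variable w : dform R n 2 2.
Local Notation P := (fun k => iter k (contract_with E w) (gram_det G)).

Lemma contract_pow_alternating k : alternating_family (P k).
Proof.
by elim: k => [|k IH]; [exact: gram_det_alternating|rewrite iterS;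
    exact: contract_with_alternating].
Qed.

(** Exchange the two frame sums. *)
Lemma contract_pow_sym k s (X Y : 'M[R]_(s, n)) : (forall A B, w A B = w B A) ->
  P k s X Y = P k s Y X.
Proof.
move=> wC; elim: k s X Y => [|k IH] s X Y; first exact: gram_detC.
rewrite !iterS /contract_with; congr (_ * _); rewrite exchange_big.
by apply: eq_bigr => I _; apply: eq_bigr => J _; rewrite wC IH.
Qed.

Lemma sum4_exchange (F : 'I_n -> 'I_n -> 'I_n -> 'I_n -> 'I_n -> R) :
  \sum_i \sum_a \sum_b \sum_c \sum_d F i a b c d =
  \sum_a \sum_b \sum_c \sum_d \sum_i F i a b c d.
Proof.
rewrite exchange_big; apply: eq_bigr => a _.
rewrite exchange_big; apply: eq_bigr => b _.
by rewrite exchange_big; apply: eq_bigr => c _; rewrite exchange_big.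
Qed.

Lemma trace_contract_with Psi : alternating_family Psi ->
  trace_family E (contract_with E w Psi) =
      contract_with E w (trace_family E Psi).
Proof.
move=> PA; apply: functional_extensionality_dep => s.
apply/funext => X; apply/funext => Y; rewrite contract_with2E /trace_family.
under eq_bigr => i _ do rewrite contract_with2E.
rewrite -mulr_sumr sum4_exchange; congr (_ * _).
apply: eq_bigr => a _; apply: eq_bigr => b _; apply: eq_bigr => c _.
apply: eq_bigr => d _; rewrite mulr_sumr; apply: eq_bigr => i _; congr (_ * _).
rewrite (altform_rot _ _ _ _ (proj1 (PA _) _)).
by rewrite (altform_rot _ _ _ _ (proj2 (PA _) _)).
Qed.

(** The trace is pushed through the k contractions down to D, in degree 2k +
    s. *)
Lemma trace_contract_pow k s (X Y : 'M[R]_(s, n)) :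
  trace_family E (P k) X Y = (n%:R - (2 * k + s)%:R) * P k s X Y.
Proof.
have -> : trace_family E (P k) = iter k (contract_with E w)
    (trace_family E (gram_det G)).
  elim: k => [//|k IH]; rewrite !iterS trace_contract_with ?IH //;
      exact: contract_pow_alternating.
have -> : trace_family E (gram_det G) = fun s X Y =>
    (n%:R - s%:R) * gram_det G X Y.
  apply: functional_extensionality_dep => t.
  by apply/funext => A; apply/funext => B; rewrite trace_gram_det.
by rewrite (iter_contract_with_scale w k (fun s => n%:R - s%:R)) mulnC.
Qed.

End Curvature.

(** The vanishing of the Bianchi map, which moves one vector from the left
    group to the right one and antisymmetrizes the left group. *)
Definition bianchi_family (Psi : form_family R n) :=
    forall r (X : 'M[R]_(r.+2, n)) Y,
  \sum_(j < r.+2) (-1) ^+ j * Psi r.+1 (row' j X : 'M[R]_(r.+1, n))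
      (vcons (row j X) Y) = 0.

(** Writing x_j = \sum_i <x_j, e_i> e_i and undoing the Laplace expansion
    turns the sum into \sum_i D(X; e_i, e_i, Y), which vanishes by
    alternation. *)
Lemma bianchi_gram_det : bianchi_family (gram_det G).
Proof.
move=> r X Y.
transitivity (\sum_(j < r.+2) \sum_i (-1) ^+ j * inner G (row j X) (e i) *
    gram_det G (row' j X : 'M[R]_(r.+1, n)) (vcons (e i) Y)).
  apply: eq_bigr => j _; under eq_bigr => i _ do rewrite -mulrA.
  rewrite -mulr_sumr; congr (_ * _).
  rewrite (frame_decomp Gsym EGE (f := fun u =>
      gram_det G (row' j X : 'M[R]_(r.+1, n)) (vcons u Y))) // => c u v.
  exact: altform_vconsD _ _ _ _ (proj2 (gram_det_alternating G _) _).
rewrite exchange_big big1 // => i _.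
rewrite -(gram_det_cons_r G X (vcons (e i) Y)).
have [_ fa] := proj2 (gram_det_alternating G r.+2) X.
by apply: (fa _ ord0 (lift ord0 ord0)); rewrite // row_vconsS !row_vcons0.
Qed.

(** Reindexing cyclically replaces F by the average of its three cyclic
    rotations. *)
Lemma sum3_cyc (F S : 'I_n -> 'I_n -> 'I_n -> R) :
  (forall a b c, F a b c + F b c a + F c a b = 0) ->
  (forall a b c, S b c a = S a b c) ->
  \sum_a \sum_b \sum_c F a b c * S a b c = 0.
Proof.
move=> FC SC; set x := \sum_a _.
have cyc (H : 'I_n -> 'I_n -> 'I_n -> R) :
    \sum_a \sum_b \sum_c H a b c = \sum_a \sum_b \sum_c H b c a.
  rewrite [RHS]exchange_big; apply: eq_bigr => b _.
  by rewrite [RHS]exchange_big.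
have x1 : x = \sum_a \sum_b \sum_c F b c a * S a b c.
  rewrite /x cyc; apply: eq_bigr => a _; apply: eq_bigr => b _.
  by apply: eq_bigr => c _; rewrite SC.
have x2 : x = \sum_a \sum_b \sum_c F c a b * S a b c.
  rewrite x1 cyc; apply: eq_bigr => a _; apply: eq_bigr => b _.
  by apply: eq_bigr => c _; rewrite SC.
have : x + x + x = 0.
  rewrite {2}x1 {2}x2 /x -!big_split big1 // => a _.
  rewrite -!big_split big1 // => b _; rewrite -!big_split big1 // => c _.
  by rewrite /= -!mulrDl FC mul0r.
by lra.
Qed.

(** Apply the hypothesis on Psi to (e_a, e_b, X) and (e_c, e_d, Y). The
    terms that move a row of X form the sum to be computed. The term that
    moves e_a is cyclic in a, c, d, the one that moves e_b is cyclic in b,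
    c, d, and both are killed by the Bianchi identity of w. *)
Lemma bianchi_contract_with (w : dform R n 2 2) Psi : alternating_family Psi ->
  (forall a b c d, eval4 w a b c d + eval4 w c b d a + eval4 w d b a c = 0) ->
  (forall a b c d, eval4 w a b c d = - eval4 w b a c d) ->
  bianchi_family Psi -> bianchi_family (contract_with E w Psi).
Proof.
move=> PA wB wA PB r X Y.
under eq_bigr => j _ do rewrite contract_with2E mulrCA mulr_sumr.
rewrite -mulr_sumr exchange_big /=.
under eq_bigr => a _ do
  (under eq_bigr => j _ do rewrite mulr_sumr; rewrite exchange_big /=).
under eq_bigr => a _ do under eq_bigr => b _ do
  (under eq_bigr => j _ do rewrite mulr_sumr; rewrite exchange_big /=).
under eq_bigr => a _ do under eq_bigr => b _ do under eq_bigr => c _ do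
  (under eq_bigr => j _ do rewrite mulr_sumr; rewrite exchange_big /=).
apply/eqP; rewrite mulf_eq0; apply/orP; right; apply/eqP.
pose S (u v c d : V) := Psi r.+3 (vcons v X) (vcons u (vcons c (vcons d Y))).
transitivity (\sum_a \sum_b \sum_c \sum_d
  eval4 w (e a) (e b) (e c) (e d) * (S (e b) (e a) (e c) (e d)
      - S (e a) (e b) (e c) (e d))).
  apply: eq_bigr => a _; apply: eq_bigr => b _; apply: eq_bigr => c _.
  apply: eq_bigr => d _.
  under eq_bigr => j _ do rewrite mulrCA; rewrite -mulr_sumr; congr (_ * _).
  have := PB r.+2 (vcons (e a) (vcons (e b) X)) (vcons (e c) (vcons (e d) Y)).
  rewrite big_ord_recl big_ord_recl /= !row'_vcons0 row'_vconsS row'_vcons0.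
  rewrite row_vconsS !row_vcons0 expr0 expr1 mul1r mulN1r addrA.
  rewrite -/(S _ _ _ _) -/(S _ _ _ _).
  move/eqP; rewrite addrC addr_eq0 opprB => /eqP <-; apply: eq_bigr => j _.
  rewrite !row'_vconsS !row_vconsS (altform_rot _ _ _ _ (proj2 (PA _) _)).
  rewrite (altform_rot _ _ _ _ (proj2 (PA _) _)).
  by rewrite /bump /= !add1n !exprS !mulN1r opprK.
have Z b : \sum_a \sum_c \sum_d
    eval4 w (e a) (e b) (e c) (e d) * S (e a) (e b) (e c) (e d) = 0.
  apply: (@sum3_cyc (fun a c d => eval4 w (e a) (e b) (e c) (e d))
                    (fun a c d => S (e a) (e b) (e c) (e d))) => a c d //.
  by rewrite /S (altform_rot _ _ _ _ (proj2 (PA _) _)).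
transitivity (\sum_a (- \sum_b \sum_c \sum_d
      eval4 w (e b) (e a) (e c) (e d) * S (e b) (e a) (e c) (e d)) -
    \sum_b \sum_a \sum_c \sum_d
      eval4 w (e a) (e b) (e c) (e d) * S (e a) (e b) (e c) (e d)).
  rewrite [X in _ - X]exchange_big -sumrB; apply: eq_bigr => a _.
  rewrite -sumrN -sumrB; apply: eq_bigr => b _.
  rewrite -sumrN -sumrB; apply: eq_bigr => c _.
  rewrite -sumrN -sumrB; apply: eq_bigr => d _.
  by rewrite (wA (e a)); ring.
rewrite !big1 ?subr0 // => a _; last by rewrite Z oppr0.
Qed.

(** The Leibniz rule for k contractions with w when w varies in the
    direction w' and the determinants are constant. *)
Fixpoint contract_pow_der (w w' : dform R n 2 2) k : form_family R n :=
  if k is j.+1 then fun s X Y =>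
    contract_with E w' (iter j (contract_with E w) (gram_det G)) X Y
        + contract_with E w (contract_pow_der w w' j) X Y
  else fun _ _ _ => 0.

Arguments contract_pow_der : clear implicits.

Lemma contract_pow_der_alternating w w' k :
    alternating_family (contract_pow_der w w' k).
Proof.
elim: k => [|k IH] s.
  by split=> [Y|X]; split=> [Z i c u v|] //=; rewrite mulr0 addr0.
have A1 := contract_with_alternating E w' (contract_pow_alternating w k) s;
    have A2 := contract_with_alternating E w IH s.
split=> [Y|X]; split=> [Z i c u v|Z i j ij ee] /=.
- by rewrite (proj1 (proj1 A1 Y)) (proj1 (proj1 A2 Y)); ring.
- by rewrite (proj2 (proj1 A1 Y) _ _ _ ij ee) (proj2 (proj1 A2 Y) _ _ _ ij ee)
    addr0.
- by rewrite (proj1 (proj2 A1 X)) (proj1 (proj2 A2 X)); ring.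
by rewrite (proj2 (proj2 A1 X) _ _ _ ij ee) (proj2 (proj2 A2 X) _ _ _ ij ee)
    addr0.
Qed.

(** With w' i the derivative of w along e_i, the contraction with w' i pairs
    w' i (e_a, e_b; .., ..) with a function alternating in e_a, e_b and e_i,
    and the contractions with w commute with the sum over i. *)
Lemma div_contract_pow w (w' : 'I_n -> dform R n 2 2) k s (X : 'M[R]_(s, n)) Y :
  (forall a b c x y, eval4 (w' a) (e b) (e c) x y + eval4 (w' b) (e c) (e a) x y
                     + eval4 (w' c) (e a) (e b) x y = 0) ->
  \sum_i contract_pow_der w (w' i) k s.+1 (vcons (e i) X) Y = 0.
Proof.
move=> B2; elim: k s X Y => [|k IH] s X Y /=; first by rewrite big1.
rewrite big_split /= [X in X + _](_ : _ = 0) ?add0r; last first.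
  under eq_bigr => i _ do rewrite contract_with2E.
  rewrite -mulr_sumr; apply/eqP; rewrite mulf_eq0; apply/orP; right; apply/eqP.
  rewrite sum4_exchange.
  transitivity (\sum_c \sum_d \sum_a \sum_b \sum_i
    eval4 (w' i) (e a) (e b) (e c) (e d) *
    iter k (contract_with E w) (gram_det G) s.+3
        (vcons (e a) (vcons (e b) (vcons (e i) X)))
                           (vcons (e c) (vcons (e d) Y))).
    under eq_bigr => a _ do rewrite exchange_big.
    rewrite exchange_big; apply: eq_bigr => c _ /=.
    under eq_bigr => a _ do rewrite exchange_big.
    by rewrite exchange_big.
  rewrite big1 // => c _; rewrite big1 // => d _.
  apply: (@sum3_cyc (fun a b i => eval4 (w' i) (e a) (e b) (e c) (e d))
    (fun a b i => iter k (contract_with E w) (gram_det G) s.+3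
        (vcons (e a) (vcons (e b) (vcons (e i) X)))
                           (vcons (e c) (vcons (e d) Y)))) => a b i.
    by rewrite -[RHS](B2 a b i (e c) (e d)); ring.
  by rewrite (altform_rot _ _ _ _ (proj1 (contract_pow_alternating w k _) _)).
under eq_bigr => i _ do rewrite contract_with2E.
rewrite -mulr_sumr; apply/eqP; rewrite mulf_eq0; apply/orP; right; apply/eqP.
rewrite sum4_exchange big1 // => a _; rewrite big1 // => b _.
rewrite big1 // => c _; rewrite big1 // => d _; rewrite -mulr_sumr.
under eq_bigr => i _ do
  rewrite (altform_rot _ _ _ _ (proj1 (contract_pow_der_alternating w (w' i) k
      _) _)).
by rewrite IH mulr0.
Qed.

End HodgeDual.

(** * Contraction by the inverse Gram matrix *)

Section Trace.
Variables (R : realType) (n : nat).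
Local Notation V := 'rV[R]_n.
Local Notation d i := (delta_mx 0 i : V).

Definition linear_fun (f : V -> R) := forall c u v, f (c *: u + v) =
    c * f u + f v.

Definition bilinear_fun (B : V -> V -> R) :=
  (forall v, linear_fun (B ^~ v)) /\ (forall u, linear_fun (B u)).

Definition quadrilinear_fun (T : V -> V -> V -> V -> R) :=
  [/\ forall b c e, linear_fun (fun a => T a b c e), forall a c e,
      linear_fun (fun b => T a b c e),
      forall a b e, linear_fun (fun c => T a b c e) & forall a b c,
          linear_fun (fun e => T a b c e)].

Lemma linear_fun0 f : linear_fun f -> f 0 = 0.
Proof. by move=> fl; have := fl (-1) 0 0; rewrite scaler0 addr0 mulN1r addNr.
    Qed.

Lemma linear_funD f u v : linear_fun f -> f (u + v) = f u + f v.
Proof. by move=> fl; rewrite -[u]scale1r fl mul1r scale1r. Qed.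

Lemma linear_funN f u : linear_fun f -> f (- u) = - f u.
Proof. by move=> fl; rewrite -scaleN1r -[_ *: u]addr0 fl linear_fun0 // addr0
    mulN1r. Qed.

Lemma linear_funB f u v : linear_fun f -> f (u - v) = f u - f v.
Proof. by move=> fl; rewrite linear_funD // linear_funN. Qed.

Lemma linear_fun_sum f (I : finType) (c : I -> R) (w : I -> V) : linear_fun f ->
  f (\sum_i c i *: w i) = \sum_i c i * f (w i).
Proof.
move=> fl; elim/big_rec2: _ => [|i y x _ <-]; first exact: linear_fun0.
by rewrite fl.
Qed.

Lemma linear_fun_delta f u : linear_fun f -> f u = \sum_i u 0 i * f (d i).
Proof. by move=> fl; rewrite {1}[u]row_sum_delta linear_fun_sum. Qed.

Lemma linear_fun_mulr f c : linear_fun f -> linear_fun (fun u => f u * c).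
Proof. by move=> fl a u v; rewrite fl; ring. Qed.

Lemma linear_fun_mull f c : linear_fun f -> linear_fun (fun u => c * f u).
Proof. by move=> fl a u v; rewrite fl; ring. Qed.

Lemma linear_fun_bigsum (I : finType) (f : I -> V -> R) :
  (forall i, linear_fun (f i)) -> linear_fun (fun u => \sum_i f i u).
Proof.
move=> fl a u v; rewrite mulr_sumr -big_split.
by apply: eq_bigr => i _; rewrite fl.
Qed.

Lemma bilinear_fun_mul f g : linear_fun f -> linear_fun g ->
    bilinear_fun (fun u v => f u * g v).
Proof. by move=> fl gl; split=> u; [exact: linear_fun_mulr|exact:
    linear_fun_mull]. Qed.

Lemma bilinear_fun_sum (I : finType) (B : I -> V -> V -> R) :
  (forall i, bilinear_fun (B i)) -> bilinear_fun (fun u v => \sum_i B i u v).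
Proof.
move=> Bl; split=> u; apply: linear_fun_bigsum => i;
    first exact: (proj1 (Bl i)).
exact: (proj2 (Bl i)).
Qed.

(** For H the inverse of the Gram matrix, the contraction of B over an
    orthonormal frame, written in the coordinate basis. *)
Definition inv_trace (H : 'M[R]_n) (B : V -> V -> R) :=
  \sum_a \sum_b H a b * B (d a) (d b).

Lemma eq_inv_trace H B B' : (forall u v, B u v = B' u v) ->
    inv_trace H B = inv_trace H B'.
Proof.
by move=> BB; apply: eq_bigr => a _; apply: eq_bigr => b _; rewrite BB.
Qed.

Lemma inv_trace_frame (E : 'M[R]_n) B : bilinear_fun B ->
    inv_trace (E^T *m E) B = \sum_i B (row i E) (row i E).
Proof.
move=> [Bl Br]; rewrite /inv_trace.
transitivity (\sum_a \sum_b \sum_i E i a * (E i b * B (d a) (d b))).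
  apply: eq_bigr => a _; apply: eq_bigr => b _; rewrite mxE mulr_suml.
  by apply: eq_bigr => i _; rewrite mxE mulrA.
under eq_bigr => a _ do rewrite exchange_big.
rewrite exchange_big; apply: eq_bigr => i _.
rewrite [RHS](linear_fun_delta _ (Bl _)) /=; apply: eq_bigr => a _.
rewrite mxE -mulr_sumr; congr (_ * _); rewrite [RHS](linear_fun_delta _ (Br _))
    /=.
by apply: eq_bigr => b _; rewrite mxE.
Qed.

(** [contract_with] for a (2, 2) form, with each of the four sums over a
    frame replaced by an [inv_trace]. *)
Definition contract_with_inv H (w : dform R n 2 2) (Psi : form_family R n) :
    form_family R n :=
  fun s X Y => 4^-1 * inv_trace H (fun a a' => inv_trace H (fun b b' =>
    inv_trace H (fun c c' => inv_trace H (fun e e' =>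
      eval4 w a b c e * Psi s.+2 (vcons a' (vcons b' X))
          (vcons c' (vcons e' Y)))))).

Lemma alternating_family_lin1 Psi s (X : 'M[R]_(s, n)) Y :
    alternating_family Psi ->
  linear_fun (fun u => Psi s.+1 (vcons u X) Y).
Proof. by move=> PA c u v; exact: (altform_vconsD _ _ _ _ (proj1 (PA _) Y)).
    Qed.

Lemma alternating_family_lin2 Psi s u (X : 'M[R]_(s, n)) Y :
    alternating_family Psi ->
  linear_fun (fun v => Psi s.+2 (vcons u (vcons v X)) Y).
Proof.
move=> PA c v v'.
exact: (altform_vconsD _ _ _ _ (altform_vcons u (proj1 (PA _) Y))).
Qed.

Lemma alternating_family_lin1r Psi s (Y : 'M[R]_(s, n)) X :
    alternating_family Psi ->
  linear_fun (fun u => Psi s.+1 X (vcons u Y)).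
Proof. by move=> PA c u v; exact: (altform_vconsD _ _ _ _ (proj2 (PA _) X)).
    Qed.

Lemma alternating_family_lin2r Psi s u (Y : 'M[R]_(s, n)) X :
    alternating_family Psi ->
  linear_fun (fun v => Psi s.+2 X (vcons u (vcons v Y))).
Proof.
move=> PA c v v'.
exact: (altform_vconsD _ _ _ _ (altform_vcons u (proj2 (PA _) X))).
Qed.

Lemma contract_with_inv_frame (E : 'M[R]_n) w Psi :
    quadrilinear_fun (eval4 w) -> alternating_family Psi ->
  contract_with_inv (E^T *m E) w Psi = contract_with E w Psi.
Proof.
move=> [T1 T2 T3 T4] PA; apply: functional_extensionality_dep => s.
apply/funext => X; apply/funext => Y; rewrite contract_with2E
    /contract_with_inv; congr (_ * _).
set H := E^T *m E.
pose F a a' b b' c c' e e' :=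
  eval4 w a b c e * Psi s.+2 (vcons a' (vcons b' X)) (vcons c' (vcons e' Y)).
rewrite -/F.
transitivity (inv_trace H (fun a a' => inv_trace H
    (fun b b' => inv_trace H (fun c c' =>
    \sum_i F a a' b b' c c' (row i E) (row i E))))).
  apply: eq_inv_trace => a a'; apply: eq_inv_trace => b b';
      apply: eq_inv_trace => c c'.
  rewrite inv_trace_frame //; apply: (bilinear_fun_mul (T4 a b c)).
  exact: alternating_family_lin2r.
transitivity (inv_trace H (fun a a' => inv_trace H (fun b b' => \sum_j
    \sum_i F a a' b b' (row j E) (row j E) (row i E) (row i E)))).
  apply: eq_inv_trace => a a'; apply: eq_inv_trace => b b'.
  rewrite inv_trace_frame //; apply: bilinear_fun_sum => i.
  by apply: (bilinear_fun_mul (T3 a b (row i E)));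
      exact: alternating_family_lin1r.
transitivity (inv_trace H (fun a a' => \sum_k \sum_j
    \sum_i F a a' (row k E) (row k E) (row j E) (row j E) (row i E) (row i E))).
  apply: eq_inv_trace => a a'.
  rewrite inv_trace_frame //; apply: bilinear_fun_sum => j;
      apply: bilinear_fun_sum => i.
  by apply: (bilinear_fun_mul (T2 a (row j E) (row i E)));
      exact: alternating_family_lin2.
rewrite inv_trace_frame //; apply: bilinear_fun_sum => k;
    apply: bilinear_fun_sum => j.
apply: bilinear_fun_sum => i.
by apply: (bilinear_fun_mul (T1 (row k E) (row j E) (row i E)));
    exact: alternating_family_lin1.
Qed.

Definition contract_pow_inv H G w k := iter k (contract_with_inv H w)
    (gram_det G).

Lemma contract_pow_inv_frame (E G : 'M[R]_n) w k : quadrilinear_fun (eval4 w) ->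
  contract_pow_inv (E^T *m E) G w k = iter k (contract_with E w) (gram_det G).
Proof.
move=> wl; elim: k => [//|k IH]; rewrite /contract_pow_inv !iterS
    -/(contract_pow_inv _ _ _ k) IH.
by rewrite contract_with_inv_frame //; exact: contract_pow_alternating.
Qed.

Lemma frame_invmx (E G : 'M[R]_n) : E *m G *m E^T = 1%:M -> E^T *m E = invmx G.
Proof.
move=> /frameV EEG; have [_ Gu] := mulmx1_unit EEG.
by rewrite -[RHS]mul1mx -EEG mulmxK.
Qed.

(** Both sides contract the same numbers: Y J is to G' what Y is to G. *)
Lemma contract_pow_natural (J E G G' : 'M[R]_n) (w w' : dform R n 2 2) k s
    (X Y : 'M[R]_(s, n)) :
  G = J *m G' *m J^T -> (forall A B, w A B = w' (A *m J) (B *m J)) ->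
  iter k (contract_with E w) (gram_det G) s X Y
  = iter k (contract_with (E *m J) w') (gram_det G') s (X *m J) (Y *m J).
Proof.
move=> GJ wJ; have rE p (I : {ffun 'I_p -> 'I_n}) :
    rowsub I E *m J = rowsub I (E *m J).
  by apply/matrixP => i j; rewrite !mxE; apply: eq_bigr => l _; rewrite !mxE.
elim: k s X Y => [|k IH] s X Y.
  by rewrite /= /gram_det GJ trmx_mul !mulmxA.
rewrite !iterS /contract_with; congr (_ * _).
by apply: eq_bigr => I _; apply: eq_bigr => K _; rewrite wJ IH !mul_col_mx !rE.
Qed.

End Trace.
Arguments contract_pow_inv {R n} H G w k s X Y.

Section Cholesky.
Variable R : realType.

(** One step of the Gram-Schmidt process: split off the first coordinate and
    use the Schur complement. *)
Lemma posdef_frame_step n (G : 'M[R]_(1 + n)) :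
  (forall S : 'M[R]_n, posdef S -> exists F : 'M[R]_n, F *m S *m F^T = 1%:M) ->
  posdef G -> exists E : 'M[R]_(1 + n), E *m G *m E^T = 1%:M.
Proof.
move=> IH [Gs Gp].
pose a := ulsubmx G; pose b := ursubmx G; pose C := drsubmx G.
have GE : G = block_mx a b b^T C.
  rewrite -[LHS]submxK; congr block_mx.
  by rewrite -{1}Gs -trmx_ursub.
have a0 : 0 < a 0 0.
  have := Gp (row_mx 1%:M 0).
  rewrite {1}GE mul_row_block !mul1mx !mul0mx !addr0 tr_row_mx mul_row_col.
  rewrite trmx1 mulmx1 trmx0 mulmx0 addr0; apply.
  apply/eqP => /(congr1 lsubmx); rewrite row_mxKl => /matrixP/(_ 0 0).
  by rewrite !mxE /= => /eqP; rewrite oner_eq0.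
have aE : a = (a 0 0)%:M by rewrite [LHS]mx11_scalar.
(* the Schur complement of the first diagonal entry *)
pose S := C - (a 0 0)^-1 *: (b^T *m b).
have Cs : C^T = C by rewrite /C trmx_drsub Gs.
have Ss : S^T = S.
  by rewrite /S linearB /= linearZ /= trmx_mul trmxK Cs.
have [|F FS] := IH S.
  split=> // v v0.
  pose u := row_mx (- ((a 0 0)^-1 *: (v *m b^T))) v : 'rV[R]_(1 + n).
  have u0 : u != 0.
    apply: contra v0 => /eqP /(congr1 rsubmx).
    by rewrite row_mxKr => ->; apply/eqP/matrixP => i j; rewrite !mxE.
  have := Gp u u0; rewrite GE mul_row_block tr_row_mx mul_row_col.
  have -> : - ((a 0 0)^-1 *: (v *m b^T)) *m a + v *m b^T = 0.
    rewrite {2}aE mul_mx_scalar scalerN scalerA divff ?gt_eqF // scale1r.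
    by rewrite addrC subrr.
  rewrite mul0mx add0r; congr (0 < _ 0 0); congr (_ *m _).
  by rewrite /S mulmxBr mulNmx -scalemxAl -mulmxA scalemxAr addrC.
pose r := (Num.sqrt (a 0 0))^-1.
exists (block_mx r%:M 0 (- ((a 0 0)^-1 *: (F *m b^T))) F : 'M[R]_(1 + n)).
rewrite GE (mulmx_block (r%:M)) tr_block_mx mulmx_block.
rewrite !mul0mx !addr0 trmx0 !mulmx0 !addr0.
have -> : - ((a 0 0)^-1 *: (F *m b^T)) *m a + F *m b^T = 0.
  rewrite {2}aE mul_mx_scalar scalerN scalerA divff ?gt_eqF // scale1r.
  by rewrite addrC subrr.
rewrite !mul0mx !add0r.
have -> : (- ((a 0 0)^-1 *: (F *m b^T)) *m b + F *m C) *m F^T = 1%:M.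
  rewrite -FS; congr (_ *m _).
  by rewrite /S mulmxBr mulNmx -scalemxAl -mulmxA scalemxAr addrC.
have -> : r%:M *m a *m (r%:M)^T = 1%:M.
  rewrite {1}aE tr_scalar_mx -!scalar_mxM; congr (_%:M).
  rewrite /r mulrAC -expr2 exprVn sqr_sqrtr ?ltW // mulVf // gt_eqF //.
have -> : r%:M *m a *m (- ((a 0 0)^-1 *: (F *m b^T)))^T + r%:M *m b *m F^T = 0.
  have -> : (- ((a 0 0)^-1 *: (F *m b^T)))^T = - ((a 0 0)^-1 *: (b *m F^T)).
    by rewrite -[b in RHS]trmxK -trmx_mul; apply/matrixP => i j; rewrite !mxE.
  rewrite {1}aE -!mulmxA !mul_scalar_mx.
  by rewrite !scalerN (scalerA (a 0 0)) divff ?gt_eqF // scale1r addrC subrr.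
by rewrite -scalar_mx_block.
Qed.

Lemma posdef_frame n (G : 'M[R]_n) : posdef G ->
  exists E : 'M[R]_n, E *m G *m E^T = 1%:M.
Proof.
elim: n G => [|n IH] G Gp; first by exists 0; apply/matrixP => -[].
exact: (posdef_frame_step IH Gp).
Qed.

Lemma onbP n (G : 'M[R]_n) : posdef G -> onb G *m G *m (onb G)^T = 1%:M.
Proof.
move=> /posdef_frame[E HE].
exact: (@xgetPex _ 1%:M [set F : 'M[R]_n | F *m G *m F^T = 1%:M]
    (ex_intro _ E HE)).
Qed.

End Cholesky.

(** * Differential calculus of scalar functions *)

Section DerivationRules.
Variables (R : realType) (V : normedModType R).
Implicit Types (f g : V -> R) (x v : V).

Lemma is_derD f g x v df dg : is_derive x v f df -> is_derive x v g dg ->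
  is_derive x v (fun y => f y + g y) (df + dg).
Proof. exact: is_deriveD. Qed.

Lemma is_derN f x v df : is_derive x v f df ->
  is_derive x v (fun y => - f y) (- df).
Proof. exact: is_deriveN. Qed.

Lemma is_derB f g x v df dg : is_derive x v f df -> is_derive x v g dg ->
  is_derive x v (fun y => f y - g y) (df - dg).
Proof. by move=> ? ?; apply: is_derD => //; exact: is_derN. Qed.

Lemma is_derM f g x v df dg : is_derive x v f df -> is_derive x v g dg ->
  is_derive x v (fun y => f y * g y) (df * g x + f x * dg).
Proof.
move=> fd gd; apply: (is_derive_eq (is_deriveM fd gd)).
by rewrite /GRing.scale /= addrC [g x * _]mulrC.
Qed.

Lemma is_der_cst c x v : is_derive x v (fun=> c : R) 0.
Proof. exact: is_derive_cst. Qed.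

Lemma is_derZ c f x v df : is_derive x v f df ->
  is_derive x v (fun y => c * f y) (c * df).
Proof.
by move=> fd; apply: (is_derive_eq (is_derM (is_der_cst c x v) fd));
    rewrite mul0r add0r.
Qed.

Lemma is_der_bigsum (I : finType) (f : I -> V -> R) x v (df : I -> R) :
  (forall i, is_derive x v (f i) (df i)) ->
  is_derive x v (fun y => \sum_i f i y) (\sum_i df i).
Proof.
move=> fd; rewrite (_ : (fun y => _) = \sum_i f i).
  by elim/big_ind2: _ => // [|f1 d1 f2 d2 D1 D2];
      [exact: is_der_cst|exact: is_derD].
by apply/funext => y; elim/big_rec2: _ => // i ? ? _ ->.
Qed.

Lemma is_der_bigprod m (f : 'I_m -> V -> R) x v (df : 'I_m -> R) :
  (forall i, is_derive x v (f i) (df i)) ->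
  is_derive x v (fun y => \prod_i f i y)
    (\sum_j df j * \prod_(i < m | i != j) f i x).
Proof.
elim: m f df => [|m IH] f df fd.
  rewrite big_ord0 (_ : (fun y => _) = fun=> 1); first exact: is_der_cst.
  by apply/funext => y; rewrite big_ord0.
rewrite (_ : (fun y => _) = fun y => f ord0 y * \prod_i f (lift ord0 i) y);
    last first.
  by apply/funext => y; rewrite big_ord_recl.
have IH' := IH (fun i => f (lift ord0 i)) _ (fun i => fd (lift ord0 i)).
apply: (is_derive_eq (is_derM (fd ord0) IH')).
rewrite big_ord_recl; congr (_ * _ + _).
  by rewrite [RHS]big_mkcond big_ord_recl /= mul1r.
rewrite mulr_sumr; apply: eq_bigr => j _.
rewrite mulrCA [in RHS]big_mkcond big_ord_recl /= [in LHS]big_mkcond.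
by congr (_ * (_ * _)); apply: eq_bigr => i _; rewrite (inj_eq lift_inj).
Qed.

Lemma is_der_unique f x v d1 d2 : is_derive x v f d1 -> is_derive x v f d2 ->
    d1 = d2.
Proof. by move=> [_ <-] [_ <-]. Qed.

Lemma is_der_derive f x v df : is_derive x v f df -> 'D_v f x = df.
Proof. by case. Qed.

Lemma diff_is_der f x v : differentiable f x -> is_derive x v f ('D_v f x).
Proof. by move=> fd; apply: derivableP; exact: diff_derivable. Qed.

(** Jacobi's formula, from the Leibniz expansion of the determinant. *)
Lemma is_der_det m (M : V -> 'M[R]_m) x v (dM : 'M[R]_m) :
  (forall i j, is_derive x v (fun y => M y i j) (dM i j)) ->
  is_derive x v (fun y => \det (M y)) (\sum_i \sum_j dM i j
      * cofactor (M x) i j).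
Proof.
move=> Md.
have H (s : 'S_m) := is_derZ ((-1) ^+ s) (is_der_bigprod (fun i => Md i (s i))).
apply: (is_derive_eq (is_der_bigsum H)).
transitivity (\sum_i \det (\matrix_(k, j) if k == i then dM i j else M x k j)).
  under eq_bigr => s _ do rewrite mulr_sumr.
  rewrite exchange_big; apply: eq_bigr => i _; apply: eq_bigr => s _.
  rewrite [in RHS](bigD1 i) //= !mxE eqxx; congr (_ * (_ * _)).
  by apply: eq_bigr => k ki; rewrite mxE (negbTE ki).
apply: eq_bigr => i _; rewrite (expand_det_row _ i); apply: eq_bigr => j _.
rewrite mxE eqxx; congr (_ * (_ * \det _)).
by apply/matrixP => k l; rewrite !mxE eq_sym (negbTE (neq_lift _ _)).
Qed.

End DerivationRules.

Lemma near_eq_differentiable (R : realFieldType) (V W : normedModType R)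
    (f g : V -> W) (x : V) :
  (\near x, f x = g x) -> differentiable f x -> differentiable g x.
Proof.
move=> fg fd; have fgx := nbhs_singleton fg.
have gE : g \o shift x = cst (g x) + 'd f x +o_ 0 id.
  apply/eqaddoP => eps e0.
  have /eqaddoP/(_ eps e0) := diff_locally fd.
  have := fg; rewrite (near_shift 0 x) /= subr0 => fgn fo.
  apply: filterS2 fgn fo => h /= e.
  by rewrite !fctE /= e fgx.
have dE : 'd g x = 'd f x :> (V -> W) by apply: diff_unique gE;
    exact: diff_continuous.
by apply/diff_locallyP; rewrite dE; split=> //; exact: diff_continuous.
Qed.

Section VectorChain.
Variables (R : realType) (n : nat) (S : normedModType R).
Local Notation V := 'rV[R]_n.

Lemma is_der_row (W : S -> V) (x v : S) (dW : V) :
  is_derive x v W dW <-> forall i, is_derive x v (fun y => W y 0 i) (dW 0 i).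
Proof.
split=> [[Wd We] i|Wd].
  have Wi := proj1 (derivable_mxP _ _ _) Wd 0 i.
  apply: DeriveDef => //.
  by have := derive_mx Wd; rewrite We => ->; rewrite mxE.
have Wd' : derivable W x v.
  by apply/derivable_mxP => i j; rewrite (ord1 i); case: (Wd j).
apply: DeriveDef => //; rewrite derive_mx //; apply/rowP => i; rewrite mxE.
by case: (Wd i).
Qed.

(** Only a direction is needed in the inner function: restrict it to the
    line through x along z and compose there. *)
Lemma is_der_chain (f : V -> R) (phi : S -> V) (x z : S) (dphi : V) :
  differentiable f (phi x) -> is_derive x z phi dphi ->
  is_derive x z (fun y => f (phi y)) ('D_dphi f (phi x)).
Proof.
move=> fd [pd pe].
pose c (h : R) := phi (h *: z + x).
have c0 : c 0 = phi x by rewrite /c scale0r add0r.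
have cd : derivable c 0 1 by move/derivable1P: pd.
have cdiff : differentiable c 0 by apply/derivable1_diffP.
have fc : differentiable f (c 0) by rewrite c0.
have fcd : differentiable (f \o c) 0 by exact: differentiable_comp.
have D0 (W : normedModType R) (g : S -> W) :
    'D_1 (fun h : R => g (h *: z + x)) 0 = 'D_z g x.
  rewrite /derive; set g1 := fun h => h^-1 *: _; set g2 := fun h => h^-1 *: _.
  suff -> : g1 = g2 by [].
  by apply/funext => h; rewrite /g1 /g2 /= addr0 scale0r add0r [h%:A]mulr1.
apply: DeriveDef; first by apply/derivable1P/derivable1_diffP; exact: fcd.
rewrite -(D0 _ (fun y => f (phi y))) -/(f \o c) deriveE // diff_comp //=.
by rewrite deriveE // -c0; congr ('d f _ _);
    rewrite -deriveE // -pe -(D0 _ phi).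
Qed.

End VectorChain.

Section VectorCalculus.
Variables (R : realType) (n : nat).
Local Notation V := 'rV[R]_n.
Local Notation d i := (delta_mx 0 i : V).

(** The Leibniz rule for a linear form applied to a vector, both depending
    on the point; iterating it differentiates multilinear forms in moving
    vectors. *)
Lemma is_der_lin (F : V -> V -> R) (W : V -> V) (x v dW : V) (dF : V -> R) :
  (forall y, linear_fun (F y)) -> (forall z,
      is_derive x v (fun y => F y z) (dF z)) ->
  (forall i, is_derive x v (fun y => W y 0 i) (dW 0 i)) ->
  is_derive x v (fun y => F y (W y)) (dF (W x) + F x dW).
Proof.
move=> Fl Fd Wd.
have dFE z : dF z = \sum_i z 0 i * dF (d i).
  apply: is_der_unique (Fd z) _.
  rewrite (_ : (fun y => F y z) = fun y => \sum_i z 0 i * F y (d i)).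
    by apply: is_der_bigsum => i; exact: is_derZ.
  by apply/funext => y; exact: linear_fun_delta.
rewrite (_ : (fun y => F y (W y)) = fun y => \sum_i W y 0 i * F y (d i));
    last first.
  by apply/funext => y; exact: linear_fun_delta.
apply: (is_derive_eq (is_der_bigsum (fun i => is_derM (Wd i) (Fd (d i))))).
by rewrite big_split addrC -dFE; congr (_ + _);
    rewrite [RHS](linear_fun_delta _ (Fl x)).
Qed.

Variable U : set V.
Hypothesis oU : open U.

Lemma open_near x (P : V -> Prop) : U x -> (forall y, U y -> P y) ->
    \near x, P x.
Proof. by move=> Ux UP; apply: filterS UP _; exact: open_nbhs_nbhs. Qed.

Lemma diff_near (f g : V -> R) x : U x -> (forall y, U y -> f y = g y) ->
  differentiable f x -> differentiable g x.
Proof. by move=> Ux fg; apply: near_eq_differentiable; exact: open_near fg. Qed.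

(** All partial derivatives of order at most m are differentiable; the
    recursion takes the innermost derivative first, so that closure
    properties follow by induction on m. *)
Fixpoint differentiable_upto m (f : V -> R) :=
    (forall x, U x -> differentiable f x) /\
  if m is k.+1 then forall i, differentiable_upto k (fun x => 'D_(d i) f x)
      else True.

Lemma smooth_differentiable_upto f : smooth_on U f <-> forall m,
    differentiable_upto m f.
Proof.
split=> [fs m|fs s].
  elim: m f fs => [|m IH] f fs; first by split=> // x; exact: (fs [::]).
  split=> [|i]; first by move=> x; exact: (fs [::]).
  apply: IH => s; have := fs (rcons s i).
  by rewrite /iter_partial foldr_rcons.
elim/last_ind: s f fs => [|s i IH] f fs x Ux; first exact: (proj1 (fs 0%N)).
rewrite /iter_partial foldr_rcons; apply: (IH _ _ x Ux) => m.
exact: (proj2 (fs m.+1) i).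
Qed.

Lemma differentiable_upto_ext m f g : (forall y, U y -> f y = g y) ->
    differentiable_upto m f -> differentiable_upto m g.
Proof.
elim: m f g => [|m IH] f g fg [fd fs].
  by split=> // x Ux; apply: diff_near fg _ => //; exact: fd.
split=> [x Ux|i]; first by apply: diff_near fg _ => //; exact: fd.
apply: IH (fs i) => y Uy; apply: near_eq_derive; exact: open_near fg.
Qed.

Lemma differentiable_upto_diff m f x : differentiable_upto m f -> U x ->
    differentiable f x.
Proof. by case: m => [|m] [fd _]; exact: fd. Qed.

Lemma differentiable_uptoW m f : differentiable_upto m.+1 f ->
    differentiable_upto m f.
Proof.
elim: m f => [|m IH] f [fd fs]; first by split.
by split=> // i; apply: IH; exact: fs.
Qed.

Lemma differentiable_upto_cst m (c : R) : differentiable_upto m (fun=> c).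
Proof.
have dc c' x : differentiable (fun=> c' : R) x by exact: differentiable_cst.
elim: m c => [|m IH] c; split=> // i.
by apply: differentiable_upto_ext (IH 0) => y _; rewrite derive_cst.
Qed.

Lemma differentiable_uptoD m f g : differentiable_upto m f ->
    differentiable_upto m g -> differentiable_upto m (fun x => f x + g x).
Proof.
elim: m f g => [|m IH] f g [fd fs] [gd gs].
  by split=> // x Ux; apply: differentiableD; [exact: fd|exact: gd].
split=> [x Ux|i]; first by apply: differentiableD; [exact: fd|exact: gd].
apply: differentiable_upto_ext (IH _ _ (fs i) (gs i)) => y Uy;
    apply/esym/is_der_derive.
by apply: is_derD; apply: diff_is_der; [exact: fd|exact: gd].
Qed.

Lemma differentiable_uptoM m f g : differentiable_upto m f ->
    differentiable_upto m g -> differentiable_upto m (fun x => f x * g x).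
Proof.
elim: m f g => [|m IH] f g fs gs.
  split=> // x Ux; apply: differentiableM;
      [exact: differentiable_upto_diff fs Ux|exact: differentiable_upto_diff gs
      Ux].
have fd := differentiable_upto_diff fs; have gd := differentiable_upto_diff gs.
split=> [x Ux|i]; first by apply: differentiableM; [exact: fd|exact: gd].
apply: (@differentiable_upto_ext _ (fun x =>
    'D_(d i) f x * g x + f x * 'D_(d i) g x)).
  move=> y Uy; apply/esym/is_der_derive.
  by apply: is_derM; apply: diff_is_der; [exact: fd|exact: gd].
by apply: differentiable_uptoD; apply: IH;
    [exact: (proj2 fs i)|exact: differentiable_uptoW|exact:
    differentiable_uptoW|exact: (proj2 gs i)].
Qed.

Lemma differentiable_uptoV m f : (forall x, U x -> f x != 0) ->
    differentiable_upto m f -> differentiable_upto m (fun x => (f x)^-1).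
Proof.
move=> f0; elim: m => [|m IH] fs.
  split=> // x Ux; apply: differentiableV;
      [exact: differentiable_upto_diff fs Ux|exact: f0].
have fd := differentiable_upto_diff fs.
split=> [x Ux|i]; first by apply: differentiableV; [exact: fd|exact: f0].
apply: (@differentiable_upto_ext _ (fun x =>
    - 1 * 'D_(d i) f x * ((f x)^-1 * (f x)^-1))).
  move=> y Uy; rewrite -[RHS]/('D_(d i) (fun x => (f x)^-1) y) deriveV ?f0 //.
    by rewrite /GRing.scale /= expr2 invfM; ring.
  exact/diff_derivable/fd.
have f1 := IH (differentiable_uptoW fs).
by apply: differentiable_uptoM; [apply: differentiable_uptoM;
    [exact: differentiable_upto_cst|exact: (proj2 fs i)]|exact:
    differentiable_uptoM].
Qed.

Lemma smooth_ext f g : (forall y, U y -> f y = g y) -> smooth_on U f ->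
    smooth_on U g.
Proof. by move=> fg /smooth_differentiable_upto fs;
    apply/smooth_differentiable_upto => m;
    exact: differentiable_upto_ext (fs m). Qed.

Lemma smooth_diff f x : smooth_on U f -> U x -> differentiable f x.
Proof. by move=> fs; exact: (fs [::]). Qed.

Lemma smooth_cst (c : R) : smooth_on U (fun=> c).
Proof. by apply/smooth_differentiable_upto => m;
    exact: differentiable_upto_cst. Qed.

Lemma smoothD f g : smooth_on U f -> smooth_on U g ->
    smooth_on U (fun x => f x + g x).
Proof. by move=> /smooth_differentiable_upto fs /smooth_differentiable_upto gs;
    apply/smooth_differentiable_upto => m; exact: differentiable_uptoD. Qed.

Lemma smoothM f g : smooth_on U f -> smooth_on U g ->
    smooth_on U (fun x => f x * g x).
Proof. by move=> /smooth_differentiable_upto fs /smooth_differentiable_upto gs;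
    apply/smooth_differentiable_upto => m; exact: differentiable_uptoM. Qed.

Lemma smoothZ c f : smooth_on U f -> smooth_on U (fun x => c * f x).
Proof. by move=> fs; apply: smoothM => //; exact: smooth_cst. Qed.

Lemma smoothB f g : smooth_on U f -> smooth_on U g ->
    smooth_on U (fun x => f x - g x).
Proof.
move=> fs gs; apply: smoothD => //.
by apply: smooth_ext (smoothZ (-1) gs) => y _; rewrite mulN1r.
Qed.

Lemma smoothV f : (forall x, U x -> f x != 0) -> smooth_on U f ->
  smooth_on U (fun x => (f x)^-1).
Proof. by move=> f0 /smooth_differentiable_upto fs;
    apply/smooth_differentiable_upto => m; exact: differentiable_uptoV. Qed.

Lemma smooth_sum (I : finType) (f : I -> V -> R) :
  (forall i, smooth_on U (f i)) -> smooth_on U (fun x => \sum_i f i x).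
Proof.
move=> fs; rewrite (_ : (fun x => _) = \sum_i f i).
  by elim/big_rec: _ => [|i g _]; [exact: smooth_cst|exact: smoothD].
by apply/funext => y; elim/big_rec2: _ => // i ? ? _ ->.
Qed.

Lemma smooth_prod (I : finType) (f : I -> V -> R) :
  (forall i, smooth_on U (f i)) -> smooth_on U (fun x => \prod_i f i x).
Proof.
move=> fs; rewrite (_ : (fun x => _) = \prod_i f i).
  by elim/big_rec: _ => [|i g _]; [exact: smooth_cst|exact: smoothM].
by apply/funext => y; elim/big_rec2: _ => // i ? ? _ ->.
Qed.

Lemma smooth_det m (M : V -> 'M[R]_m) :
    (forall i j, smooth_on U (fun x => M x i j)) ->
  smooth_on U (fun x => \det (M x)).
Proof.
move=> Ms; apply: smooth_sum => s; apply: smoothZ.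
by apply: smooth_prod => i; exact: Ms.
Qed.

(** The entries are cofactors divided by the determinant. *)
Lemma smooth_invmx m (M : V -> 'M[R]_m) :
    (forall i j, smooth_on U (fun x => M x i j)) ->
  (forall x, U x -> M x \in unitmx) ->
  forall i j, smooth_on U (fun x => invmx (M x) i j).
Proof.
move=> Ms Mu i j.
apply: (@smooth_ext (fun x => (\det (M x))^-1 *
   ((-1) ^+ (j + i) * \det (row' j (col' i (M x)))))).
  by move=> y Uy; rewrite /invmx Mu // !mxE.
apply: smoothM; first apply: smoothV (smooth_det Ms).
  by move=> x Ux; have := Mu x Ux; rewrite unitmxE unitfE.
apply: smoothZ; apply: smooth_det => k l.
by apply: smooth_ext (Ms (lift j k) (lift i l)) => y _; rewrite !mxE.
Qed.

Lemma derive_lin (f : V -> R) x : differentiable f x ->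
    linear_fun (fun u => 'D_u f x).
Proof. by move=> fd c u v; rewrite !deriveE // linearP. Qed.

Lemma smooth_derive f u : smooth_on U f -> smooth_on U (fun x => 'D_u f x).
Proof.
move=> fs; apply: (@smooth_ext (fun x => \sum_i u 0 i * 'D_(d i) f x)).
  by move=> y Uy; rewrite [RHS](linear_fun_delta _
      (derive_lin (smooth_diff fs Uy))).
apply: smooth_sum => i; apply: smoothZ.
by move/smooth_differentiable_upto: fs => fs;
    apply/smooth_differentiable_upto => m; exact: (proj2 (fs m.+1) i).
Qed.

Lemma is_der_line (f : V -> R) v y (t : R) : differentiable f (t *: v + y) ->
  is_derive t 1 (fun t : R => f (t *: v + y)) ('D_v f (t *: v + y)).
Proof.
move=> fd; apply: (is_der_chain (phi := fun t : R => t *: v + y) (dphi := v)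
    fd).
apply/is_der_row => i.
apply: (near_eq_is_derive (f := fun s : R => s * v 0 i + y 0 i)).
  by near=> s; rewrite !mxE.
apply: (is_derive_eq (is_derD (is_derM (is_derive_id t 1) (is_der_cst _ t 1))
    (is_der_cst _ t 1))).
by rewrite mulr0 !addr0 mul1r.
Unshelve. all: by end_near. Qed.

(** The second difference of f on the parallelogram spanned by h u and h v. *)
Definition second_diff (f : V -> R) u v x (h : R) :=
  f (h *: v + (h *: u + x)) - f (h *: u + x) - (f (h *: v + x) - f x).

(** The mean value theorem in the direction v writes the second difference
    as h times a difference of D_v f at points h u apart, and
    differentiability of D_v f at x evaluates that difference up to o(h). *)
Lemma second_diff_le f u v x (e : R) : U x ->
  (forall y, U y -> differentiable f y) ->
  differentiable (fun y => 'D_v f y) x -> 0 < e ->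
  exists2 r : R, 0 < r & forall h, 0 < h -> h < r ->
    `|second_diff f u v x h - h ^+ 2 * 'D_u (fun y => 'D_v f y) x| <= e
        * h ^+ 2.
Proof.
move=> Ux fd; set A := (fun y => 'D_v f y) => Ad e0.
pose K : R := `|u| + `|v| + 1.
have K0 : 0 < K by rewrite /K ltr_wpDl // addr_ge0.
have [r1 /= r10 Ur] : exists2 r : R, 0 < r & forall y, `|x - y| < r -> U y.
  have /nbhs_ballP[r r0 rU] : nbhs x U by exact: open_nbhs_nbhs.
  by exists r => // y xy; apply: rU; rewrite -ball_normE.
(* two error terms, each at most e1 h K, are allowed *)
pose e1 := e / (2 * K).
have e10 : 0 < e1 by rewrite /e1 divr_gt0 // mulr_gt0.
have [r2 /= r20 Ar] : exists2 r : R, 0 < r & forall k, `|k| < r ->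
    `|A (k + x) - (A x + 'D_k A x)| <= e1 * `|k|.
  have /eqaddoP/(_ e1 e10) := diff_locally Ad.
  move=> /nbhs_ballP[r r0 rA]; exists r => // k kr.
  have := rA k; rewrite -ball_normE /= sub0r normrN => /(_ kr).
  by rewrite !fctE deriveE.
exists (Num.min r1 r2 / K); first by rewrite divr_gt0 // lt_min r10.
move=> h h0 hr.
have hK : h * K < Num.min r1 r2 by rewrite -ltr_pdivlMr.
have small (s t : R) : 0 <= s <= h -> 0 <= t <= h ->
    `|s *: u + t *: v| <= h * K /\ `|s *: u + t *: v| < Num.min r1 r2.
  move=> /andP[s0 sh] /andP[t0 th].
  suff H : `|s *: u + t *: v| <= h * K by split=> //; exact: le_lt_trans H hK.
  rewrite (le_trans (ler_normD _ _)) // !normrZ (ger0_norm s0) (ger0_norm t0).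
  rewrite /K !mulrDr mulr1 -addrA lerD // ?ler_wpM2r //.
  by apply: ler_wpDr; [exact: ltW|exact: ler_wpM2r].
have inU (s t : R) : 0 <= s <= h -> 0 <= t <= h -> U (t *: v + (s *: u + x)).
  move=> sh th; apply: Ur.
  rewrite addrCA addrA addrC opprD addNKr normrN.
  by have [_] := small s t sh th; rewrite lt_min => /andP[].
have hh : 0 <= h <= h by rewrite ltW //=.
have zh : 0 <= (0 : R) <= h by rewrite lexx ltW.
pose phi t := f (t *: v + (h *: u + x)) - f (t *: v + x).
have phid t : 0 <= t <= h ->
    is_derive t 1 phi (A (t *: v + (h *: u + x)) - A (t *: v + x)).
  move=> th; apply: is_derB; apply: is_der_line; apply: fd; first exact: inU.
  by have := inU 0 t zh th; rewrite scale0r add0r.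
have [c ch phiE] : exists2 c, c \in `]0, h[%R & phi h - phi 0 =
    (A (c *: v + (h *: u + x)) - A (c *: v + x)) * (h - 0).
  apply: (MVT (f := phi) (df := fun t =>
      A (t *: v + (h *: u + x)) - A (t *: v + x))) => //.
    by move=> t; rewrite in_itv /= => /andP[t0 th]; apply: phid; rewrite !ltW.
  apply: derivable_within_continuous => t; rewrite in_itv /= => th.
  by case: (phid t th).
have {ch} ch : 0 <= c <= h by move: ch; rewrite in_itv /= => /andP[? ?];
    rewrite !ltW.
have -> : second_diff f u v x h = phi h - phi 0.
  by rewrite /second_diff /phi !scale0r !add0r; ring.
rewrite phiE subr0 expr2.
have Al := derive_lin Ad.
have [k1 k1'] := small h c hh ch.
have [k2 k2'] := small 0 c zh ch.
rewrite lt_min in k1'; case/andP: k1' => _ /Ar A1.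
rewrite lt_min in k2'; case/andP: k2' => _ /Ar A2.
rewrite scale0r add0r in k2 A2.
have DE : 'D_(h *: u + c *: v) A x = h * 'D_u A x + 'D_(c *: v) A x.
  by rewrite Al.
have -> : c *: v + (h *: u + x) = h *: u + c *: v + x by rewrite addrCA addrA.
set a1 := A (h *: u + c *: v + x) in A1 *; set a2 := A (c *: v + x) in A2 *.
rewrite DE in A1.
have ringE (b1 b2 p q z t : R) : (b1 - b2) * t - t * t * p =
    t * ((b1 - (z + (t * p + q))) - (b2 - (z + q))) by ring.
rewrite (ringE _ _ _ ('D_(c *: v) A x) (A x)).
rewrite normrM (gtr0_norm h0) mulrCA ler_pM2l //.
apply: le_trans (ler_normB _ _) _.
apply: le_trans (lerD A1 A2) _.
have -> : e * h = e1 * (h * K) + e1 * (h * K).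
  by rewrite /e1; field; rewrite gt_eqF.
by apply: lerD; rewrite ler_pM2l.
Qed.

(** The second difference is symmetric in u and v, so that both mixed
    derivatives are its limit after division by h^2. *)
Lemma schwarz f u v x : smooth_on U f -> U x ->
  'D_u (fun y => 'D_v f y) x = 'D_v (fun y => 'D_u f y) x.
Proof.
move=> fs Ux.
have fd y : U y -> differentiable f y by exact: smooth_diff.
set a := LHS; set b := RHS.
apply/eqP; rewrite -subr_eq0 -normr_eq0 eq_le normr_ge0 andbT.
apply/ler_addgt0Pl => e e0; rewrite addr0.
have e20 : 0 < e / 2 by rewrite divr_gt0.
have [r1 r10 H1] := second_diff_le u Ux fd
    (smooth_diff (smooth_derive v fs) Ux) e20.
have [r2 r20 H2] := second_diff_le v Ux fd
    (smooth_diff (smooth_derive u fs) Ux) e20.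
pose h := Num.min r1 r2 / 2.
have m0 : 0 < Num.min r1 r2 by rewrite lt_min r10.
have h0 : 0 < h by rewrite divr_gt0.
have : h < Num.min r1 r2 by rewrite /h ltr_pdivrMr // mulr_natr mulr2n ltrDl.
rewrite lt_min => /andP[hr1 hr2].
have {}H1 := H1 h h0 hr1; have {}H2 := H2 h h0 hr2.
have sE : second_diff f v u x h = second_diff f u v x h.
  by rewrite /second_diff addrCA; ring.
rewrite sE in H2.
have hh : 0 < h ^+ 2 by rewrite exprn_gt0.
rewrite -(ler_pM2l hh) -[X in X * _](ger0_norm (ltW hh)) -normrM.
have -> : h ^+ 2 * (a - b) = (second_diff f u v x h - h ^+ 2 * b)
    - (second_diff f u v x h - h ^+ 2 * a) by ring.
apply: le_trans (ler_normB _ _) _.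
apply: le_trans (lerD H2 H1) _.
by rewrite -mulrDl -splitr mulrC.
Qed.

End VectorCalculus.

(** * The Levi-Civita connection and its curvature in a chart *)

Section Inner.
Variables (R : realType) (n : nat).
Local Notation V := 'rV[R]_n.
Local Notation d i := (delta_mx 0 i : V).

Lemma inner_linl (G : 'M[R]_n) z : linear_fun (fun u => inner G u z).
Proof. by move=> c u v; rewrite /inner !mulmxDl -!scalemxAl !mxE. Qed.

Lemma inner_linr (G : 'M[R]_n) u : linear_fun (fun z => inner G u z).
Proof. by move=> c z w; rewrite /inner linearP /= mulmxDr -!scalemxAr !mxE. Qed.

Lemma inner_delta (G : 'M[R]_n) i j : inner G (d i) (d j) = G i j.
Proof.
rewrite /inner -rowE mxE (bigD1 j) //= big1 ?addr0 => [|k kj].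
  by rewrite !mxE !eqxx mulr1.
by rewrite !mxE (negbTE kj) andbF mulr0.
Qed.

Lemma linear_fun_eq f g : linear_fun f -> linear_fun g ->
    (forall i, f (d i) = g (d i)) ->
  forall u : V, f u = g u.
Proof.
move=> fl gl fg u; rewrite (linear_fun_delta u fl) (linear_fun_delta u gl).
by apply: eq_bigr => i _; rewrite fg.
Qed.

Lemma posdef_unit (G : 'M[R]_n) : posdef G -> G \in unitmx.
Proof. by move=> /onbP /frameV /mulmx1_unit[]. Qed.

(** Testing against the coordinate vectors suffices. *)
Lemma inner_inj (G : 'M[R]_n) u v : G \in unitmx ->
  (forall z, inner G u z = inner G v z) -> u = v.
Proof.
move=> Gu H; apply: (can_inj (mulmxK Gu)); apply/rowP => i.
by have := H (d i); rewrite /inner trmx_delta -!colE ![col _ _ _ _]mxE.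
Qed.

Lemma linear_fun_derive (F : V -> V -> R) (x u : V) :
    (forall y, linear_fun (F y)) ->
  (forall z, differentiable (fun y => F y z) x) ->
  linear_fun (fun z => 'D_u (fun y => F y z) x).
Proof.
move=> Fl Fd c z w; apply: is_der_derive.
rewrite (_ : (fun y => _) = fun y => c * F y z + F y w); last first.
  by apply/funext => y; rewrite Fl.
by apply: is_derD; [apply: is_derZ|]; exact: diff_is_der.
Qed.

Definition linear_map (f : V -> V) := forall c u v, f (c *: u + v) =
    c *: f u + f v.

Lemma linear_fun_comp f (g : V -> V) : linear_fun f -> linear_map g ->
    linear_fun (fun u => f (g u)).
Proof. by move=> fl gl c u v; rewrite gl fl. Qed.

End Inner.

Section LeviCivita.
Variables (R : realType) (n : nat).
Local Notation V := 'rV[R]_n.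
Local Notation d i := (delta_mx 0 i : V).
Variables (U : set V) (G : V -> 'M[R]_n).
Hypothesis oU : open U.
Hypothesis Gs : forall i j, smooth_on U (fun x => G x i j).
Hypothesis Gp : forall x, U x -> posdef (G x).

Local Notation gm y := (inner (G y)).
Local Notation Gam := (christoffel_vec G).

Lemma inner_symm y u v : U y -> gm y u v = gm y v u.
Proof. by move=> Uy; apply: innerC; case: (Gp Uy). Qed.

Lemma inner_smooth u w : smooth_on U (fun y => gm y u w).
Proof.
apply: (@smooth_ext _ _ _ oU (fun y => \sum_i u 0 i * \sum_j w 0 j * G y i j)).
  move=> y _; rewrite (linear_fun_delta _ (inner_linl (G y) w)).
  apply: eq_bigr => i _; rewrite (linear_fun_delta _ (inner_linr (G y) (d i))).
  by congr (_ * _); apply: eq_bigr => j _; rewrite inner_delta.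
apply: (smooth_sum oU) => i; apply: (smoothZ oU); apply: (smooth_sum oU) => j.
exact: (smoothZ oU).
Qed.

Lemma inner_diff u w y : U y -> differentiable (fun y => gm y u w) y.
Proof. by move=> Uy; exact: smooth_diff (inner_smooth u w) Uy. Qed.

Lemma christoffel_vec_linl y w : linear_map (fun v => Gam y v w).
Proof.
move=> c u v; apply/rowP => l; rewrite !mxE mulr_sumr -big_split.
apply: eq_bigr => i _ /=; rewrite mulr_sumr -big_split.
by apply: eq_bigr => j _ /=; rewrite !mxE; ring.
Qed.

Lemma christoffel_vec_linr y v : linear_map (Gam y v).
Proof.
move=> c u w; apply/rowP => l; rewrite !mxE mulr_sumr -big_split.
apply: eq_bigr => i _ /=; rewrite mulr_sumr -big_split.
by apply: eq_bigr => j _ /=; rewrite !mxE; ring.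
Qed.

Lemma christoffel_smooth l i j : smooth_on U (fun y => christoffel G y l i j).
Proof.
apply: (smoothZ oU); apply: (smooth_sum oU) => m; apply: (smoothM oU).
  apply: (smooth_invmx oU) => // y Uy; exact/posdef_unit/Gp.
apply: (smoothB oU); [apply: (smoothD oU)|]; exact: (smooth_derive oU).
Qed.

Lemma christoffel_vec_smooth v w l : smooth_on U (fun y => Gam y v w 0 l).
Proof.
apply: (@smooth_ext _ _ _ oU
  (fun y => \sum_i \sum_j v 0 i * w 0 j * christoffel G y l i j)).
  move=> y _; rewrite mxE; apply: eq_bigr => i _; apply: eq_bigr => j _.
  by ring.
by do 2![apply: (smooth_sum oU) => ?]; apply: (smoothZ oU);
    exact: christoffel_smooth.
Qed.

(** The Christoffel symbols with the upper index lowered. *)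
Definition christoffel_form y v w z := gm y (Gam y v w) z.

Lemma christoffel_form_lin1 y w z : linear_fun
    (fun v => christoffel_form y v w z).
Proof. exact: linear_fun_comp (inner_linl _ _) (christoffel_vec_linl _ _). Qed.

Lemma christoffel_form_lin2 y v z : linear_fun
    (fun w => christoffel_form y v w z).
Proof. exact: linear_fun_comp (inner_linl _ _) (christoffel_vec_linr _ _). Qed.

Lemma christoffel_form_lin3 y v w : linear_fun (christoffel_form y v w).
Proof. exact: inner_linr. Qed.

Lemma christoffel_form_smooth v w z : smooth_on U
    (fun y => christoffel_form y v w z).
Proof.
apply: (@smooth_ext _ _ _ oU (fun y => \sum_l Gam y v w 0 l * gm y (d l) z)).
  by move=> y _; rewrite -(linear_fun_delta _ (inner_linl (G y) z)).
apply: (smooth_sum oU) => l; apply: (smoothM oU);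
    first exact: christoffel_vec_smooth.
exact: inner_smooth.
Qed.

Lemma christoffel_form_diff v w z y : U y ->
    differentiable (fun y => christoffel_form y v w z) y.
Proof. by move=> Uy; exact: smooth_diff (christoffel_form_smooth v w z) Uy. Qed.

(** Both sides are linear in v, w and z, so that it suffices to check the
    coordinate vectors, where the definition of the Christoffel symbols is
    the formula raised by the inverse Gram matrix. *)
Lemma koszul y v w z : U y -> christoffel_form y v w z =
  2^-1 * ('D_v (fun x => gm x w z) y + 'D_w (fun x => gm x v z) y
          - 'D_z (fun x => gm x v w) y).
Proof.
move=> Uy.
have dl u w' : linear_fun (fun v => 'D_v (fun x => gm x u w') y).
  by apply: derive_lin; exact: inner_diff.
have ddl u w' : linear_fun (fun v => 'D_u (fun x => gm x v w') y).
  by apply: linear_fun_derive => [x|v']; [exact: inner_linl|exact: inner_diff].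
have ddr u w' : linear_fun (fun v => 'D_u (fun x => gm x w' v) y).
  by apply: linear_fun_derive => [x|v']; [exact: inner_linr|exact: inner_diff].
have lin3 (k a b c a' b' c' : R) :
    2^-1 * ((k * a + a') + (k * b + b') - (k * c + c')) =
    k * (2^-1 * (a + b - c)) + 2^-1 * (a' + b' - c') by ring.
move: v; apply: linear_fun_eq; first exact: christoffel_form_lin1.
  by move=> c u v; rewrite dl !ddl lin3.
move=> i; move: w; apply: linear_fun_eq; first exact: christoffel_form_lin2.
  by move=> c u v; rewrite dl ddl ddr lin3.
move=> j; move: z; apply: linear_fun_eq; first exact: christoffel_form_lin3.
  by move=> c u v; rewrite dl !ddr lin3.
move=> p.
have gE k l : (fun x => gm x (d k) (d l)) = (fun x => G x k l).
  by apply/funext => x; rewrite inner_delta.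
rewrite !gE /christoffel_form (linear_fun_delta _ (inner_linl _ _)) /=.
have GamE l : Gam y (d i) (d j) 0 l = christoffel G y l i j.
  rewrite mxE (bigD1 i) //= (bigD1 j) //= !mxE !eqxx !mulr1.
  rewrite big1 ?addr0 => [|k kj]; last by rewrite !mxE (negbTE kj) andbF mulr0.
  rewrite big1 ?addr0 // => k ki; rewrite big1 // => l' _.
  by rewrite !mxE (negbTE ki) andbF mulr0 mul0r.
under eq_bigr => l _ do rewrite GamE inner_delta /christoffel -mulrA.
rewrite -mulr_sumr; congr (_ * _).
under eq_bigr => l _ do rewrite mulr_suml.
rewrite exchange_big /=.
have Gi m : \sum_l invmx (G y) l m * G y l p = (p == m)%:R.
  have := mulmxV (posdef_unit (Gp Uy)) => /matrixP/(_ p m).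
  rewrite !mxE => <-; apply: eq_bigr => l _; rewrite mulrC.
  by case: (Gp Uy) => /matrixP/(_ l p); rewrite mxE => ->.
rewrite (bigD1 p) //= [X in _ + X]big1 ?addr0 => [|m mp].
  under eq_bigr => l _ do rewrite mulrAC.
  by rewrite -mulr_suml Gi eqxx mul1r.
under eq_bigr => l _ do rewrite mulrAC.
by rewrite -mulr_suml Gi eq_sym (negbTE mp) mul0r.
Qed.

Lemma derive_inner_symm y u v z : U y ->
  'D_z (fun x => gm x u v) y = 'D_z (fun x => gm x v u) y.
Proof.
by move=> Uy; apply: near_eq_derive; apply: (open_near oU) Uy _ => x;
    exact: inner_symm.
Qed.

Lemma christoffel_formC y v w z : U y ->
    christoffel_form y v w z = christoffel_form y w v z.
Proof.
by move=> Uy; rewrite !koszul // [in LHS](derive_inner_symm v w z Uy)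
    [X in X - _]addrC.
Qed.

Lemma christoffel_vecC y v w : U y -> Gam y v w = Gam y w v.
Proof.
move=> Uy; apply: (inner_inj (posdef_unit (Gp Uy))) => z;
    exact: christoffel_formC.
Qed.

(** The connection is metric. *)
Lemma derive_inner y u v w : U y ->
  'D_u (fun x => gm x v w) y = christoffel_form y u v w
      + christoffel_form y u w v.
Proof.
move=> Uy; rewrite !koszul // (derive_inner_symm w v u Uy).
by set p := 'D_u _ y; set q := 'D_v _ y; set r := 'D_w _ y; field.
Qed.

Definition dchristoffel x u v w z := 'D_u (fun y => christoffel_form y v w z) x.

Lemma is_der_christoffel_form x u v w z : U x ->
  is_derive x u (fun y => christoffel_form y v w z) (dchristoffel x u v w z).
Proof. by move=> Ux; apply: diff_is_der; exact: christoffel_form_diff. Qed.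

Lemma is_der_inner x u v w : U x ->
  is_derive x u (fun y => gm y v w) (christoffel_form x u v w
      + christoffel_form x u w v).
Proof. by move=> Ux; rewrite -derive_inner //; apply: diff_is_der;
    exact: inner_diff. Qed.

(** The derivative of the Christoffel vector is tested against z by
    differentiating <G(v, w), z>; the last two terms are the derivative of
    the metric. *)
Lemma is_der_christoffel_vec x u v w : U x ->
  exists2 D : V, is_derive x u (fun y => Gam y v w) D &
    forall z, gm x D z = dchristoffel x u v w z
        - christoffel_form x u (Gam x v w) z
                         - christoffel_form x u z (Gam x v w).
Proof.
move=> Ux; exists (\row_l 'D_u (fun y => Gam y v w 0 l) x).
  by apply/is_der_row => l; rewrite mxE; apply: diff_is_der;
      exact: smooth_diff (christoffel_vec_smooth v w l) Ux.
move=> z.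
have H : is_derive x u (fun y => gm y (Gam y v w) z)
    (christoffel_form x u (Gam x v w) z + christoffel_form x u z (Gam x v w) +
      gm x (\row_l 'D_u (fun y => Gam y v w 0 l) x) z).
  apply: (is_der_lin (F := fun y p => gm y p z)
    (dF := fun p => christoffel_form x u p z + christoffel_form x u z p)).
  - by move=> y; exact: inner_linl.
  - by move=> p; exact: is_der_inner.
  - by move=> l; rewrite mxE; apply: diff_is_der;
      exact: smooth_diff (christoffel_vec_smooth v w l) Ux.
rewrite (is_der_unique (is_der_christoffel_form u v w z Ux) H).
by move: (christoffel_form x) (inner (G x)) => g g'; ring.
Qed.

(** The curvature with its index lowered before differentiating, so that no
    derivative of the inverse metric occurs. *)
Definition riem4 x u v z w :=
  dchristoffel x u v w z - dchristoffel x v u w z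
  - gm x (Gam x u z) (Gam x v w) + gm x (Gam x v z) (Gam x u w).

Lemma curvature_opE x u v w : U x ->
  curv_op G u v w x = ('D_u (fun y => Gam y v w) x + Gam x u (Gam x v w))
                    - ('D_v (fun y => Gam y u w) x + Gam x v (Gam x u w)).
Proof.
move=> Ux; rewrite /curv_op.
have nE v' : nabla G v' (fun=> w) = fun y => Gam y v' w.
  by apply/funext => y; rewrite /nabla derive_cst add0r.
by rewrite !nE.
Qed.

Lemma curvatureE x u v z w : U x -> gm x (curv_op G u v w x) z =
    riem4 x u v z w.
Proof.
move=> Ux; rewrite curvature_opE //.
have [D1 [_ ->] E1] := is_der_christoffel_vec u v w Ux.
have [D2 [_ ->] E2] := is_der_christoffel_vec v u w Ux.
have il := inner_linl (G x) z.
rewrite (linear_funB _ _ il) !(linear_funD _ _ il) E1 E2 /riem4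
    /christoffel_form.
move: (dchristoffel x) (inner (G x)) (Gam x) => h g c'; ring.
Qed.

Lemma eval4_curvature x a b c e : U x ->
    eval4 (curvature G x) a b c e = riem4 x a b c e.
Proof.
move=> Ux; rewrite /eval4 /curvature -curvatureE // /inner /metric_form.
have r0 (u v : V) : row 0 (col_mx u v : 'M[R]_(1 + 1, n)) = u.
  by rewrite -vconsE -[RHS](row_vcons0 u v); congr (row _ _); exact: val_inj.
have r1 (u v : V) : row 1 (col_mx u v : 'M[R]_(1 + 1, n)) = v.
  rewrite -vconsE; have -> : 1 = lift ord0 ord0 :> 'I_2 by exact: val_inj.
  by rewrite row_vconsS; apply/rowP => j; rewrite mxE.
by rewrite !r0 !r1.
Qed.

Lemma curvature_riem4 x A B : U x ->
  curvature G x A B = riem4 x (row 0 A) (row 1 A) (row 0 B) (row 1 B).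
Proof. by move=> Ux; rewrite -curvatureE. Qed.

Definition d2metric x u v w z := 'D_u (fun y => 'D_v (fun t => gm t w z) y) x.

Lemma d2metricC12 x u v w z : U x -> d2metric x u v w z = d2metric x v u w z.
Proof. by move=> Ux; apply: schwarz Ux => //; exact: inner_smooth. Qed.

Lemma d2metricC34 x u v w z : U x -> d2metric x u v w z = d2metric x u v z w.
Proof.
move=> Ux; apply: near_eq_derive; apply: (open_near oU) Ux _ => y.
exact: derive_inner_symm.
Qed.

Lemma dchristoffel_d2metric x u v w z : U x ->
  dchristoffel x u v w z = 2^-1 * (d2metric x u v w z + d2metric x u w v z
      - d2metric x u z v w).
Proof.
move=> Ux; apply: is_der_derive.
apply: (near_eq_is_derive (f := fun y => 2^-1 * ('D_v (fun x => gm x w z) y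
   + 'D_w (fun x => gm x v z) y - 'D_z (fun x => gm x v w) y))).
  by apply: (open_near oU) Ux _ => y Uy; rewrite koszul.
have dg a b c : is_derive x u (fun y => 'D_a (fun t => gm t b c) y)
    (d2metric x u a b c).
  by apply: diff_is_der; apply: smooth_diff Ux; apply: (smooth_derive oU);
      exact: inner_smooth.
exact: (is_derZ _ (is_derB (is_derD (dg v w z) (dg w v z)) (dg z v w))).
Qed.

(** All the symmetries of the curvature can be read off this expression. *)
Lemma riem4_d2metric x u v z w : U x -> riem4 x u v z w =
  2^-1 * (d2metric x u w v z - d2metric x u z v w - d2metric x v w u z
      + d2metric x v z u w)
  - gm x (Gam x u z) (Gam x v w) + gm x (Gam x v z) (Gam x u w).
Proof. move=> Ux; rewrite /riem4 !dchristoffel_d2metric //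
    (d2metricC12 u v w z Ux).
by move: (d2metric x) (inner (G x)) (Gam x) => h g c'; ring. Qed.

Lemma riem4_anti x a b c e : riem4 x a b c e = - riem4 x b a c e.
Proof. by rewrite /riem4; move: (dchristoffel x) (inner (G x)) (Gam x) =>
    h g c'; ring. Qed.

Lemma riem4_anti' x a b c e : U x -> riem4 x a b c e = - riem4 x a b e c.
Proof.
move=> Ux; rewrite !riem4_d2metric //.
rewrite (inner_symm (Gam x a c) _ Ux) (inner_symm (Gam x b c) _ Ux).
by move: (d2metric x) (inner (G x)) (Gam x) => h g c'; ring.
Qed.

Lemma riem4_pair x a b c e : U x -> riem4 x a b c e = riem4 x c e a b.
Proof.
move=> Ux; rewrite !riem4_d2metric //.
rewrite (d2metricC12 c b e a Ux) (d2metricC12 c a e b Ux)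
    (d2metricC12 e b c a Ux) (d2metricC12 e a c b Ux).
rewrite (d2metricC34 b c e a Ux) (d2metricC34 a c e b Ux)
    (d2metricC34 b e c a Ux) (d2metricC34 a e c b Ux).
rewrite (christoffel_vecC c a Ux) (christoffel_vecC e b Ux)
    (christoffel_vecC e a Ux) (christoffel_vecC c b Ux).
rewrite (inner_symm (Gam x b c) _ Ux).
by move: (d2metric x) (inner (G x)) (Gam x) => h g c'; ring.
Qed.

Lemma riem4_bianchi x a b c e : U x ->
  riem4 x a b c e + riem4 x c b e a + riem4 x e b a c = 0.
Proof.
move=> Ux; rewrite !riem4_d2metric //.
rewrite (d2metricC12 c a b e Ux) (d2metricC12 e c b a Ux)
    (d2metricC12 e a b c Ux).
rewrite (d2metricC34 b e c a Ux) (d2metricC34 b c e a Ux)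
    (d2metricC34 b a e c Ux).
rewrite (christoffel_vecC c a Ux) (christoffel_vecC e a Ux)
    (christoffel_vecC e c Ux).
rewrite (inner_symm (Gam x b e) _ Ux) (inner_symm (Gam x b c) _ Ux)
    (inner_symm (Gam x b a) _ Ux).
by move: (d2metric x) (inner (G x)) (Gam x) => h g c'; ring.
Qed.

End LeviCivita.

(** * The second Bianchi identity *)

Section CurvatureCalculus.
Variables (R : realType) (n : nat).
Local Notation V := 'rV[R]_n.
Local Notation d i := (delta_mx 0 i : V).

(** The two sums over rows are written out. *)
Lemma eval4_cov_deriv (G : V -> 'M[R]_n) (w : V -> dform R n 2 2) x v a b c e :
  let g := christoffel_vec G x v in
  eval4 (cov_deriv G w x v) a b c e =
  'D_v (fun y => eval4 (w y) a b c e) x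
      - (eval4 (w x) (g a) b c e + eval4 (w x) a (g b) c e)
  - (eval4 (w x) a b (g c) e + eval4 (w x) a b c (g e)).
Proof.
move=> g; rewrite /eval4 /cov_deriv.
have rb (u : V) : row ord0 u = u by apply/rowP => j; rewrite mxE.
have sb (u u' : V) : set_row u ord0 u' = u'.
  by apply: vcons_ext => i; rewrite row_set_row (ord1 i) eqxx -[u' in RHS]rb rb.
have S (F : 'M[R]_(2, n) -> R) u u' :
    \sum_(i < 2) F (set_row (col_mx u u' : 'M[R]_(1 + 1, n)) i
                     (g (row i (col_mx u u' : 'M[R]_(1 + 1, n))))) =
    F (col_mx (g u) u' : 'M[R]_(1 + 1, n))
        + F (col_mx u (g u') : 'M[R]_(1 + 1, n)).
  rewrite -!vconsE big_ord_recl big_ord_recl big_ord0 addr0.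
  by rewrite set_row_vcons0 row_vcons0 set_row_vconsS row_vconsS rb sb.
by rewrite (S (fun A => w x A _)) (S (w x _)).
Qed.

Variables (U : set V) (G : V -> 'M[R]_n).
Hypothesis oU : open U.
Hypothesis Gs : forall i j, smooth_on U (fun x => G x i j).
Hypothesis Gp : forall x, U x -> posdef (G x).

Local Notation gm y := (inner (G y)).
Local Notation Gam := (christoffel_vec G).
Local Notation christoffel_form := (christoffel_form G).
Local Notation dchristoffel := (dchristoffel G).
Local Notation riem4 := (riem4 G).

(** The derivative only sees the points of U, where the linearity is known. *)
Lemma linear_fun_derive_on (F : V -> V -> R) (x u : V) : U x ->
  (forall y, U y -> linear_fun (F y)) ->
  (forall z, differentiable (fun y => F y z) x) ->
  linear_fun (fun z => 'D_u (fun y => F y z) x).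
Proof.
move=> Ux Fl Fd c z w; apply: is_der_derive.
apply: (near_eq_is_derive (f := fun y => c * F y z + F y w)).
  by apply: (open_near oU) Ux _ => y Uy; rewrite Fl.
by apply: is_derD; [apply: is_derZ|]; exact: diff_is_der.
Qed.

Lemma dchristoffel_quadrilinear x : U x -> quadrilinear_fun (dchristoffel x).
Proof.
move=> Ux; have gd v w z := christoffel_form_diff oU Gs Gp v w z Ux.
split=> a b c.
- exact: derive_lin.
- by apply: linear_fun_derive => // y; exact: christoffel_form_lin1.
- by apply: linear_fun_derive => // y; exact: christoffel_form_lin2.
- by apply: linear_fun_derive => // y; exact: christoffel_form_lin3.
Qed.

Lemma riem4_quadrilinear x : U x -> quadrilinear_fun (riem4 x).
Proof.
move=> Ux; have [k1 k2 k3 k4] := dchristoffel_quadrilinear Ux.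
have gl z : linear_fun (fun u => gm x u z) by exact: inner_linl.
have gr u : linear_fun (fun z => gm x u z) by exact: inner_linr.
have Gl w : linear_map (fun v => Gam x v w) by exact: christoffel_vec_linl.
have Gr v : linear_map (Gam x v) by exact: christoffel_vec_linr.
have ringE (k a1 a2 b1 b2 c1 c2 e1 e2 : R) :
   k * a1 + a2 - (k * b1 + b2) - (k * c1 + c2) + (k * e1 + e2) =
   k * (a1 - b1 - c1 + e1) + (a2 - b2 - c2 + e2) by ring.
split=> a b c k u v; rewrite /riem4.
- by rewrite k1 k2 !Gl gl gr ringE.
- by rewrite k2 k1 !Gl gr gl ringE.
- by rewrite !k4 !Gr !gl ringE.
- by rewrite !k3 !Gr !gr ringE.
Qed.

Lemma inner_christoffel_smooth a c b e :
  smooth_on U (fun y => gm y (Gam y a c) (Gam y b e)).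
Proof.
apply: (@smooth_ext _ _ _ oU (fun y => \sum_l Gam y b e 0 l
    * christoffel_form y a c (d l))).
  by move=> y _; rewrite -(linear_fun_delta _
      (@christoffel_form_lin3 _ _ G y a c)).
apply: (smooth_sum oU) => l; apply: (smoothM oU);
    first exact: christoffel_vec_smooth.
exact: christoffel_form_smooth.
Qed.

Lemma riem4_smooth a b c e : smooth_on U (fun y => riem4 y a b c e).
Proof.
apply: (smoothD oU); last exact: inner_christoffel_smooth.
apply: (smoothB oU); last exact: inner_christoffel_smooth.
by apply: (smoothB oU); apply: (smooth_derive oU);
    exact: christoffel_form_smooth.
Qed.

(** The Leibniz rule; the derivative of the second Christoffel vector is
    replaced by its value in [is_der_christoffel_vec]. *)
Lemma is_der_inner_christoffel x p u z v w : U x ->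
  is_derive x p (fun y => gm y (Gam y u z) (Gam y v w))
   (dchristoffel x p u z (Gam x v w) + dchristoffel x p v w (Gam x u z)
    - christoffel_form x p (Gam x v w) (Gam x u z)
        - christoffel_form x p (Gam x u z) (Gam x v w)).
Proof.
move=> Ux; have [D DG DE] := is_der_christoffel_vec oU Gs Gp p v w Ux.
have H := is_der_lin (F := fun y q => christoffel_form y u z q)
    (@christoffel_form_lin3 _ _ G ^~ u ^~ z)
  (fun q => is_der_christoffel_form oU Gs Gp p u z q Ux)
      (proj1 (is_der_row _ _ _ _) DG).
apply: (is_derive_eq H).
by rewrite -[christoffel_form x u z D]/(gm x (Gam x u z) D)
    (inner_symm Gp _ D Ux) DE !addrA.
Qed.

Definition cov_riem4 x p u v z w :=
  'D_p (fun y => riem4 y u v z w) x - (riem4 x (Gam x p u) v z w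
      + riem4 x u (Gam x p v) z w)
  - (riem4 x u v (Gam x p z) w + riem4 x u v z (Gam x p w)).

(** Third derivatives of the metric cancel by the symmetry of second
    derivatives of the Christoffel forms. The terms that act on u and v
    cancel because the connection is symmetric and the curvature
    antisymmetric. What is left is a cyclic sum in which every product
    occurs twice with opposite signs. *)
Lemma second_bianchi x p u v z w : U x ->
  cov_riem4 x p u v z w + cov_riem4 x u v p z w + cov_riem4 x v p u z w = 0.
Proof.
move=> Ux.
pose k3 p u v w z := 'D_p (fun y => dchristoffel y u v w z) x.
have k3C p' u' v' : k3 p' u' v' w z = k3 u' p' v' w z.
  by apply: schwarz Ux => //; exact: christoffel_form_smooth.
have dR p' u' v' := is_derD (is_derB (is_derB
    (diff_is_der p' (smooth_diff (smooth_derive oU u'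
        (christoffel_form_smooth oU Gs Gp v' w z)) Ux))
    (diff_is_der p' (smooth_diff (smooth_derive oU v'
        (christoffel_form_smooth oU Gs Gp u' w z)) Ux)))
    (is_der_inner_christoffel p' u' z v' w Ux))
        (is_der_inner_christoffel p' v' z u' w Ux).
have cE p' u' v' : cov_riem4 x p' u' v' z w =
    (k3 p' u' v' w z - k3 p' v' u' w z
     - (dchristoffel x p' u' z (Gam x v' w)
         + dchristoffel x p' v' w (Gam x u' z)
        - christoffel_form x p' (Gam x v' w) (Gam x u' z)
            - christoffel_form x p' (Gam x u' z) (Gam x v' w))
     + (dchristoffel x p' v' z (Gam x u' w)
         + dchristoffel x p' u' w (Gam x v' z)
        - christoffel_form x p' (Gam x u' w) (Gam x v' z)
            - christoffel_form x p' (Gam x v' z) (Gam x u' w)))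
   - (riem4 x (Gam x p' u') v' z w + riem4 x u' (Gam x p' v') z w)
   - ((dchristoffel x u' v' w (Gam x p' z) - dchristoffel x v' u' w (Gam x p' z)
       - christoffel_form x u' (Gam x p' z) (Gam x v' w)
           + christoffel_form x v' (Gam x p' z) (Gam x u' w))
      - (dchristoffel x u' v' z (Gam x p' w)
          - dchristoffel x v' u' z (Gam x p' w)
       - christoffel_form x u' (Gam x p' w) (Gam x v' z)
           + christoffel_form x v' (Gam x p' w) (Gam x u' z))).
  rewrite /cov_riem4; congr (_ - _ - _);
      first exact: is_der_derive (dR p' u' v').
  by rewrite (riem4_anti' oU Gs Gp _ _ z _ Ux).
rewrite !cE (k3C u p v) (k3C v p u) (k3C v u p).
rewrite (christoffel_vecC oU Gs Gp u p Ux) (christoffel_vecC oU Gs Gp v p Ux)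
    (christoffel_vecC oU Gs Gp v u Ux).
rewrite (riem4_anti G x u (Gam x p v)) (riem4_anti G x v (Gam x p u)).
rewrite (riem4_anti G x p (Gam x u v)).
move: (dchristoffel x) (christoffel_form x) (riem4 x) k3 {k3C cE dR} =>
    K g r k3.
move: (Gam x p z) (Gam x u z) (Gam x v z) (Gam x p w) (Gam x u w) (Gam x v w).
move: (Gam x p u) (Gam x p v) (Gam x u v) => ? ? ? ? ? ? ? ? ?.
ring.
Qed.

Lemma eval4_cov_curvature x v a b c e : U x ->
  eval4 (cov_deriv G (curvature G) x v) a b c e = cov_riem4 x v a b c e.
Proof.
move=> Ux; rewrite eval4_cov_deriv !(eval4_curvature oU Gs Gp) // /cov_riem4;
    congr (_ - _ - _).
by apply: near_eq_derive; apply: (open_near oU) Ux _ => y;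
    exact: (eval4_curvature oU Gs Gp).
Qed.

Lemma cov_riem4_quadrilinear x v : U x -> quadrilinear_fun (cov_riem4 x v).
Proof.
move=> Ux; have [r1 r2 r3 r4] := riem4_quadrilinear Ux.
have rd a b c e : differentiable (fun y => riem4 y a b c e) x.
  exact: smooth_diff (riem4_smooth a b c e) Ux.
have Gr : linear_map (Gam x v) by exact: christoffel_vec_linr.
have ringE (k a1 a2 b1 b2 c1 c2 e1 e2 f1 f2 : R) :
   k * a1 + a2 - (k * b1 + b2 + (k * c1 + c2)) - (k * e1 + e2 + (k * f1 + f2)) =
   k * (a1 - (b1 + c1) - (e1 + f1)) + (a2 - (b2 + c2) - (e2 + f2)) by ring.
split=> a b c k s t; rewrite /cov_riem4.
- rewrite (linear_fun_derive_on (F := fun y z => riem4 y z a b c) v Ux) //.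
    by rewrite Gr !r1 ringE.
  by move=> y Uy; case: (riem4_quadrilinear Uy).
- rewrite (linear_fun_derive_on (F := fun y z => riem4 y a z b c) v Ux) //.
    by rewrite Gr !r2 ringE.
  by move=> y Uy; case: (riem4_quadrilinear Uy).
- rewrite (linear_fun_derive_on (F := fun y z => riem4 y a b z c) v Ux) //.
    by rewrite Gr !r3 ringE.
  by move=> y Uy; case: (riem4_quadrilinear Uy).
rewrite (linear_fun_derive_on (F := fun y z => riem4 y a b c z) v Ux) //.
  by rewrite Gr !r4 ringE.
by move=> y Uy; case: (riem4_quadrilinear Uy).
Qed.

End CurvatureCalculus.

(** * Change of charts *)

Lemma differentiable_row (R : realType) (n : nat) (S : normedModType R)
    (phi : S -> 'rV[R]_n) x :
  (forall i, differentiable (fun t => phi t 0 i) x) -> differentiable phi x.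
Proof.
move=> pd.
rewrite (_ : phi = \sum_i (fun t => phi t 0 i *: (delta_mx 0 i : 'rV[R]_n))).
  by apply: differentiable_sum => i; exact: differentiableZl.
by apply/funext => t; rewrite fct_sumE; exact: row_sum_delta.
Qed.

(** The derivatives of the change of coordinates phi, as vectors. They are
    locked because unification would otherwise unfold the limits that define
    them. *)
HB.lock Definition dphi (R : realType) (n : nat) (phi : 'rV[R]_n -> 'rV[R]_n)
    (y u : 'rV[R]_n) : 'rV[R]_n :=
  \row_i 'D_u (fun t => phi t 0 i) y.

HB.lock Definition d2phi (R : realType) (n : nat) (phi : 'rV[R]_n -> 'rV[R]_n)
    (y u v : 'rV[R]_n) : 'rV[R]_n :=
  \row_i 'D_u (fun t => 'D_v (fun s => phi s 0 i) t) y.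

HB.lock Definition d3phi (R : realType) (n : nat) (phi : 'rV[R]_n -> 'rV[R]_n)
    (y u v w : 'rV[R]_n) : 'rV[R]_n :=
  \row_i 'D_u (fun t => 'D_v (fun s => 'D_w (fun r => phi r 0 i) s) t) y.

Section Transition.
Variables (R : realType) (n : nat).
Local Notation V := 'rV[R]_n.
Variables (Ua Ub W : set V) (Ga Gb : V -> 'M[R]_n) (phi : V -> V).
Hypothesis oUa : open Ua.
Hypothesis oUb : open Ub.
Hypothesis oW : open W.
Hypothesis WUa : forall x, W x -> Ua x.
Hypothesis WUb : forall x, W x -> Ub (phi x).
Hypothesis Gas : forall i j, smooth_on Ua (fun x => Ga x i j).
Hypothesis Gap : forall x, Ua x -> posdef (Ga x).
Hypothesis Gbs : forall i j, smooth_on Ub (fun x => Gb x i j).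
Hypothesis Gbp : forall x, Ub x -> posdef (Gb x).
Hypothesis phis : forall i, smooth_on W (fun x => phi x 0 i).
Hypothesis Gab : forall x, W x ->
  Ga x = jacobian phi x *m Gb (phi x) *m (jacobian phi x)^T.

Local Notation ga y := (inner (Ga y)).
Local Notation gb y := (inner (Gb y)).
Local Notation Gama := (christoffel_vec Ga).
Local Notation Gamb := (christoffel_vec Gb).
Local Notation gama := (christoffel_form Ga).
Local Notation gamb := (christoffel_form Gb).

Local Notation dphi := (dphi phi).
Local Notation d2phi := (d2phi phi).
Local Notation d3phi := (d3phi phi).

Lemma dphiE y u i : dphi y u 0 i = 'D_u (fun t => phi t 0 i) y.
Proof. by rewrite dphi.unlock; exact: mxE. Qed.

Lemma d2phiE y u v i :
  d2phi y u v 0 i = 'D_u (fun t => 'D_v (fun s => phi s 0 i) t) y.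
Proof. by rewrite d2phi.unlock; exact: mxE. Qed.

Lemma d3phiE y u v w i : d3phi y u v w 0 i =
  'D_u (fun t => 'D_v (fun s => 'D_w (fun r => phi r 0 i) s) t) y.
Proof. by rewrite d3phi.unlock; exact: mxE. Qed.

Lemma is_der_phi y u : W y -> is_derive y u phi (dphi y u).
Proof.
move=> Wy; apply/is_der_row => i; rewrite dphiE; apply: diff_is_der.
exact: smooth_diff (phis i) Wy.
Qed.

Lemma jacobianE y u : W y -> u *m jacobian phi y = dphi y u.
Proof.
move=> Wy; have pd : differentiable phi y.
  by apply: differentiable_row => i; exact: smooth_diff (phis i) Wy.
by rewrite -deriveEjacobian //; case: (is_der_phi u Wy).
Qed.

Lemma is_der_dphi y u v i : W y ->
  is_derive y u (fun t => dphi t v 0 i) (d2phi y u v 0 i).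
Proof.
move=> Wy; rewrite d2phiE.
have -> : (fun t => dphi t v 0 i) = (fun t => 'D_v (fun s => phi s 0 i) t).
  by apply/funext => t; exact: dphiE.
by apply: diff_is_der; apply: smooth_diff Wy; exact: (smooth_derive oW).
Qed.

Lemma is_der_d2phi y u v w i : W y ->
  is_derive y u (fun t => d2phi t v w 0 i) (d3phi y u v w 0 i).
Proof.
move=> Wy; rewrite d3phiE.
have -> : (fun t => d2phi t v w 0 i) =
    (fun t => 'D_v (fun s => 'D_w (fun r => phi r 0 i) s) t).
  by apply/funext => t; exact: d2phiE.
apply: diff_is_der; apply: smooth_diff Wy.
by apply: (smooth_derive oW); exact: (smooth_derive oW).
Qed.

Lemma d2phiC y u v : W y -> d2phi y u v = d2phi y v u.
Proof.
by move=> Wy; apply/rowP => i; rewrite d2phiE d2phiE;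
    exact: (schwarz oW _ _ (phis i)).
Qed.

Lemma d3phiC y u v w : W y -> d3phi y u v w = d3phi y v u w.
Proof.
move=> Wy; apply/rowP => i; rewrite d3phiE d3phiE.
exact: (schwarz oW _ _ (smooth_derive oW w (phis i))).
Qed.

Lemma inner_transition y u w : W y -> ga y u w =
    gb (phi y) (dphi y u) (dphi y w).
Proof.
move=> Wy; rewrite -!jacobianE // /inner Gab // trmx_mul.
by rewrite !mulmxA.
Qed.

Lemma is_der_inner_phi y z p q : W y -> is_derive y z (fun t => gb (phi t) p q)
  (gamb (phi y) (dphi y z) p q + gamb (phi y) (dphi y z) q p).
Proof.
move=> Wy; have Uy := WUb Wy; rewrite -(derive_inner oUb Gbs Gbp _ _ _ Uy).
by apply: is_der_chain (is_der_phi z Wy); exact: inner_diff Uy.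
Qed.

Lemma is_der_inner_dphi y z u w : W y ->
  is_derive y z (fun t => gb (phi t) (dphi t u) (dphi t w))
   (gamb (phi y) (dphi y z) (dphi y u) (dphi y w)
    + gamb (phi y) (dphi y z) (dphi y w) (dphi y u)
    + gb (phi y) (d2phi y z u) (dphi y w)
        + gb (phi y) (dphi y u) (d2phi y z w)).
Proof.
move=> Wy.
apply: (is_der_lin (F := fun t q => gb (phi t) (dphi t u) q)
 (dF := fun q => gamb (phi y) (dphi y z) (dphi y u) q
    + gamb (phi y) (dphi y z) q (dphi y u) + gb (phi y) (d2phi y z u) q)).
- by move=> t; exact: inner_linr.
- move=> q; apply: (is_der_lin (F := fun t p => gb (phi t) p q)
   (dF := fun p => gamb (phi y) (dphi y z) p q + gamb (phi y) (dphi y z) q p)).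
  + by move=> t; exact: inner_linl.
  + by move=> p; exact: is_der_inner_phi.
  + by move=> i; exact: is_der_dphi.
by move=> i; exact: is_der_dphi.
Qed.

(** Differentiate the transformation of the metric and insert it in the
    Koszul formula: four of the six second-derivative terms cancel. *)
Lemma christoffel_form_transition y v w z : W y -> gama y v w z =
  gamb (phi y) (dphi y v) (dphi y w) (dphi y z)
      + gb (phi y) (d2phi y v w) (dphi y z).
Proof.
move=> Wy; have Uy := WUb Wy; rewrite (koszul oUa Gas Gap) //; last exact: WUa.
have D a b c : 'D_a (fun x => ga x b c) y =
   gamb (phi y) (dphi y a) (dphi y b) (dphi y c)
    + gamb (phi y) (dphi y a) (dphi y c) (dphi y b)
    + gb (phi y) (d2phi y a b) (dphi y c) + gb (phi y) (dphi y b) (d2phi y a c).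
  rewrite -(is_der_derive (is_der_inner_dphi a b c Wy)).
  by apply: near_eq_derive; apply: (open_near oW) Wy _ => t;
      exact: inner_transition.
rewrite !D (d2phiC w v Wy) (d2phiC z v Wy) (d2phiC z w Wy).
rewrite (christoffel_formC oUb Gbs Gbp (dphi y w) (dphi y v) _ Uy).
rewrite (christoffel_formC oUb Gbs Gbp (dphi y z) (dphi y v) _ Uy).
rewrite (christoffel_formC oUb Gbs Gbp (dphi y z) (dphi y w) _ Uy).
rewrite (inner_symm Gbp (dphi y v) (d2phi y w z) Uy)
    (inner_symm Gbp (dphi y w) (d2phi y v z) Uy).
move: (gamb (phi y)) (gb (phi y)) (dphi y) (d2phi y) => g h p q.
by field.
Qed.

(** The Christoffel symbols transform by the second derivative of the change
    of coordinates; d phi is onto, so that the previous identity determines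
    the vector. *)
Lemma christoffel_vec_transition y v w : W y ->
  dphi y (Gama y v w) = Gamb (phi y) (dphi y v) (dphi y w) + d2phi y v w.
Proof.
move=> Wy; have Gu := posdef_unit (Gap (WUa Wy)).
pose J := jacobian phi y.
have JGu : Gb (phi y) *m J^T \in unitmx.
  by move: Gu; rewrite Gab // -mulmxA unitmx_mul => /andP[].
apply: (can_inj (mulmxK JGu)); apply/rowP => i.
have H := christoffel_form_transition v w (delta_mx 0 i) Wy.
have E (u : V) : (u *m (Gb (phi y) *m J^T)) 0 i =
    gb (phi y) u (dphi y (delta_mx 0 i)).
  rewrite -jacobianE // -/J /inner trmx_mul trmx_delta !mulmxA -colE.
  by rewrite [RHS]mxE.
rewrite !E -inner_transition // -[LHS]/(gama y v w _) H.
by rewrite (linear_funD _ _ (inner_linl _ _)).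
Qed.

(** The derivative of [christoffel_form_transition] in the direction u. *)
Lemma dchristoffel_transition x u v w z : W x ->
  let p := dphi x in let q := d2phi x in let g := gamb (phi x) in
  dchristoffel Ga x u v w z = dchristoffel Gb (phi x) (p u) (p v) (p w) (p z)
   + g (q u v) (p w) (p z) + g (p v) (q u w) (p z) + g (p v) (p w) (q u z)
   + (g (p u) (q v w) (p z) + g (p u) (p z) (q v w)
      + gb (phi x) (d3phi x u v w) (p z) + gb (phi x) (q v w) (q u z)).
Proof.
move=> Wx p q g; have Ux := WUb Wx.
apply: is_der_derive.
apply: (near_eq_is_derive (f := fun y =>
  gamb (phi y) (dphi y v) (dphi y w) (dphi y z)
      + gb (phi y) (d2phi y v w) (dphi y z))).
  by apply: (open_near oW) Wx _ => y Wy; rewrite christoffel_form_transition.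
apply: is_derD.
  apply: (is_der_lin (F := fun y c => gamb (phi y) (dphi y v) (dphi y w) c)
    (dF := fun c => dchristoffel Gb (phi x) (p u) (p v) (p w) c
        + g (q u v) (p w) c + g (p v) (q u w) c)).
  - by move=> y; exact: christoffel_form_lin3.
  - move=> c; apply: (is_der_lin (F := fun y b => gamb (phi y) (dphi y v) b c)
      (dF := fun b => dchristoffel Gb (phi x) (p u) (p v) b c + g (q u v) b c)).
    + by move=> y; exact: christoffel_form_lin2.
    + move=> b; apply: (is_der_lin (F := fun y a => gamb (phi y) a b c)
        (dF := fun a => dchristoffel Gb (phi x) (p u) a b c)).
      * by move=> y; exact: christoffel_form_lin1.
      * move=> a; apply: is_der_chain (is_der_phi u Wx);
          exact: christoffel_form_diff Ux.
      * by move=> i; exact: is_der_dphi.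
    + by move=> i; exact: is_der_dphi.
  by move=> i; exact: is_der_dphi.
apply: (is_der_lin (F := fun t c => gb (phi t) (d2phi t v w) c)
 (dF := fun c => g (p u) (q v w) c + g (p u) c (q v w)
     + gb (phi x) (d3phi x u v w) c)).
- by move=> t; exact: inner_linr.
- move=> c; apply: (is_der_lin (F := fun t a => gb (phi t) a c)
   (dF := fun a => g (p u) a c + g (p u) c a)).
  + by move=> t; exact: inner_linl.
  + by move=> a; exact: is_der_inner_phi.
  + by move=> i; exact: is_der_d2phi.
by move=> i; exact: is_der_dphi.
Qed.

(** The third derivative of phi is symmetric in u and v, and all terms with
    a second derivative cancel between the linear and the quadratic part. *)
Lemma riem4_transition x u v z w : W x ->
  riem4 Ga x u v z w = riem4 Gb (phi x) (dphi x u) (dphi x v) (dphi x z)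
      (dphi x w).
Proof.
move=> Wx; have Ux := WUb Wx.
rewrite /riem4 !dchristoffel_transition // !inner_transition //
    !christoffel_vec_transition //.
have il c := inner_linl (Gb (phi x)) c; have ir c := inner_linr (Gb (phi x)) c.
rewrite !(linear_funD _ _ (il _)) !(linear_funD _ _ (ir _)).
rewrite (d2phiC v u Wx) (d3phiC v u w Wx).
rewrite !(inner_symm Gbp (d2phi _ _ _) (Gamb _ _ _) Ux).
rewrite -!/(gamb (phi x) _ _ _).
rewrite (inner_symm Gbp (d2phi x u z) _ Ux) (inner_symm Gbp (d2phi x v z) _ Ux).
move: (gamb (phi x)) (gb (phi x)) (dphi x) (d2phi x) (dchristoffel Gb (phi x))
    (d3phi x) (Gamb (phi x)).
move=> g h p q k r c; ring.
Qed.

Lemma curvature_transition x A B : W x -> curvature Ga x A B =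
  curvature Gb (phi x) (A *m jacobian phi x) (B *m jacobian phi x).
Proof.
move=> Wx; rewrite (curvature_riem4 oUa Gas Gap)
    ?(curvature_riem4 oUb Gbs Gbp); last first.
- exact: WUa.
- exact: WUb.
by rewrite !row_mul !jacobianE // riem4_transition.
Qed.

End Transition.

(** * Covariant derivative of iterated contractions *)

Section TraceRules.
Variables (R : realType) (n : nat).
Local Notation V := 'rV[R]_n.
Implicit Type H : 'M[R]_n.

Lemma inv_traceD H (B B' : V -> V -> R) :
  inv_trace H (fun u v => B u v + B' u v) = inv_trace H B + inv_trace H B'.
Proof.
rewrite /inv_trace -big_split; apply: eq_bigr => a _; rewrite -big_split.
by apply: eq_bigr => b _; rewrite mulrDr.
Qed.

Lemma inv_trace_sum H (I : finType) (B : I -> V -> V -> R) :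
  inv_trace H (fun u v => \sum_i B i u v) = \sum_i inv_trace H (B i).
Proof.
rewrite /inv_trace [RHS]exchange_big; apply: eq_bigr => a _.
rewrite [RHS]exchange_big; apply: eq_bigr => b _; exact: mulr_sumr.
Qed.

Lemma inv_trace_bilinear H (B : V -> V -> V -> V -> R) :
  (forall u v, bilinear_fun (fun a a' => B a a' u v)) ->
      bilinear_fun (fun a a' => inv_trace H (B a a')).
Proof.
move=> Bl; apply: bilinear_fun_sum => i; apply: bilinear_fun_sum => j.
by have [Bl1 Bl2] := Bl (delta_mx 0 i) (delta_mx 0 j); split=> u;
    apply: linear_fun_mull.
Qed.

Definition inv_trace4 H (F : V -> V -> V -> V -> V -> V -> V -> V -> R) :=
  inv_trace H (fun a a' => inv_trace H (fun b b' =>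
      inv_trace H (fun c c' => inv_trace H (fun e e' =>
    F a a' b b' c c' e e')))).

Lemma inv_trace4D H F F' :
  inv_trace4 H (fun a a' b b' c c' e e' =>
      F a a' b b' c c' e e' + F' a a' b b' c c' e e')
  = inv_trace4 H F + inv_trace4 H F'.
Proof.
rewrite /inv_trace4 -inv_traceD; apply: eq_inv_trace => a a';
    rewrite -inv_traceD; apply: eq_inv_trace => b b'.
by rewrite -inv_traceD; apply: eq_inv_trace => c c'; rewrite -inv_traceD.
Qed.

Lemma inv_trace4_sum H (I : finType) F :
  inv_trace4 H (fun a a' b b' c c' e e' => \sum_(i : I) F i a a' b b' c c' e e')
  = \sum_i inv_trace4 H (F i).
Proof.
rewrite /inv_trace4 -inv_trace_sum; apply: eq_inv_trace => a a';
    rewrite -inv_trace_sum; apply: eq_inv_trace => b b'.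
by rewrite -inv_trace_sum; apply: eq_inv_trace => c c'; rewrite -inv_trace_sum.
Qed.

Lemma eq_inv_trace4 H F F' : (forall a a' b b' c c' e e',
  F a a' b b' c c' e e' = F' a a' b b' c c' e e') ->
      inv_trace4 H F = inv_trace4 H F'.
Proof.
move=> FF; apply: eq_inv_trace => a a'; apply: eq_inv_trace => b b';
    apply: eq_inv_trace => c c'.
by apply: eq_inv_trace => e e'; exact: FF.
Qed.

Fixpoint contract_pow_inv_der H G (w w' : dform R n 2 2) k : form_family R n :=
  if k is j.+1 then fun s X Y =>
    contract_with_inv H w' (contract_pow_inv H G w j) X Y
        + contract_with_inv H w (contract_pow_inv_der H G w w' j) X Y
  else fun _ _ _ => 0.
Arguments contract_pow_inv_der : clear implicits.

Lemma contract_pow_inv_der_frame (E G : 'M[R]_n) w w' k :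
    quadrilinear_fun (eval4 w) -> quadrilinear_fun (eval4 w') ->
  contract_pow_inv_der (E^T *m E) G w w' k = @contract_pow_der R n G E w w' k.
Proof.
move=> wl wl'; elim: k => [//|k IH] /=.
apply: functional_extensionality_dep => s; apply/funext => X; apply/funext => Y.
rewrite IH contract_pow_inv_frame // (contract_with_inv_frame _ wl');
    last exact: contract_pow_alternating.
by rewrite (contract_with_inv_frame _ wl) //;
    exact: contract_pow_der_alternating.
Qed.

End TraceRules.

Section CovariantDerivative.
Variables (R : realType) (n : nat).
Local Notation V := 'rV[R]_n.
Local Notation d i := (delta_mx 0 i : V).
Variables (x v : V) (g : V -> V).

(** The map g is the action of the connection on vectors in the direction v;
    the row terms account for X and Y being constant in the coordinates. *)
Definition has_cov_deriv (Psi : V -> form_family R n)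
    (dPsi : form_family R n) :=
  forall s X Y, is_derive x v (fun y => Psi y s X Y)
    (dPsi s X Y + \sum_i Psi x s (set_row X i (g (row i X))) Y
                + \sum_j Psi x s X (set_row Y j (g (row j Y)))).

Variable G : V -> 'M[R]_n.
Hypothesis Gd : forall u w, is_derive x v (fun y => inner (G y) u w)
  (inner (G x) (g u) w + inner (G x) u (g w)).

Lemma mul_inner (A : 'M[R]_n) s t (X : 'M[R]_(s, n)) (Y : 'M[R]_(t, n)) i j :
  (X *m A *m Y^T) i j = inner A (row i X) (row j Y).
Proof.
rewrite /inner -row_mul [LHS]mxE [RHS]mxE; apply: eq_bigr => k _.
by congr (_ * _); rewrite !mxE.
Qed.

(** The metric is parallel. By Jacobi's formula the derivative is a sum over
    all entries; splitting each into its two halves and regrouping by rows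
    or by columns gives the terms of the connection on X or on Y. *)
Lemma gram_det_cov_deriv : has_cov_deriv (fun y => gram_det (G y))
    (fun _ _ _ => 0).
Proof.
move=> s X Y; rewrite add0r.
have Md i j : is_derive x v (fun y => (X *m G y *m Y^T) i j)
   ((\matrix_(i, j) (inner (G x) (g (row i X)) (row j Y)
                     + inner (G x) (row i X) (g (row j Y)))) i j).
  rewrite mxE (_ : (fun y => _) = fun y => inner (G y) (row i X) (row j Y)) //.
  by apply/funext => y; rewrite mul_inner.
apply: (is_derive_eq (is_der_det Md)).
pose M := X *m G x *m Y^T.
under eq_bigr => i _ do
  (under eq_bigr => j _ do rewrite mxE mulrDl; rewrite big_split /=).
rewrite big_split /=; congr (_ + _).
  apply: eq_bigr => i _; rewrite /gram_det (expand_det_row _ i).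
  apply: eq_bigr => j _; rewrite mul_inner row_set_row eqxx;
      congr (_ * (_ * \det _)).
  apply/matrixP => k l; rewrite [in LHS]mxE [in LHS]mxE [in RHS]mxE [in RHS]mxE.
  by rewrite !mul_inner row_set_row eq_sym (negbTE (neq_lift _ _)).
rewrite exchange_big; apply: eq_bigr => j _;
    rewrite /gram_det (expand_det_col _ j).
apply: eq_bigr => i _; rewrite mul_inner row_set_row eqxx;
    congr (_ * (_ * \det _)).
apply/matrixP => k l; rewrite [in LHS]mxE [in LHS]mxE [in RHS]mxE [in RHS]mxE.
by rewrite !mul_inner row_set_row eq_sym (negbTE (neq_lift _ _)).
Qed.

Variables (H : V -> 'M[R]_n) (dH : 'M[R]_n).
Hypothesis Hd : forall a b, is_derive x v (fun y => H y a b) (dH a b).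
Hypothesis dHE : forall B, bilinear_fun B -> inv_trace dH B =
  - (inv_trace (H x) (fun u u' => B (g u) u')
      + inv_trace (H x) (fun u u' => B u (g u'))).

(** The inverse metric is parallel: its derivative compensates the terms in
    which the connection acts on the two contracted arguments. *)
Lemma inv_trace_der (B : V -> V -> V -> R) D : bilinear_fun (B x) ->
  (forall u u', is_derive x v (fun y => B y u u')
                  (D u u' + (B x (g u) u' + B x u (g u')))) ->
  is_derive x v (fun y => inv_trace (H y) (B y)) (inv_trace (H x) D).
Proof.
move=> Bl Bd.
have S := is_der_bigsum (fun a => is_der_bigsum
    (fun b => is_derM (Hd a b) (Bd (d a) (d b)))).
apply: (is_derive_eq S).
transitivity (inv_trace dH (B x) + inv_trace (H x)
    (fun u u' => D u u' + (B x (g u) u' + B x u (g u')))).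
  rewrite /inv_trace -big_split; apply: eq_bigr => a _; rewrite -big_split.
  by apply: eq_bigr => b _.
by rewrite dHE // !inv_traceD addrC addrK.
Qed.

Variables (w : V -> dform R n 2 2) (w' : dform R n 2 2).
Hypothesis wl : quadrilinear_fun (eval4 (w x)).
Hypothesis wd : forall a b c e, is_derive x v (fun y => eval4 (w y) a b c e)
  (eval4 w' a b c e + (eval4 (w x) (g a) b c e + eval4 (w x) a (g b) c e
                    + eval4 (w x) a b (g c) e + eval4 (w x) a b c (g e))).

(** The product of w and Psi is contracted four times. Each contraction
    removes, by [inv_trace_der], the two connection terms of its arguments,
    so that only those of the rows of X and Y survive. *)
Lemma contract_with_inv_cov_deriv Psi dPsi : alternating_family (Psi x) ->
    has_cov_deriv Psi dPsi ->
  has_cov_deriv (fun y => contract_with_inv (H y) (w y) (Psi y))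
   (fun s X Y => contract_with_inv (H x) w' (Psi x) X Y
       + contract_with_inv (H x) (w x) dPsi X Y).
Proof.
move=> PA Pd s X Y.
pose P y a b c e := Psi y s.+2 (vcons a (vcons b X)) (vcons c (vcons e Y)).
pose F y a a' b b' c c' e e' := eval4 (w y) a b c e * P y a' b' c' e'.
pose XX i := set_row X i (g (row i X)); pose YY j := set_row Y j (g (row j Y)).
pose Q a' b' c' e' := dPsi s.+2 (vcons a' (vcons b' X)) (vcons c' (vcons e' Y))
   + \sum_i Psi x s.+2 (vcons a' (vcons b' (XX i))) (vcons c' (vcons e' Y))
   + \sum_j Psi x s.+2 (vcons a' (vcons b' X)) (vcons c' (vcons e' (YY j))).
have Pder a b c e : is_derive x v (fun y => P y a b c e)
   (Q a b c e + (P x (g a) b c e + P x a (g b) c e + P x a b (g c) e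
       + P x a b c (g e))).
  apply: (is_derive_eq (Pd _ _ _)).
  rewrite 4!big_ord_recl !row_vcons0 !set_row_vcons0 !row_vconsS
      !set_row_vconsS.
  rewrite !row_vcons0 !set_row_vcons0.
  under eq_bigr => i _ do rewrite !row_vconsS !set_row_vconsS -/(XX i).
  under [X in _ + _ + (_ + (_ + X))]eq_bigr => i _ do
    rewrite !row_vconsS !set_row_vconsS -/(YY i).
  by rewrite /Q /P; move: (\sum_i _) (\sum_i _) => ? ?; ring.
pose M a a' b b' c c' e e' := eval4 w' a b c e * P x a' b' c' e' +
  eval4 (w x) a b c e * Q a' b' c' e'.
have Fd a a' b b' c c' e e' : is_derive x v (fun y => F y a a' b b' c c' e e')
  (M a a' b b' c c' e e'
   + (F x (g a) a' b b' c c' e e' + F x a (g a') b b' c c' e e')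
   + (F x a a' (g b) b' c c' e e' + F x a a' b (g b') c c' e e')
   + (F x a a' b b' (g c) c' e e' + F x a a' b b' c (g c') e e')
   + (F x a a' b b' c c' (g e) e' + F x a a' b b' c c' e (g e'))).
  apply: (is_derive_eq (is_derM (wd a b c e) (Pder a' b' c' e'))).
  by rewrite /M /F; move: (eval4 (w x)) (eval4 w') (P x) (Q a' b' c' e') =>
      t t' p q; ring.
have [T1 T2 T3 T4] := wl.
have Fe a a' b b' c c' : bilinear_fun (F x a a' b b' c c').
  by apply: bilinear_fun_mul; [exact: T4|exact: alternating_family_lin2r].
have Fc a a' b b' : bilinear_fun (fun c c' =>
    inv_trace (H x) (F x a a' b b' c c')).
  apply: inv_trace_bilinear => e e'.
  by apply: (bilinear_fun_mul (T3 a b e)); exact: alternating_family_lin1r.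
have Fb a a' : bilinear_fun (fun b b' =>
    inv_trace (H x) (fun c c' => inv_trace (H x) (F x a a' b b' c c'))).
  apply: inv_trace_bilinear => c c'; apply: inv_trace_bilinear => e e'.
  by apply: (bilinear_fun_mul (T2 a c e)); exact: alternating_family_lin2.
have Fa : bilinear_fun (fun a a' => inv_trace (H x)
    (fun b b' => inv_trace (H x) (fun c c' =>
    inv_trace (H x) (F x a a' b b' c c')))).
  apply: inv_trace_bilinear => b b'; apply: inv_trace_bilinear => c c';
      apply: inv_trace_bilinear => e e'.
  by apply: (bilinear_fun_mul (T1 b c e)); exact: alternating_family_lin1.
have D1 a a' b b' c c' := inv_trace_der (Fe a a' b b' c c') (Fd a a' b b' c c').
have D2 a a' b b' : is_derive x v (fun y => inv_trace (H y) (fun c c' =>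
    inv_trace (H y) (F y a a' b b' c c')))
        (inv_trace (H x) (fun c c' => inv_trace (H x) (fun e e' =>
     M a a' b b' c c' e e'
   + (F x (g a) a' b b' c c' e e' + F x a (g a') b b' c c' e e')
   + (F x a a' (g b) b' c c' e e' + F x a a' b (g b') c c' e e')))).
  apply: (inv_trace_der (B := fun y c c' =>
      inv_trace (H y) (F y a a' b b' c c')) (Fc _ _ _ _)).
  move=> c c'; apply: (is_derive_eq (D1 a a' b b' c c')).
  by rewrite inv_traceD; congr (_ + _); exact: inv_traceD.
have D3 a a' : is_derive x v (fun y => inv_trace (H y)
    (fun b b' => inv_trace (H y) (fun c c' =>
    inv_trace (H y) (F y a a' b b' c c'))))
        (inv_trace (H x) (fun b b' => inv_trace (H x) (fun c c' =>
     inv_trace (H x) (fun e e' => M a a' b b' c c' e e'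
   + (F x (g a) a' b b' c c' e e' + F x a (g a') b b' c c' e e'))))).
  apply: (inv_trace_der (B := fun y b b' => inv_trace (H y) (fun c c' =>
    inv_trace (H y) (F y a a' b b' c c'))) (Fb _ _)).
  move=> b b'; apply: (is_derive_eq (D2 a a' b b')).
  rewrite -!inv_traceD; apply: eq_inv_trace => c c'; rewrite -!inv_traceD;
      exact: eq_inv_trace.
have D4 : is_derive x v (fun y => inv_trace4 (H y) (F y)) (inv_trace4 (H x) M).
  apply: (inv_trace_der (B := fun y a a' =>
      inv_trace (H y) (fun b b' => inv_trace (H y) (fun c c' =>
    inv_trace (H y) (F y a a' b b' c c')))) Fa).
  move=> a a'; apply: (is_derive_eq (D3 a a')).
  rewrite -!inv_traceD; apply: eq_inv_trace => b b'; rewrite -!inv_traceD;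
      apply: eq_inv_trace => c c'.
  by rewrite -!inv_traceD; exact: eq_inv_trace.
apply: (is_derive_eq (is_derZ 4^-1 D4)).
have LHE T Ps X' Y' : contract_with_inv (H x) T Ps X' Y' =
    4^-1 * inv_trace4 (H x)
  (fun a a' b b' c c' e e' => eval4 T a b c e *
    Ps s.+2 (vcons a' (vcons b' X')) (vcons c' (vcons e' Y'))) by [].
rewrite !LHE (eq_bigr _ (fun i _ => LHE _ _ (XX i) Y)).
rewrite (eq_bigr _ (fun j _ => LHE _ _ X (YY j))).
rewrite -!mulr_sumr -!mulrDr; congr (_ * _);
    rewrite -!inv_trace4_sum -!inv_trace4D.
apply: eq_inv_trace4 => a a' b b' c c' e e';
    rewrite /M /Q -!mulr_sumr /P !mulrDr.
by rewrite !addrA.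
Qed.

Lemma contract_pow_inv_cov_deriv k : (forall j,
    alternating_family (contract_pow_inv (H x) (G x) (w x) j)) ->
  has_cov_deriv (fun y => contract_pow_inv (H y) (G y) (w y) k)
      (contract_pow_inv_der (H x) (G x) (w x) w' k).
Proof.
move=> PA; elim: k => [|k IH]; first exact: gram_det_cov_deriv.
by have := contract_with_inv_cov_deriv (PA k) IH.
Qed.

End CovariantDerivative.

Section InverseDerivative.
Variables (R : realType) (n : nat).
Local Notation V := 'rV[R]_n.
Local Notation d i := (delta_mx 0 i : V).

(** The derivative of H is - H (dG) H, and dG = C G + G C^T for the matrix C
    of the connection. *)
Lemma invmx_der (x v : V) (g : V -> V) (G H : V -> 'M[R]_n) (dH : 'M[R]_n) :
  (forall u w, is_derive x v (fun y => inner (G y) u w)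
     (inner (G x) (g u) w + inner (G x) u (g w))) ->
  (forall a b, is_derive x v (fun y => H y a b) (dH a b)) ->
  (\near x, H x *m G x = 1%:M) ->
  forall B, bilinear_fun B -> inv_trace dH B =
  - (inv_trace (H x) (fun u u' => B (g u) u')
      + inv_trace (H x) (fun u u' => B u (g u'))).
Proof.
move=> Gd Hd HG B [Bl Br].
pose Gm := \matrix_i g (d i).
have HGx : H x *m G x = 1%:M by exact: nbhs_singleton HG.
have GHx := mulmx1C HGx.
have Gmr c : g (d c) = row c Gm by apply/rowP => j; rewrite !mxE.
have dr c : d c = row c (1%:M : 'M[R]_n) by rewrite row1.
(* derivative of H G = 1 *)
have DHG : dH *m G x + H x *m (Gm *m G x + G x *m Gm^T) = 0.
  apply/matrixP => a b.
  have S := is_der_bigsum (fun c => is_derM (Hd a c) (Gd (d c) (d b))).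
  have S0 : is_derive x v (fun y => \sum_c H y a c * inner (G y) (d c) (d b)) 0.
    apply: (near_eq_is_derive (f := fun y : V => (a == b)%:R : R)).
    apply: filterS HG => y /matrixP/(_ a b);
        rewrite mxE [in X in X -> _]mxE => <-.
    by apply: eq_bigr => c _; rewrite inner_delta.
  rewrite [RHS]mxE -(is_der_unique S S0) mxE [X in X + _]mxE [X in _ + X]mxE
      -big_split.
  apply: eq_bigr => c _; rewrite inner_delta; congr (_ * _ + _ * _).
  by rewrite mxE !Gmr (dr b) (dr c) -!mul_inner trmx1 mulmx1 mul1mx.
have dHM : dH = - (H x *m Gm + Gm^T *m H x).
  rewrite -[LHS]mulmx1 -GHx mulmxA.
  move/eqP: DHG; rewrite addr_eq0 => /eqP ->.
  rewrite mulNmx mulmxDr mulmxDl; congr (- (_ + _)).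
    by rewrite -!mulmxA GHx mulmx1.
  by rewrite !mulmxA HGx mul1mx.
have E1 : inv_trace (H x *m Gm) B = inv_trace (H x) (fun u u' => B u (g u')).
  apply: eq_bigr => a _.
  under eq_bigr => b _ do rewrite mxE mulr_suml.
  rewrite exchange_big; apply: eq_bigr => c _ /=.
  rewrite [in RHS](linear_fun_delta (g (d c)) (Br (d a))) mulr_sumr.
  by apply: eq_bigr => b _; rewrite Gmr [row c Gm 0 b]mxE mulrA.
have E2 : inv_trace (Gm^T *m H x) B = inv_trace (H x) (fun u u' => B (g u) u').
  rewrite [LHS]exchange_big [RHS]exchange_big; apply: eq_bigr => b _.
  under eq_bigr => a _ do rewrite mxE mulr_suml.
  rewrite exchange_big; apply: eq_bigr => c _ /=.
  rewrite [in RHS](linear_fun_delta (g (d c)) (Bl (d b))) mulr_sumr.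
  apply: eq_bigr => a _; rewrite Gmr [row c Gm 0 a]mxE [Gm^T a c]mxE.
  by rewrite mulrCA mulrA.
rewrite dHM -E1 -E2 /inv_trace -big_split -sumrN; apply: eq_bigr => a _.
rewrite -big_split -sumrN; apply: eq_bigr => b _ /=; rewrite [in LHS]mxE.
by rewrite mulNr; congr (- _); rewrite mxE mulrDl addrC.
Qed.

End InverseDerivative.

(** * Iterated contractions of the curvature on a manifold *)

Section SmoothContraction.
Variables (R : realType) (n : nat).
Local Notation V := 'rV[R]_n.
Variables (U : set V) (oU : open U).

Lemma inv_trace_smooth (H : V -> 'M[R]_n) (B : V -> V -> V -> R) :
  (forall a b, smooth_on U (fun y => H y a b)) ->
  (forall u v, smooth_on U (fun y => B y u v)) ->
  smooth_on U (fun y => inv_trace (H y) (B y)).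
Proof.
by move=> Hs Bs; do 2![apply: (smooth_sum oU) => ?]; exact: (smoothM oU).
Qed.

Lemma contract_pow_inv_smooth (H G : V -> 'M[R]_n) (w : V -> dform R n 2 2) k s
    X Y :
  (forall a b, smooth_on U (fun y => H y a b)) ->
  (forall i j, smooth_on U (fun y => G y i j)) ->
  (forall a b c e, smooth_on U (fun y => eval4 (w y) a b c e)) ->
  smooth_on U (fun y => contract_pow_inv (H y) (G y) (w y) k s X Y).
Proof.
move=> Hs Gs ws; elim: k s X Y => [|k IH] s X Y.
  apply: (smooth_det oU) => i j.
  apply: (smooth_ext oU _ (inner_smooth oU Gs (row i X) (row j Y))) => y _.
  by rewrite mul_inner.
apply: (smoothZ oU).
apply: (inv_trace_smooth (B := fun y a a' =>
    inv_trace (H y) (fun b b' => inv_trace (H y) (fun c c' =>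
  inv_trace (H y) (fun e e' => eval4 (w y) a b c e
      * contract_pow_inv (H y) (G y) (w y) k s.+2
    (vcons a' (vcons b' X)) (vcons c' (vcons e' Y))))))) => // a a'.
apply: (inv_trace_smooth (B := fun y b b' => inv_trace (H y) (fun c c' =>
  inv_trace (H y) (fun e e' => eval4 (w y) a b c e
      * contract_pow_inv (H y) (G y) (w y) k s.+2
    (vcons a' (vcons b' X)) (vcons c' (vcons e' Y)))))) => // b b'.
apply: (inv_trace_smooth (B := fun y c c' =>
  inv_trace (H y) (fun e e' => eval4 (w y) a b c e
      * contract_pow_inv (H y) (G y) (w y) k s.+2
    (vcons a' (vcons b' X)) (vcons c' (vcons e' Y))))) => // c c'.
apply: (inv_trace_smooth (B := fun y e e' =>
    eval4 (w y) a b c e * contract_pow_inv (H y) (G y) (w y) k s.+2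
    (vcons a' (vcons b' X)) (vcons c' (vcons e' Y)))) => // e e'.
by apply: (smoothM oU).
Qed.

End SmoothContraction.

Section MetricChart.
Variables (R : realType) (n k : nat).
Local Notation V := 'rV[R]_n.
Variables (U : set V) (G : V -> 'M[R]_n).
Hypothesis oU : open U.
Hypothesis Gs : forall i j, smooth_on U (fun x => G x i j).
Hypothesis Gp : forall x, U x -> posdef (G x).

Local Notation Rm := (curvature G).
Local Notation E x := (onb (G x)).
Local Notation P x := (iter k (contract_with (E x) (Rm x)) (gram_det (G x))).

Lemma curvature_quadrilinear x : U x -> quadrilinear_fun (eval4 (Rm x)).
Proof.
move=> Ux; have [r1 r2 r3 r4] := riem4_quadrilinear oU Gs Gp Ux.
have eE a b c e := eval4_curvature oU Gs Gp a b c e Ux.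
by split=> a b c d u v; rewrite !eE ?r1 ?r2 ?r3 ?r4.
Qed.

Lemma contract_pow_frame_free x : U x ->
    P x = contract_pow_inv (invmx (G x)) (G x) (Rm x) k.
Proof.
move=> Ux; rewrite -(frame_invmx (onbP (Gp Ux))) contract_pow_inv_frame //.
exact: curvature_quadrilinear.
Qed.

Lemma hodge_contract_pow x m r (X Y : 'M[R]_(r, n)) : U x ->
    (m + 2 * k + r)%N = n ->
  (m`!%:R)^-1 *
    hodge (G x) r r (wedge (dpow (metric_form (G x)) m) (dpow (Rm x) k)) X Y
  = P x r X Y.
Proof.
move=> Ux mkr; have [Gsym _] := Gp Ux.
exact: (hodge_curvature Gsym (onbP (Gp Ux)) _ _ _ erefl mkr).
Qed.

Lemma curvature_sym x A B : U x -> Rm x A B = Rm x B A.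
Proof.
by move=> Ux; rewrite !(curvature_riem4 oU Gs Gp) // (riem4_pair oU Gs Gp).
Qed.

Lemma bianchi_contract_pow x : U x -> bianchi_family (P x).
Proof.
move=> Ux; have [Gsym _] := Gp Ux; have EGE := onbP (Gp Ux).
have eE a b c e := eval4_curvature oU Gs Gp a b c e Ux.
elim: k => [|j IH]; first exact: (bianchi_gram_det Gsym EGE).
rewrite iterS; apply: bianchi_contract_with => //;
    first exact: contract_pow_alternating.
  by move=> a b c e; rewrite !eE; exact: (riem4_bianchi oU Gs Gp).
by move=> a b c e; rewrite !eE; exact: riem4_anti.
Qed.

Lemma smooth_contract_pow s X Y : smooth_on U (fun x => P x s X Y).
Proof.
apply: (@smooth_ext _ _ _ oU (fun x => contract_pow_inv (invmx (G x)) (G x)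
    (Rm x) k s X Y)).
  by move=> x Ux; rewrite contract_pow_frame_free.
apply: (contract_pow_inv_smooth oU) => //.
  by apply: (smooth_invmx oU) => // x Ux; exact: posdef_unit (Gp Ux).
move=> a b c e; apply: (smooth_ext oU _ (riem4_smooth oU Gs Gp a b c e)) =>
    x Ux.
by rewrite (eval4_curvature oU Gs Gp).
Qed.

(** The frame-free expression is differentiated, and the result is written
    again in the orthonormal frame at x. *)
Lemma cov_deriv_contract_pow x v s (X Y : 'M[R]_(s, n)) : U x ->
  cov_deriv G (fun y => P y s) x v X Y =
  @contract_pow_der R n (G x) (E x) (Rm x) (cov_deriv G Rm x v) k s X Y.
Proof.
move=> Ux; pose H y := invmx (G y).
have Hs a b : smooth_on U (fun y => H y a b).
  by apply: (smooth_invmx oU) => // y Uy; exact: posdef_unit (Gp Uy).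
pose dH : 'M[R]_n := \matrix_(a, b) 'D_v (fun y => H y a b) x.
have Hd a b : is_derive x v (fun y => H y a b) (dH a b).
  by rewrite mxE; apply: diff_is_der; exact: smooth_diff (Hs a b) Ux.
pose g := christoffel_vec G x v.
have Gd u w : is_derive x v (fun y => inner (G y) u w)
    (inner (G x) (g u) w + inner (G x) u (g w)).
  rewrite (inner_symm Gp u (g w) Ux); exact: (is_der_inner oU Gs Gp v u w Ux).
have dHE := invmx_der Gd Hd (open_near oU Ux
    (fun y Uy => mulVmx (posdef_unit (Gp Uy)))).
have wd a b c e : is_derive x v (fun y => eval4 (Rm y) a b c e)
  (eval4 (cov_deriv G Rm x v) a b c e +
      (eval4 (Rm x) (g a) b c e + eval4 (Rm x) a (g b) c e
                    + eval4 (Rm x) a b (g c) e + eval4 (Rm x) a b c (g e))).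
  rewrite eval4_cov_deriv.
  have D : is_derive x v (fun y => eval4 (Rm y) a b c e)
      ('D_v (fun y => eval4 (Rm y) a b c e) x).
    apply: diff_is_der; apply: smooth_diff Ux.
    apply: (smooth_ext oU _ (riem4_smooth oU Gs Gp a b c e)) => y Uy.
    by rewrite (eval4_curvature oU Gs Gp).
  apply: (is_derive_eq D); rewrite -/g.
  by move: ('D_v _ x) (eval4 (Rm x)) => D0 f; ring.
have wl := curvature_quadrilinear Ux.
have PA j : alternating_family (contract_pow_inv (H x) (G x) (Rm x) j).
  by rewrite /H -(frame_invmx (onbP (Gp Ux))) contract_pow_inv_frame //;
      exact: contract_pow_alternating.
have Pd := contract_pow_inv_cov_deriv Gd Hd dHE wl wd k PA X Y.
have wl' : quadrilinear_fun (eval4 (cov_deriv G Rm x v)).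
  have [r1 r2 r3 r4] := cov_riem4_quadrilinear oU Gs Gp v Ux.
  have eE a b c e := eval4_cov_curvature oU Gs Gp v a b c e Ux.
  by split=> a b c d u w; rewrite !eE ?r1 ?r2 ?r3 ?r4.
rewrite /cov_deriv.
have -> : 'D_v (fun y => P y s X Y) x =
    'D_v (fun y => contract_pow_inv (H y) (G y) (Rm y) k s X Y) x.
  by apply: near_eq_derive; apply: (open_near oU) Ux _ => y Uy;
      rewrite contract_pow_frame_free.
rewrite (is_der_derive Pd) contract_pow_frame_free // -/(H x) -/g.
rewrite {1}/H -(frame_invmx (onbP (Gp Ux))) contract_pow_inv_der_frame //.
by rewrite addrAC !addrK.
Qed.

Lemma div_free_contract_pow x s (X : 'M[R]_(s, n)) (Y : 'M[R]_(s.+1, n)) :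
    U x ->
  \sum_(i < n) cov_deriv G (fun y => P y s.+1) x (row i (E x))
      (vcons (row i (E x)) X) Y = 0.
Proof.
move=> Ux; under eq_bigr => i _ do rewrite cov_deriv_contract_pow //.
apply: div_contract_pow => a b c p q; rewrite !(eval4_cov_curvature oU Gs Gp)
    //.
exact: (second_bianchi oU Gs Gp).
Qed.

End MetricChart.

Section Overlap.
Variables (R : realType) (n : nat) (M : smooth_manifold R n).

(** In the coordinates of the chart a the overlap is the part of the image
    of a that the continuous parametrization sends to the open domain of b. *)
Lemma open_chart_overlap (a b : chart M) : open (chart_overlap a b).
Proof.
rewrite openE => _ [p [pa pb] <-].
have imp : chart_img a (chart_coord a p) by exists p.
have pc := chart_param_continuous imp.
have nb : nbhs (chart_param a (chart_coord a p)) (chart_dom b).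
  by rewrite chart_coordK //; apply: open_nbhs_nbhs; split=> //;
      exact: open_chart_dom.
have na : nbhs (chart_coord a p) (chart_img a).
  by apply: open_nbhs_nbhs; split=> //; exact: open_chart_img.
apply: filterS2 na (pc _ nb) => y [q qa <-] /=; rewrite chart_coordK // => qb.
by exists q.
Qed.

End Overlap.

Section Tensors.
Variables (R : realType) (n k : nat) (M : smooth_manifold R n).
Variable g : riemannian_metric M.
Hypothesis hk : (2 * k + 2 <= n)%N.
Local Notation V := 'rV[R]_n.

Let oU a := @open_chart_img R n M a.
Let Gs a := @metric_smooth R n M g a.
Let Gp a := @metric_posdef R n M g a.

Local Notation P a x :=
  (iter k (contract_with (onb (g a x)) (curvature (g a) x)) (gram_det (g a x))).

Lemma N2kE a x X Y : chart_img a x -> N2k g k a x X Y = P a x 2 X Y.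
Proof.
move=> ax; apply: (hodge_contract_pow (@Gp a) X Y ax).
by rewrite -subnDA -addnA subnK.
Qed.

Lemma T2kE a x X Y : chart_img a x -> T2k g k a x X Y = P a x 1 X Y.
Proof.
move=> ax; apply: (hodge_contract_pow (@Gp a) X Y ax).
by rewrite -subnDA -addnA subnK // (leq_trans _ hk) // leq_add2l.
Qed.

Lemma h2kE a x : chart_img a x -> h2k g k a x = P a x 0 0 0.
Proof.
move=> ax; apply: (hodge_contract_pow (@Gp a) 0 0 ax).
by rewrite addn0 subnK // (leq_trans _ hk) // leq_addr.
Qed.

(** The differential of the transition carries the frame chosen in the chart
    a to an orthonormal frame in the chart b. It need not be the one chosen
    there, but the contraction depends only on the inverse Gram matrix. *)
Lemma N2k_transition a b x X Y : chart_overlap a b x ->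
  N2k g k a x X Y = N2k g k b (transition a b x)
      (X *m jacobian (transition a b) x)
                                                 (Y *m jacobian (transition a
                                                     b) x).
Proof.
move=> abx; set J := jacobian _ _; set y := transition a b x.
have Wa z : chart_overlap a b z -> chart_img a z by case=> p [pa _] <-;
    exists p.
have Wb z : chart_overlap a b z -> chart_img b (transition a b z).
  by case=> p [pa pb] <-; rewrite /transition chart_coordK //; exists p.
have ax := Wa _ abx; have bx := Wb _ abx.
rewrite !N2kE // (@contract_pow_natural R n J _ _ (g b y) _
    (curvature (g b) y)).
- have EGE : (onb (g a x) *m J) *m g b y *m (onb (g a x) *m J)^T = 1%:M.
    have := onbP (Gp ax); rewrite {2}(metric_transition g abx) => <-.
    by rewrite trmx_mul !mulmxA.
  have wl := curvature_quadrilinear (@oU b) (@Gs b) (@Gp b) bx.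
  rewrite -!(contract_pow_inv_frame _ _ _ wl) (frame_invmx EGE).
  by rewrite (frame_invmx (onbP (Gp bx))).
- exact: metric_transition.
move=> A B.
exact: (curvature_transition (@oU a) (@oU b) (@open_chart_overlap _ _ _ a b)
  Wa Wb (@Gs a) (@Gp a) (@Gs b) (@Gp b) (fun i => transition_smooth i)
  (fun z => @metric_transition _ _ _ g a b z)).
Qed.

Lemma vcons_nil (v : V) (Z : 'M[R]_(0, n)) : vcons v Z = v.
Proof.
apply: vcons_ext => i; rewrite (ord1 i) row_vcons0.
by apply/rowP => j; rewrite mxE.
Qed.

(** The identity for families in degree 2, for X = (u, v, y) and Y = z. *)
Lemma N2k_bianchi : first_bianchi (N2k g k).
Proof.
move=> a x ax u v y z; rewrite !N2kE //.
have PA := contract_pow_alternating (g a x) (onb (g a x)) (curvature (g a) x) k.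
(* the empty list of rows: all matrices become lists of rows ending in it *)
pose o : 'M[R]_(0, n) := 0.
have := bianchi_contract_pow k (@oU a) (@Gs a) (@Gp a) ax
  (vcons u (vcons v (vcons y o))) (vcons z o).
rewrite 3!big_ord_recl big_ord0 addr0.
rewrite !row'_vconsS !row'_vcons0 !row_vconsS !row_vcons0.
have -> : (-1) ^+ (lift ord0 (lift ord0 ord0) : 'I_3) =
    1 :> R by rewrite sqrrN expr1n.
have -> : (-1) ^+ (lift ord0 ord0 : 'I_3) = - 1 :> R by rewrite expr1.
rewrite expr0 !mul1r mulN1r -(altform_swap y u o (proj1 (PA 2) _)).
rewrite !vcons_nil !vconsE => <-.
by rewrite -[LHS]addrA [RHS]addrA [RHS]addrC.
Qed.

Lemma N2k_divergence_free : divergence_free g (N2k g k).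
Proof.
move=> a x ax u y z e.
rewrite -[RHS](div_free_contract_pow k (@oU a) (@Gs a) (@Gp a) u (vcons y z)
    ax).
apply: eq_bigr => i _; rewrite /cov_deriv -!vconsE -/(e i); congr (_ - _ - _).
- by apply: near_eq_derive; apply: (open_near (@oU a)) ax _ => t at_;
    rewrite N2kE.
- by apply: eq_bigr => j _; rewrite N2kE.
by apply: eq_bigr => j _; rewrite N2kE.
Qed.

Lemma N2k_double_form : is_double_form (N2k g k).
Proof.
split=> [a x ax|a X Y|a b x X Y]; last exact: N2k_transition.
  have PA := contract_pow_alternating (g a x) (onb (g a x)) (curvature (g a) x)
      k 2.
  have -> : N2k g k a x = P a x 2.
    by apply/funext => X; apply/funext => Y; exact: N2kE.
  by split=> Z; split; [apply/multilinear_set_row| |apply/multilinear_set_row|];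
    [exact: (proj1 (proj1 PA Z))|exact: (proj2 (proj1 PA Z))
    |exact: (proj1 (proj2 PA Z))|exact: (proj2 (proj2 PA Z))].
apply: (smooth_ext (@oU a) _ (smooth_contract_pow k (@oU a) (@Gs a) (@Gp a) X
    Y)) => x ax.
by rewrite N2kE.
Qed.

Lemma N2k_sym : symmetric_double_form (N2k g k).
Proof.
move=> a x X Y ax; have [Gsym _] := Gp ax.
rewrite !N2kE // contract_pow_sym // => A B.
exact: (curvature_sym (@oU a) (@Gs a) (@Gp a)).
Qed.

Lemma contr_N2k a x X Y : chart_img a x ->
  contr (g a x) (N2k g k a x) X Y = (n - 2 * k - 1)%:R * T2k g k a x X Y.
Proof.
move=> ax; have [Gsym _] := Gp ax; rewrite T2kE //.
have le1 : (2 * k + 1 <= n)%N by rewrite (leq_trans _ hk) // leq_add2l.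
rewrite -subnDA (natrB _ le1) -(trace_contract_pow Gsym (onbP (Gp ax))).
by apply: eq_bigr => i _; rewrite N2kE // !vconsE.
Qed.

Lemma contr2_N2k a x X Y : chart_img a x ->
  contr (g a x) (contr (g a x) (N2k g k a x)) X Y
  = (n - 2 * k)%:R * (n - 2 * k - 1)%:R * h2k g k a x.
Proof.
move=> ax; have [Gsym _] := Gp ax; rewrite h2kE //.
have le0 : (2 * k <= n)%N by rewrite (leq_trans _ hk) // leq_addr.
rewrite {1}/contr; under eq_bigr => i _ do rewrite contr_N2k // T2kE //.
rewrite -mulr_sumr [_ * (n - 2 * k - 1)%:R]mulrC -mulrA; congr (_ * _).
rewrite (flatmx0 X) (flatmx0 Y).
have := trace_contract_pow Gsym (onbP (Gp ax)) (curvature (g a) x) k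
    (0 : 'M[R]_(0, n)) 0.
rewrite addn0 -natrB // => <-.
by apply: eq_bigr => i _; rewrite !vconsE.
Qed.

End Tensors.

Theorem theoremA6 (R : realType) (n k : nat) (M : smooth_manifold R n)
    (g : riemannian_metric M) (hk : (2 * k + 2 <= n)%N) :
  [/\ is_double_form (N2k g k),
      symmetric_double_form (N2k g k),
      first_bianchi (N2k g k)
    & divergence_free g (N2k g k)] /\
  (forall (a : chart M) (x : 'rV[R]_n), chart_img a x ->
     (forall X Y : 'M[R]_(1, n),
        contr (g a x) (N2k g k a x) X Y
        = (n - 2 * k - 1)%:R * T2k g k a x X Y) /\
     (forall X Y : 'M[R]_(0, n),
        contr (g a x) (contr (g a x) (N2k g k a x)) X Y
        = (n - 2 * k)%:R * (n - 2 * k - 1)%:R * h2k g k a x)).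
Proof.
split.
  split; [exact: N2k_double_form|exact: N2k_sym|exact: N2k_bianchi|].
  exact: N2k_divergence_free.
by move=> a x ax; split=> X Y; [exact: contr_N2k|exact: contr2_N2k].
Qed.
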